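(* Let $M$ be a compact manifold with boundary, with (possibly time-dependent) Riemannian metrics $g(t)$, $t\in[0,T]$, and let $V\to M$ be a real vector bundle with a fixed fiber metric $\widetilde h$ and time-dependent metric connections $D=D^{(t)}$. Let $\phi:V\to V$ be a fiber-preserving locally Lipschitz map. Let $C(t)\subset V$, $t\in[0,T]$, be a family of closed subsets depending continuously on $t$. Suppose that for each $t$, $C(t)$ is invariant under parallel transport and fiberwise convex (i.e. $C_x(t)=C(t)\cap V_x$ is convex for every $x\in M$), and that the family $\{C(t)\}$ is preserved by the ODE $\frac{df}{dt}=\phi(f)$ in the fibers of $V$. Let $f(x,t)$ be a family of smooth sections of $V$ on $[0,T]$, and put $\mathcal{D}(t)=\max_{y\in M}\operatorname{dist}(f(y,t),C_y(t))$. Assume that for any $t>0$ with $\mathcal{D}(t)>0$ and any $x\in M$ satisfying $\operatorname{dist}(f(x,t),C_x(t))=\mathcal{D}(t)$, there exist, locally near $x$, vector fields $X_i$, $1\le i\le k$, and $Y_j$, $1\le j\le l$, for some nonnegative integers $k,l$, such that at $(x,t)$ $$\frac{\partial f}{\partial t}-\sum_{i=1}^k D^2_{X_iX_i}f-\sum_{j=1}^l D_{Y_j}f-\phi(f)\in T^{\mathcal{C}}_{v(x,t)}C_x(t),$$ where $v(x,t)\in C_x(t)$ is the vector in $V_x$ with $\operatorname{dist}(f(x,t),v(x,t))=\operatorname{dist}(f(x,t),C_x(t))$. Assume also that for $(x,t)\in\partial M\times[0,T]$, if $\operatorname{dist}(f(x,t),C_x(t))=\mathcal{D}(t)>0$,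 then the exterior normal derivative satisfies $D_\nu f(x,t)\in T^{\mathcal{C}}_{v(x,t)}C_x(t)$, with $v(x,t)$ defined in the same way. Then, if $f(x,0)\in C(0)$ for all $x\in M$, one has $f(x,t)\in C(t)$ for all $x\in M$ and all $t\in(0,T]$.
   Context: $V_x$ is the fiber of $V$ over $x$; distances and inner products in $V_x$ are with respect to $\widetilde h$. A metric connection is one compatible with $\widetilde h$; parallel transport at time $t$ is with respect to $D^{(t)}$. With $\nabla=\nabla^{(t)}$ the Levi-Civita connection of $g(t)$, $D^2_{XY}f=D_XD_Yf-D_{\nabla_XY}f$. $\nu$ is the exterior unit normal to $\partial M$. Tangent cone: for a closed set $X$ in a Euclidean space and $p\in X$, $T^{\mathcal{C}}_pX$ is the set of vectors $\xi$ such that $\langle\xi,p-x_1\rangle\ge 0$ for every $x_1\in X^c$ (the complement of $X$) with $\operatorname{dist}(x_1,p)=\operatorname{dist}(x_1,X)$. This is applied to $C_x(t)\subset V_x$. $C(t)$ depends continuously on $t$ if the family of sets $C(t)$ is continuous in $t$ with respect to the pointed Hausdorff topology. The ODE preserves the family $\{C(t)\}$ if for every $x\in M$, every $0\le t_0\le t_1\le T$ and every solution $f:[t_0,t_1]\to V_x$ of $\frac{df}{dt}=\phi(f)$ with $f(t_0)\in C_x(t_0)$, one has $f(t)\in C_x(t)$ for all $t\in[t_0,t_1]$. *)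

(* Defs.v *)
From HB Require Import structures.
From mathcomp Require Import all_boot all_order all_algebra.
From mathcomp Require Import all_classical all_reals all_analysis.

Set Implicit Arguments.
Unset Strict Implicit.
Unset Printing Implicit Defensive.

Import Order.TTheory GRing.Theory Num.Theory.
Import numFieldNormedType.Exports.

Local Open Scope classical_set_scope.
Local Open Scope ring_scope.

Section Calculus.
Context {R : realType} {E F : normedModType R}.

Fixpoint Ck (U : set E) (k : nat) (f : E -> F) : Prop :=
  match k with
  | 0%N => forall p, U p -> {for p, continuous f}
  | k'.+1 => (forall p, U p -> differentiable f p) /\
             (forall v, Ck U k' (fun p => 'D_v f p))
  end.

(* Smoothness on a set that need not be open: local C^oo extensions exist. *)
Definition smooth_on (S : set E) (f : E -> F) : Prop :=
  forall p, S p -> exists (U : set E) (f' : E -> F),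
    [/\ open U, U p, (forall k, Ck U k f')
      & forall q, U q -> S q -> f q = f' q].

Definition diff_quot (f : E -> F) (u p : E) (h : R) : F :=
  h^-1 *: (f (p + h *: u) - f p).

(* The increments h for which p + h u stays in S.  At a boundary point of a
   half-space or of an interval this yields the one-sided derivative. *)
Definition steps (S : set E) (u p : E) : set_system R :=
  within [set h : R | S (p + h *: u)] (dnbhs (0 : R)).

Definition deriv_in (S : set E) (f : E -> F) (u p : E) : F :=
  lim (diff_quot f u p @ steps S u p).

Definition is_deriv_in (S : set E) (f : E -> F) (u p : E) (l : F) : Prop :=
  diff_quot f u p @ steps S u p --> l.

End Calculus.

Definition seg {R : realType} (a b : R) : set R^o := [set s | a <= s <= b].

Section Distance.
Context {R : realType} {W : normedModType R}.

(* Meaningful for nonempty X only: the library sets [inf set0 = 0]. *)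
Definition dist_set (w : W) (X : set W) : R := inf [set `|w - c| | c in X].

Definition nearest (w : W) (X : set W) (v : W) : Prop :=
  X v /\ `|w - v| = dist_set w X.

End Distance.

(* For n = 0 there is no such i and this is all of R^0. *)
Definition half_space {R : realType} {n : nat} : set 'rV[R]_n :=
  [set p | forall i : 'I_n, i = 0%N :> nat -> 0 <= p ord0 i].

Record bd_atlas (R : realType) (n : nat) (M : topologicalType) := BdAtlas {
  chart : Type;
  chart_dom : chart -> set M;
  chart_coord : chart -> M -> 'rV[R]_n;
  chart_point : chart -> 'rV[R]_n -> M;
  dom_open : forall a, open (chart_dom a);
  dom_cover : forall x, exists a, chart_dom a x;
  coord_open : forall a, exists O : set 'rV[R]_n,
    open O /\ chart_coord a @` chart_dom a = O `&` half_space;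
  coordK : forall a x, chart_dom a x -> chart_point a (chart_coord a x) = x;
  coord_cont : forall a, {within chart_dom a, continuous (chart_coord a)};
  point_cont : forall a,
    {within chart_coord a @` chart_dom a, continuous (chart_point a)};
  transition_smooth : forall a b,
    smooth_on (chart_coord a @` (chart_dom a `&` chart_dom b))
              (fun p => chart_coord b (chart_point a p))
}.

Section Manifold.
Context {R : realType} {n : nat} {M : topologicalType}.
Variable A : bd_atlas R n M.
Local Notation vec := 'rV[R]_n.

Definition chart_img (a : chart A) : set vec := chart_coord a @` chart_dom a.

Definition e_ (i : 'I_n) : vec := delta_mx ord0 i.

(* Which points are boundary points does not depend on the chart. *)
Definition boundary : set M :=
  [set x | exists (a : chart A) (i : 'I_n),
    [/\ chart_dom a x, i = 0%N :> nat & chart_coord a x ord0 i = 0]].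

Definition jacobian (a b : chart A) (p : vec) : 'M[R]_n :=
  \matrix_(i, k)
    deriv_in (chart_img a) (fun q => chart_coord b (chart_point a q))
             (e_ i) p ord0 k.

Definition cylinder (a : chart A) (T : R) : set (vec * R^o) :=
  chart_img a `*` seg 0 T.

Definition local_field (a : chart A) (x : M) (X : vec -> vec) : Prop :=
  exists O : set vec,
    [/\ open O, O (chart_coord a x) & smooth_on (O `&` chart_img a) X].

Definition bracket (a : chart A) (X Y : vec -> vec) (p : vec) : vec :=
  \sum_i (X p ord0 i *: deriv_in (chart_img a) Y (e_ i) p
          - Y p ord0 i *: deriv_in (chart_img a) X (e_ i) p).

(* Connections on a rank k bundle with transition matrices [tr a b], where
   sections are row vectors and s_b = s_a *m tr a b.  The coefficients G are
   those of D_i e_j = \sum_l (G i)_jl e_l, so that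
   D_i s = \partial_i s + s *m G i. *)
Section Connection.
Context {k : nat}.
Local Notation sec := 'rV[R]_k.
Local Notation coeffs := ('I_n -> 'M[R]_k).

Definition cov_vec (a : chart A) (G : vec -> coeffs) (u : vec)
    (s : vec -> sec) (p : vec) : sec :=
  \sum_i u ord0 i *: (deriv_in (chart_img a) s (e_ i) p + s p *m G p i).

Definition cov (a : chart A) (G : vec -> coeffs) (X : vec -> vec)
    (s : vec -> sec) : vec -> sec :=
  fun p => cov_vec a G (X p) s p.

(* The second condition says that D_i s, computed in the charts a and b,
   is the same vector. *)
Definition is_connection (tr : chart A -> chart A -> vec -> 'M[R]_k) (T : R)
    (G : chart A -> R -> vec -> coeffs) : Prop :=
  (forall a i, smooth_on (cylinder a T) (fun q => G a q.2 q.1 i)) /\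
  (forall a b x t i, chart_dom a x -> chart_dom b x -> 0 <= t <= T ->
    let p := chart_coord a x in
    G a t p i *m tr a b p =
      deriv_in (chart_img a) (tr a b) (e_ i) p
      + \sum_j jacobian a b p i j *: (tr a b p *m G b t (chart_coord b x) j)).

Definition metric_compatible (a : chart A) (h : vec -> sec -> sec -> R)
    (G : vec -> coeffs) : Prop :=
  forall s1 s2 : vec -> sec,
  smooth_on (chart_img a) s1 -> smooth_on (chart_img a) s2 ->
  forall (u p : vec), chart_img a p ->
    deriv_in (chart_img a) (fun q => h q (s1 q) (s2 q) : R^o) u p =
      h p (cov_vec a G u s1 p) (s2 p) + h p (s1 p) (cov_vec a G u s2 p).

End Connection.

Definition metric_form (m : 'M[R]_n) (u w : vec) : R :=
  (u *m m *m w^T) ord0 ord0.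

Definition is_riemannian (T : R) (g : chart A -> R -> vec -> 'M[R]_n) : Prop :=
  [/\ forall a, smooth_on (cylinder a T) (fun q => g a q.2 q.1),
      forall a t p, 0 <= t <= T -> chart_img a p ->
        (g a t p)^T = g a t p /\
        forall u, u != 0 -> 0 < metric_form (g a t p) u u
    & forall a b x t, chart_dom a x -> chart_dom b x -> 0 <= t <= T ->
        let J := jacobian a b (chart_coord a x) in
        g a t (chart_coord a x) = J *m g b t (chart_coord b x) *m J^T].

Definition is_levi_civita (T : R) (g : chart A -> R -> vec -> 'M[R]_n)
    (N : chart A -> R -> vec -> 'I_n -> 'M[R]_n) : Prop :=
  is_connection jacobian T N /\
  forall a t, 0 <= t <= T ->
    metric_compatible a (fun p => metric_form (g a t p)) (N a t) /\
    forall X Y : vec -> vec,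
    smooth_on (chart_img a) X -> smooth_on (chart_img a) Y ->
    forall p, chart_img a p ->
      cov a (N a t) X Y p - cov a (N a t) Y X p = bracket a X Y p.

Definition outer_unit_normal (g : chart A -> R -> vec -> 'M[R]_n)
    (a : chart A) (t : R) (p nu : vec) : Prop :=
  [/\ metric_form (g a t p) nu nu = 1,
      forall u : vec, (forall i : 'I_n, i = 0%N :> nat -> u ord0 i = 0) ->
        metric_form (g a t p) nu u = 0
    & forall i : 'I_n, i = 0%N :> nat -> nu ord0 i < 0].

(* N are the coefficients of \nabla and G those of D. *)
Definition cov2 {k} (a : chart A) (N : vec -> 'I_n -> 'M[R]_n)
    (G : vec -> 'I_n -> 'M[R]_k) (X Y : vec -> vec) (s : vec -> 'rV[R]_k)
    (p : vec) : 'rV[R]_k :=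
  cov a G X (cov a G Y s) p - cov a G (cov a N X Y) s p.

Definition smooth_curve (c : R -> M) : Prop :=
  {within seg 0 1, continuous c} /\
  forall a : chart A,
    smooth_on [set s : R^o | 0 <= s <= 1 /\ chart_dom a (c s)]
              (fun s => chart_coord a (c s)).

End Manifold.

(* The bundle is trivialized over the chart domains, which is no restriction
   as the charts may be shrunk.  The norm of each fiber is the one of the
   fiber metric [ip]. *)
Record metric_bundle (R : realType) (n : nat) (M : topologicalType)
    (A : bd_atlas R n M) (r : nat) := MetricBundle {
  fiber : M -> normedModType R;
  ip : forall x, fiber x -> fiber x -> R;
  triv : chart A -> forall x, fiber x -> 'rV[R]_r;
  triv_inv : chart A -> forall x, 'rV[R]_r -> fiber x;
  ip_linear : forall x (c : R) (u v w : fiber x),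
    ip (c *: u + v) w = c * ip u w + ip v w;
  ip_sym : forall x (u v : fiber x), ip u v = ip v u;
  ip_norm : forall x (v : fiber x), ip v v = `|v| ^+ 2;
  triv_linear : forall a x, chart_dom a x -> linear (triv a (x := x));
  trivK : forall a x, chart_dom a x -> cancel (triv a (x := x)) (triv_inv a x);
  frameK : forall a x, chart_dom a x -> cancel (triv_inv a x) (triv a (x := x));
  triv_smooth : forall a b (w : 'rV[R]_r),
    smooth_on (chart_coord a @` (chart_dom a `&` chart_dom b))
      (fun p => triv b (triv_inv a (chart_point a p) w));
  ip_smooth : forall a (w z : 'rV[R]_r),
    smooth_on (chart_coord a @` chart_dom a)
      (fun p => ip (triv_inv a (chart_point a p) w)
                   (triv_inv a (chart_point a p) z) : R^o)
}.

Section Bundle.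
Context {R : realType} {n r : nat} {M : topologicalType} {A : bd_atlas R n M}.
Variable V : metric_bundle A r.
Local Notation vec := 'rV[R]_n.
Local Notation sec := 'rV[R]_r.

Definition transition_mx (a b : chart A) (p : vec) : 'M[R]_r :=
  \matrix_(j, l)
    triv b (triv_inv V a (chart_point a p) (delta_mx ord0 j)) ord0 l.

Definition is_metric_connection (T : R)
    (G : chart A -> R -> vec -> 'I_n -> 'M[R]_r) : Prop :=
  is_connection transition_mx T G /\
  forall a t, 0 <= t <= T ->
    metric_compatible a
      (fun p w z => ip (triv_inv V a (chart_point a p) w)
                       (triv_inv V a (chart_point a p) z))
      (G a t).

Definition local_section (a : chart A) (s : forall x, fiber V x)
    (p : vec) : sec :=
  triv a (s (chart_point a p)).

Definition smooth_family (T : R) (f : R -> forall x, fiber V x) : Prop :=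
  forall a, smooth_on (cylinder a T) (fun q => local_section a (f q.2) q.1).

(* As phi preserves the fibers, only its fiber component is constrained. *)
Definition locally_lipschitz (phi : forall x, fiber V x -> fiber V x) : Prop :=
  forall a : chart A, [locally [lipschitz
    triv a (phi _ (triv_inv V a (chart_point a q.1) q.2))
    | q in chart_img a `*` [set: sec] ]].

(* The total space.  It is not {x : M & fiber V x}, since the library equips
   that type with the disjoint union topology. *)
Record total_space := TotalPt { pt_base : M; pt_vec : fiber V pt_base }.

Definition fib (C : set total_space) (x : M) : set (fiber V x) :=
  [set v | C (TotalPt v)].
Arguments fib C x : clear implicits.

Definition total_nbhs (p : total_space) (N : set total_space) : Prop :=
  exists a : chart A, chart_dom a (pt_base p) /\
  exists2 P : set (M * sec), nbhs (pt_base p, triv a (pt_vec p)) P &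
    forall y (w : fiber V y), chart_dom a y -> P (y, triv a w) -> N (TotalPt w).

Definition total_closed (C : set total_space) : Prop :=
  forall p, ~ C p -> total_nbhs p (~` C).

(* d is a metric inducing the topology of the total space. *)
Definition total_metric (d : total_space -> total_space -> R) : Prop :=
  [/\ forall p q, d p q = 0 <-> p = q,
      forall p q, d p q = d q p,
      forall p q o, d p o <= d p q + d q o
    & forall p N, total_nbhs p N <->
        exists2 e : R, 0 < e & forall q, d p q < e -> N q].

Definition near_in_ball (d : total_space -> total_space -> R)
    (o : total_space) (rad e : R) (B C : set total_space) : Prop :=
  forall p, B p -> d o p <= rad -> exists2 q, C q & d p q < e.

Definition pointed_hausdorff_continuous (d : total_space -> total_space -> R)
    (T : R) (C : R -> set total_space) : Prop :=
  forall (o : total_space) (rad e t : R), 0 < e -> 0 <= t <= T ->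
  exists2 del : R, 0 < del &
    forall s, 0 <= s <= T -> `|s - t| < del ->
      near_in_ball d o rad e (C s) (C t) /\ near_in_ball d o rad e (C t) (C s).

Definition parallel (G : chart A -> vec -> 'I_n -> 'M[R]_r)
    (c : R -> M) (w : forall s, fiber V (c s)) : Prop :=
  forall a : chart A,
    let wa : R^o -> sec := fun s => triv a (w s) in
    let ca : R^o -> vec := fun s => chart_coord a (c s) in
    smooth_on [set s : R^o | 0 <= s <= 1 /\ chart_dom a (c s)] wa /\
    forall s, 0 <= s <= 1 -> chart_dom a (c s) ->
      deriv_in (seg 0 1) wa 1 s
      + \sum_i deriv_in (seg 0 1) ca 1 s ord0 i *: (wa s *m G a (ca s) i) = 0.

Definition parallel_invariant (G : chart A -> vec -> 'I_n -> 'M[R]_r)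
    (C : set total_space) : Prop :=
  forall (c : R -> M) (w : forall s, fiber V (c s)),
    smooth_curve A c -> parallel G w -> C (TotalPt (w 0)) -> C (TotalPt (w 1)).

Definition ode_preserves (T : R) (phi : forall x, fiber V x -> fiber V x)
    (C : R -> set total_space) : Prop :=
  forall (x : M) (t0 t1 : R), 0 <= t0 -> t0 <= t1 -> t1 <= T ->
  forall u : R^o -> fiber V x,
    (forall t, t0 <= t <= t1 -> is_deriv_in (seg t0 t1) u 1 t (phi x (u t))) ->
    fib (C t0) x (u t0) ->
    forall t, t0 <= t <= t1 -> fib (C t) x (u t).

Definition tangent_cone (x : M) (X : set (fiber V x)) (p : fiber V x) :
    set (fiber V x) :=
  [set xi | forall x1, ~ X x1 -> `|x1 - p| = dist_set x1 X ->
    0 <= ip xi (p - x1)].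

Definition dist_at (C : R -> set total_space) (f : R -> forall x, fiber V x)
    (t : R) (x : M) : R :=
  dist_set (f t x) (fib (C t) x).

(* A maximum: M is compact and, for closed parallel-invariant C t, the distance
   depends continuously on the point. *)
Definition max_dist (C : R -> set total_space) (f : R -> forall x, fiber V x)
    (t : R) : R :=
  sup (range (dist_at C f t)).

Definition time_deriv (T : R) (f : R -> forall x, fiber V x) (t : R) (x : M) :
    fiber V x :=
  deriv_in (seg 0 T) (fun s => f s x) 1 t.

End Bundle.

Arguments fib {R n r M A V} C x.

(* Main.v *)
(* Let S be the first time at which f leaves C.  By continuity of the family C,
   f(., S) lies in C(S), and just after S the distance u = dist(f, C), weighted
   by a decreasing factor 1 - 2L(t - S) where L bounds the Lipschitz constant of
   phi, has a positive maximum at some (x0, t0) with t0 > S.  Put n = f - v there.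

   In space: extend n by parallel transport along a line through x0.  Transport is
   isometric and preserves C(t0), so the support function of C(t0) in the
   direction n is constant along the line, and <f, n>, which exceeds it by at most
   |n| dist(f, C), is maximal at x0.  Hence <D_w f, n> <= 0 for every admissible
   w, equality forces <D_w D_w f, n> <= 0, and the boundary condition gives
   <D_w f, n> = 0 for all w.  The tangent cone condition then yields
   <df/dt - phi(f), n> <= 0.

   In time: flow by the ODE a point of C(t0 - h) nearly nearest to f(x0, t0 - h).
   It arrives in C(t0), so convexity bounds its component along n; the flow loses
   only a factor 1 + Lh, which contradicts the decay rate 2L of the weight. *)
Require Import Defs.
From HB Require Import structures.
From mathcomp Require Import all_boot all_order all_algebra.
From mathcomp Require Import all_classical all_reals all_analysis.
From mathcomp Require Import ring lra.

Set Implicit Arguments.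
Unset Strict Implicit.
Unset Printing Implicit Defensive.

Import Order.TTheory GRing.Theory Num.Theory.
Import numFieldNormedType.Exports.

Local Open Scope classical_set_scope.
Local Open Scope ring_scope.

(** The distance to C is not differentiable and the nearest point v is not known to vary smoothly.
    Each estimate therefore freezes n = f - v at one point and compares the distance with a smooth
    scalar function that touches it there. Pointed Hausdorff continuity compares points of the total
    space that may lie in different fibers. Transport along a short segment brings them into the
    prescribed fiber; this yields upper semicontinuity of the distance, which is enough for a
    maximum. A fiber of C may be empty, and [dist_set] is then 0. The argument is confined to a
    short time window after S, on which f stays uniformly close to points of C in its own fiber;
    this also provides the single constant L. The window has length at most 1/(4L), so that the
    weight stays at least 1/2. The rate 2L exceeds L, and the surplus absorbs errors that are small
    multiples of h. At a boundary point a line may be followed in one direction only, whereas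
    smoothness of curves and of parallel sections is expressed by local extensions past the end
    points; hence the reparametrisation [ramp]. *)

(** * Maps of class C^k through iterated directional derivatives *)

Section CkTheory.
Context {R : realType} {E : normedModType R}.
Implicit Types U : set E.

(** The difference g - f vanishes near p, so the zero map is its differential there. *)
Lemma near_eq_differentiable {F : normedModType R} (f g : E -> F) p :
  (\near p, f p = g p) -> differentiable f p -> differentiable g p.
Proof.
move=> fg df; have fgp := nbhs_singleton fg.
pose u := g - f.
have -> : g = f + u by apply/funext => x; rewrite /u !fctE /= addrC subrK.
apply: differentiableD => //.
have u0 : \near p, u p = 0.
  by apply: filterS fg => q; rewrite /u !fctE => ->; rewrite subrr.
have eu : u \o shift p = cst (u p) + (\0 : E -> F) +o_ 0 id.
  apply/eqaddoP => _/posnumP[e].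
  have : \forall h \near (0 : E), u (p + h) = 0.
    have : (fun h : E => p + h) @ 0 --> p.
      by rewrite -[X in _ --> X]addr0; apply: cvgD; [exact: cvg_cst|exact: cvg_id].
    by move/(_ [set q | u q = 0] u0).
  apply: filterS => h uh.
  have -> : (u \o shift p - (cst (u p) + (\0 : E -> F))) h = 0.
    by rewrite !fctE /= (nbhs_singleton u0) (addrC h) uh addr0 subrr.
  by rewrite normr0 mulr_ge0.
have c0 : continuous (\0 : {linear E -> F}) by move=> x; exact: cvg_cst.
apply/diff_locallyP.
have -> : 'd u p = (\0 : {linear E -> F}) :> (E -> F) by apply: diff_unique.
by split.
Unshelve. all: by end_near. Qed.

Lemma Ck_ext {F : normedModType R} U k (f g : E -> F) : open U ->
  (forall p, U p -> f p = g p) -> Ck U k f -> Ck U k g.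
Proof.
move=> oU; elim: k f g => [|k IH] f g fg /=.
  move=> cf p Up; have := cf p Up; rewrite /prop_for /continuous_at -(fg p Up).
  apply: cvg_trans; apply: near_eq_cvg.
  by apply: filterS (open_nbhs_nbhs (conj oU Up)) => q Uq; rewrite fg.
have nfg p : U p -> \near p, f p = g p.
  by move=> Up; apply: filterS (open_nbhs_nbhs (conj oU Up)) => q /fg.
move=> [df cf]; split => [p Up|v].
  exact: near_eq_differentiable (nfg p Up) (df p Up).
apply: IH (cf v) => p Up; apply: near_eq_derive; exact: nfg.
Qed.

Lemma Ck_sub {F : normedModType R} U U' k (f : E -> F) : U' `<=` U ->
  Ck U k f -> Ck U' k f.
Proof.
move=> UU'; elim: k f => [|k IH] f /=; first by move=> cf p /UU' /cf.
by move=> [df cf]; split => [p /UU' /df //|v]; apply: IH.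
Qed.

Lemma CkW {F : normedModType R} U k (f : E -> F) : Ck U k.+1 f -> Ck U k f.
Proof.
elim: k f => [|k IH] f; first by move=> [df _] p /df/differentiable_continuous.
by move=> [df cf]; split => // v; apply/IH/cf.
Qed.

Lemma Ck_cst {F : normedModType R} U k (c : F) : open U -> Ck U k (fun=> c).
Proof.
move=> oU; elim: k c => [|k IH] c /=; first by move=> p _; exact: cvg_cst.
split => [p _|v]; first exact: differentiable_cst.
by apply: Ck_ext (IH 0) => // p _; rewrite derive_cst.
Qed.

Lemma CkD {F : normedModType R} U k (f g : E -> F) : open U ->
  Ck U k f -> Ck U k g -> Ck U k (fun p => f p + g p).
Proof.
move=> oU; elim: k f g => [|k IH] f g /=.
  by move=> cf cg p Up; apply: cvgD; [exact: cf|exact: cg].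
move=> [df cf] [dg cg]; split => [p Up|v].
  by apply: differentiableD; [exact: df|exact: dg].
apply: Ck_ext (IH _ _ (cf v) (cg v)) => // p Up.
by rewrite -deriveD //; apply: diff_derivable; [exact: df|exact: dg].
Qed.

Lemma CkM U k (f g : E -> R^o) : open U ->
  Ck U k f -> Ck U k g -> Ck U k (fun p => f p * g p : R^o).
Proof.
move=> oU; elim: k f g => [|k IH] f g.
  by move=> cf cg p Up; apply: cvgM; [exact: cf|exact: cg].
move=> Cf Cg; have [df cf] := Cf; have [dg cg] := Cg; split => [p Up|v].
  by apply: differentiableM; [exact: df|exact: dg].
have h := CkD oU (IH _ _ (CkW Cf) (cg v)) (IH _ _ (CkW Cg) (cf v)).
apply: Ck_ext h => // p Up.
by rewrite deriveM //; apply: diff_derivable; [exact: df|exact: dg].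
Qed.

Lemma Ck_sum {F : normedModType R} U k I (r : seq I) (f : I -> E -> F) : open U ->
  (forall i, Ck U k (f i)) -> Ck U k (fun p => \sum_(i <- r) f i p).
Proof.
move=> oU cf; elim: r => [|i r IH].
  by apply: Ck_ext (@Ck_cst F U k 0 oU) => // p _; rewrite big_nil.
by apply: Ck_ext (CkD oU (cf i) IH) => // p _; rewrite big_cons.
Qed.

Lemma differentiable_mxP m n (f : E -> 'M[R]_(m, n)) p :
  differentiable f p <->
  forall i j, differentiable (fun q => f q i j : R^o) p.
Proof.
split=> [df i j|df].
  apply: (@differentiable_comp _ _ _ _ f (fun N : 'M[R]_(m, n) => N i j : R^o)) => //.
  exact: differentiable_coord.
have -> : f = \sum_(i < m) \sum_(j < n) (fun q => f q i j *: delta_mx i j).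
  apply/funext => q; rewrite fct_sumE [LHS]matrix_sum_delta.
  by apply: eq_bigr => i _; rewrite fct_sumE.
apply: differentiable_sum => i; apply: differentiable_sum => j.
exact: differentiableZl.
Qed.

Lemma cvg_mxP {T : Type} {F : set_system T} {FF : Filter F} m n
    (f : T -> 'M[R]_(m, n)) (l : 'M[R]_(m, n)) :
  f @ F --> l <-> forall i j, f x i j @[x --> F] --> l i j.
Proof.
split=> [fl i j|fl].
  exact: (@cvg_comp _ _ _ f (fun M : 'M[R]_(m, n) => M i j) _ _ _ fl (@coord_continuous _ m n i j l)).
apply/cvgrPdist_le => /= e e0; near=> x.
rewrite /Num.Def.normr /= mx_normrE (bigmax_le _ (ltW e0)) //= => i _.
rewrite !mxE /=.
move: i; near: x; apply: filter_forall => /= i.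
exact: ((cvgrPdist_le _ _).1 (fl i.1 i.2)).
Unshelve. all: by end_near. Qed.

Lemma Ck_mxP U k m n (f : E -> 'M[R]_(m, n)) : open U ->
  Ck U k f <-> forall i j, Ck U k (fun q => f q i j : R^o).
Proof.
move=> oU; elim: k f => [|k IH] f /=.
  split=> [cf i j p Up|cf p Up]; first exact: (cvg_mxP _ _).1 (cf p Up) i j.
  by apply/cvg_mxP => i j; exact: cf.
split=> [[df cf] i j|cf].
  split=> [p Up|v]; first exact: (differentiable_mxP _ _).1 (df p Up) i j.
  apply: Ck_ext ((IH _).1 (cf v) i j) => // p Up.
  by rewrite derive_mx ?mxE //; exact/diff_derivable/df.
have df p : U p -> differentiable f p.
  by move=> Up; apply/differentiable_mxP => i j; apply: (cf i j).1.
split=> // v; apply/IH => i j.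
apply: Ck_ext ((cf i j).2 v) => // p Up.
by rewrite derive_mx ?mxE //; exact/diff_derivable/df.
Qed.

(** Passing to entries leaves only the scalar product rule [CkM]. *)
Lemma Ck_mulmx U k m n l (f : E -> 'M[R]_(m, n)) (g : E -> 'M[R]_(n, l)) :
  open U -> Ck U k f -> Ck U k g -> Ck U k (fun p => f p *m g p).
Proof.
move=> oU /(Ck_mxP _ _ oU) cf /(Ck_mxP _ _ oU) cg; apply/Ck_mxP => // i j.
apply: Ck_ext (Ck_sum (index_enum 'I_n) oU
  (fun h => CkM oU (cf i h) (cg h j))) => // p _.
by rewrite mxE.
Qed.

Lemma Ck_scale_mx U k m n (a : E -> R^o) (f : E -> 'M[R]_(m, n)) :
  open U -> Ck U k a -> Ck U k f -> Ck U k (fun p => a p *: f p).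
Proof.
move=> oU ca /(Ck_mxP _ _ oU) cf; apply/Ck_mxP => // i j.
by apply: Ck_ext (CkM oU ca (cf i j)) => // p _; rewrite mxE.
Qed.

End CkTheory.

(** Functions that are smooth on a half-space come with extensions that change from point to point,
    so regularity along a curve is assembled locally. *)
Lemma Ck_local {R : realType} {E F : normedModType R} (J : set E) k (f : E -> F) :
  (forall s, J s -> exists J', [/\ open J', J' s & Ck J' k f]) -> Ck J k f.
Proof.
elim: k f => [|k IH] f H /=.
  by move=> s Js; have [J' [_ J's]] := H s Js; apply.
split=> [s Js|v]; first by have [J' [_ J's [df _]]] := H s Js; exact: df.
by apply: IH => s /H[J' [oJ' J's [_ cf]]]; exists J'; split => //; exact: cf.
Qed.

(** * Composition with reparametrised lines *)

Section Line.
Context {R : realType} {E : normedModType R}.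

Lemma derive_comp_line {F : normedModType R} (g : E -> F) (q : R^o -> R^o)
    (p w : E) (s v : R^o) :
  differentiable q s -> differentiable g (p + q s *: w) ->
  differentiable (fun t => g (p + q t *: w)) s /\
  'D_v (fun t => g (p + q t *: w)) s = 'D_v q s *: 'D_w g (p + q s *: w).
Proof.
move=> dq dg; pose th := fun t : R^o => p + q t *: w.
have dth : is_diff s th (fun u => 'd q s u *: w).
  have h1 : differentiable (fun t => q t *: w) s by exact: differentiableZl.
  have e : th = cst p + (fun t => q t *: w) by [].
  split; first by rewrite e; apply: differentiableD.
  by rewrite e diffD // diff_cst diffZl //; apply/funext => x /=; rewrite add0r.
have dgt : differentiable (g \o th) s by apply: differentiable_comp.
split => //.
rewrite (deriveE v dgt) diff_comp //= diff_val linearZ /=.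
by rewrite -!deriveE.
Qed.

(** The derivative is the product of a derivative of q with ['D_w g] along the same line, which is
    again of the form covered by the induction; for lines no general chain rule for C^k maps is
    called for. *)
Lemma Ck_comp_line m n U J k (g : E -> 'M[R]_(m, n)) (q : R^o -> R^o) (p w : E) :
  open U -> open J -> (forall s, J s -> U (p + q s *: w)) ->
  Ck U k g -> Ck J k q -> Ck J k (fun s => g (p + q s *: w)).
Proof.
move=> oU oJ JU; elim: k g q JU => [|k IH] g q JU.
  move=> cg cq s Js.
  apply: (@continuous_comp _ _ _ (fun s => p + q s *: w) g); last exact/cg/JU.
  by apply: cvgD; [exact: cvg_cst|apply: cvgZr_tmp; exact: cq].
move=> Cg Cq; have [dg cg] := Cg; have [dq cq] := Cq.
have D v s : J s -> _ := fun Js => derive_comp_line v (dq s Js) (dg _ (JU s Js)).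
split => [s Js|v]; first exact: (D 0 s Js).1.
apply: Ck_ext (Ck_scale_mx oJ (cq v) (IH ('D_w g) _ JU (cg w) (CkW Cq))) => // s Js.
by rewrite (D v s Js).2.
Qed.

(** The curve never leaves S, so the composite agrees locally with that of an extension of g and is
    C^k on an open set of parameters, even where the curve touches the boundary of S. *)
Lemma smooth_on_comp_line m n S J (g : E -> 'M[R]_(m, n)) (q : R^o -> R^o) (p w : E) :
  open J -> (forall s, J s -> S (p + q s *: w)) ->
  smooth_on S g -> (forall k, Ck J k q) ->
  forall k, Ck J k (fun s => g (p + q s *: w)).
Proof.
move=> oJ JS sg cq k; apply: Ck_local => s Js.
have [U [g' [oU Us cg' gg']]] := sg _ (JS s Js).
pose J' := J `&` [set t | U (p + q t *: w)].
have oJ' : open J'.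
  rewrite openE => t [Jt Ut]; rewrite /interior; apply: filterI.
    exact: open_nbhs_nbhs.
  have : (fun t : R^o => p + q t *: w) @ t --> p + q t *: w.
    by apply: cvgD; [exact: cvg_cst|apply: cvgZr_tmp; exact: (cq 0)].
  by move/(_ _ (open_nbhs_nbhs (conj oU Ut))).
exists J'; split => //; apply: Ck_ext (_ : Ck J' k (fun s => g' (p + q s *: w))) => //.
  by move=> t [Jt Ut]; rewrite gg' //; exact: JS.
by apply: Ck_comp_line oU oJ' _ (cg' k) (Ck_sub _ (cq k)) => t [].
Qed.

End Line.

(** * One-sided derivatives *)

Section Steps.
Context {R : realType} {E F : normedModType R}.
Implicit Types (S : set E) (f g : E -> F).

(** Restricting the increments to S only refines the filter, so the derivative of any differentiable
    extension is the limit. *)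
Lemma deriv_in_cvg S U f f' (u p : E) : open U -> U p -> S p ->
  (forall q, U q -> S q -> f q = f' q) -> derivable f' p u ->
  is_deriv_in S f u p ('D_u f' p).
Proof.
move=> oU Up Sp ff' df'.
have : diff_quot f' u p @ 0^' --> 'D_u f' p.
  apply: cvg_trans df'; apply: near_eq_cvg; near=> x.
  by rewrite /diff_quot /= (addrC p).
move=> h; rewrite /is_deriv_in.
apply: (@cvg_trans _ (diff_quot f' u p @ steps S u p)); last first.
  by apply: cvg_trans h; apply: cvg_app; exact: cvg_within.
apply: near_eq_cvg; rewrite /steps near_withinE.
have : \forall h \near (0 : R)^', U (p + h *: u).
  apply: cvg_within; have : (fun h : R => p + h *: u) @ 0 --> p.
    rewrite -[X in _ --> X]addr0 -[X in _ --> _ + X](scale0r u).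
    by apply: cvgD; [exact: cvg_cst|apply: cvgZr_tmp; exact: cvg_id].
  by move/(_ _ (open_nbhs_nbhs (conj oU Up))).
apply: filterS => h1 Uh Sh.
by rewrite /diff_quot (ff' _ Uh Sh) (ff' _ Up Sp).
Unshelve. all: by end_near. Qed.

Lemma steps_proper S (u p : E) :
  (forall e : R, 0 < e -> exists h : R, [/\ h != 0, `|h| < e & S (p + h *: u)]) ->
  ProperFilter (steps S u p).
Proof.
move=> H; apply: Build_ProperFilter_ex => //.
move=> P; rewrite /steps /within /= => -[e e0 eP].
have [h [h0 he Sh]] := H e e0; exists h; apply: eP => //=.
by rewrite /ball_ /= sub0r normrN.
Qed.

Lemma deriv_inE S U f f' (u p : E) : ProperFilter (steps S u p) ->
  open U -> U p -> S p ->
  (forall q, U q -> S q -> f q = f' q) -> derivable f' p u ->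
  deriv_in S f u p = 'D_u f' p.
Proof.
by move=> PF oU Up Sp ff' df'; apply: cvg_lim => //; exact: (deriv_in_cvg oU).
Qed.

End Steps.

Lemma seg_steps_proper {R : realType} (a b s : R) : a < b -> a <= s <= b ->
  ProperFilter (steps (seg a b) (1 : R^o) (s : R^o)).
Proof.
move=> ab /andP[as_ sb]; apply: steps_proper => e e0.
have [sltb|bles] := ltP s b.
  pose h := Num.min (e / 2) (b - s).
  have h0 : 0 < h by rewrite lt_min divr_gt0 //= subr_gt0.
  exists h; split; first by rewrite gt_eqF.
    by rewrite gtr0_norm // /h gt_min; apply/orP; left; lra.
  rewrite /seg /= scaler1; have : h <= b - s by rewrite ge_min lexx orbT.
  lra.
pose h := Num.min (e / 2) (s - a).
have h0 : 0 < h by rewrite lt_min divr_gt0 //= subr_gt0; lra.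
exists (- h); split; first by rewrite oppr_eq0 gt_eqF.
  by rewrite normrN gtr0_norm // /h gt_min; apply/orP; left; lra.
rewrite /seg /= scaler1; have : h <= s - a by rewrite ge_min lexx orbT.
lra.
Qed.

(** * Norm estimates, mean values and primitives for matrices *)

Section MatrixNorm.
Context {R : realType}.

Lemma mx_norm_le m n (M : 'M[R]_(m, n)) (e : R) : 0 <= e ->
  (forall i j, `|M i j| <= e) -> `|M| <= e.
Proof.
move=> e0 H; by rewrite /Num.Def.normr /= mx_normrE (bigmax_le _ e0) //= => i _; exact: H.
Qed.

Lemma mx_norm_ge m n (M : 'M[R]_(m, n)) i j : `|M i j| <= `|M|.
Proof.
rewrite [leRHS]/Num.Def.normr /= mx_normrE.
exact: (le_bigmax _ (fun k : 'I_m * 'I_n => `|M k.1 k.2|) (i, j)).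
Qed.

(** The matrix norm is the largest entry in absolute value, whence the factor n. *)
Lemma mulmx_norm_le m n l (A : 'M[R]_(m, n)) (B : 'M[R]_(n, l)) :
  `|A *m B| <= n%:R * `|A| * `|B|.
Proof.
apply: mx_norm_le => [|i j]; first by rewrite !mulr_ge0.
rewrite mxE; apply: le_trans (ler_norm_sum _ _ _) _.
have -> : n%:R * `|A| * `|B| = \sum_(k < n) (`|A| * `|B|).
  by rewrite sumr_const card_ord -mulrA mulr_natl.
by apply: ler_sum => k _; rewrite normrM ler_pM //; exact: mx_norm_ge.
Qed.

End MatrixNorm.

Section MeanValue.
Context {R : realType}.

Lemma MVT_derive (f df : R -> R) (a b : R) : a <= b ->
  (forall x, a <= x <= b -> is_derive x (1 : R) f (df x)) ->
  exists2 c, a <= c <= b & f b - f a = df c * (b - a).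
Proof.
move=> ab H.
have H1 x : x \in `]a, b[ -> is_derive x (1 : R) f (df x).
  by rewrite in_itv /= => /andP[ax xb]; apply: H; rewrite !ltW.
have cf : {within `[a, b], continuous f}.
  apply: derivable_within_continuous => x; rewrite in_itv /= => xab.
  exact: (@ex_derive _ _ _ _ _ _ _ (H x xab)).
have [c + e] := MVT_segment ab H1 cf.
by rewrite in_itv /= => cab; exists c.
Qed.

Lemma is_derive_mxP m n (f : R -> 'M[R]_(m, n)) (s : R) (l : 'M[R]_(m, n)) :
  is_derive s (1 : R) f l <->
  forall i j, is_derive s (1 : R) (fun t => f t i j) (l i j).
Proof.
split=> [[df fl] i j|H].
  split; first exact: ((derivable_mxP _ _ _).1 df i j).
  by rewrite -fl derive_mx // mxE.
have df : derivable f s 1.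
  by apply/derivable_mxP => i j; exact: (@ex_derive _ _ _ _ _ _ _ (H i j)).
split => //; rewrite derive_mx //; apply/matrixP => i j; rewrite mxE.
exact: (@derive_val _ _ _ _ _ _ _ (H i j)).
Qed.

(** For the maximum norm the scalar mean value theorem on each entry already gives the bound. *)
Lemma mvt_mx m n (f df : R -> 'M[R]_(m, n)) (a b B : R) : 0 <= B ->
  (forall x, a <= x <= b -> is_derive x (1 : R) f (df x)) ->
  (forall x, a <= x <= b -> `|df x| <= B) ->
  forall s t, a <= s <= b -> a <= t <= b -> `|f s - f t| <= B * `|s - t|.
Proof.
move=> B0 H HB s t; wlog : s t / t <= s.
  move=> W sab tab; have [ts|/ltW st] := leP t s; first exact: W.
  by rewrite distrC (distrC s); exact: W.
move=> ts /andP[as_ sb] /andP[at_ tb].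
have sub x : t <= x <= s -> a <= x <= b by move=> /andP[tx xs]; lra.
apply: mx_norm_le => [|i j]; first by rewrite mulr_ge0.
have [c cab e] := MVT_derive ts
  (fun x xts => (is_derive_mxP f x (df x)).1 (H x (sub x xts)) i j).
rewrite mxE [X in _ + X]mxE e normrM; apply: ler_wpM2r => //.
by apply: le_trans (mx_norm_ge _ _ _) (HB _ (sub _ cab)).
Qed.

Lemma primitive_itv (g : R -> R) (a b : R) : a < b -> continuous g ->
  exists G : R -> R, forall x, a < x < b -> is_derive x (1 : R) G (g x).
Proof.
move=> ab cg; pose mu := @lebesgue_measure R.
exists (fun y => (\int[mu]_(t in [set` `[a, y]]) g t)%R) => x /andP[ax xb].
have ig : mu.-integrable `[a, b] (EFin \o g).
  apply: continuous_compact_integrable; first exact: segment_compact.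
  exact: continuous_subspaceT.
have [dG eG] := continuous_FTC1_closed xb ig ax (cg x).
move: eG; rewrite derive1E => eG; split; [exact: dG|exact: eG].
Qed.

Lemma primitive_rV r (g : R -> 'rV[R]_r) (a b s0 : R) (u0 : 'rV[R]_r) :
  a < s0 < b -> continuous g ->
  exists G : R -> 'rV[R]_r, G s0 = u0 /\
    forall x, a < x < b -> is_derive x (1 : R) G (g x).
Proof.
move=> sab cg; have ab : a < b by lra.
have /choice[G HG] (j : 'I_r) : exists G : R -> R, forall x, a < x < b ->
    is_derive x (1 : R) G (g x ord0 j).
  apply: primitive_itv => // x.
  apply: (@continuous_comp _ _ _ g (fun M : 'rV[R]_r => M ord0 j)); first exact: cg.
  exact: coord_continuous.
exists (fun x => \row_j (G j x - G j s0 + u0 ord0 j)); split.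
  by apply/rowP => j; rewrite mxE subrr add0r.
move=> x xab; apply/is_derive_mxP => i j.
have -> : (fun t => (\row_j0 (G j0 t - G j0 s0 + u0 ord0 j0)) i j) =
    G j + cst (- G j s0 + u0 ord0 j).
  by apply/funext => t; rewrite mxE fctE addrA.
have dG := HG j x xab.
have := @is_deriveD _ _ _ (G j) (cst (- G j s0 + u0 ord0 j)) x 1 _ _ dG (is_derive_cst _ _ _).
by rewrite addr0 (ord1 i).
Qed.

End MeanValue.

(** * Picard iteration *)

Section Picard.
Context {R : realType} {r : nat}.
Local Notation rV := 'rV[R]_r.

Lemma geometric_cvg (x : nat -> rV) (M : R) :
  (forall n, `|x n.+1 - x n| <= M * 2^-1 ^+ n) ->
  exists l, forall n, `|x n - l| <= 2 * M * 2^-1 ^+ n.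
Proof.
move=> H.
have M0 : 0 <= M by have := H 0%N; rewrite expr0 mulr1; apply: le_trans.
have d k n : `|x (n + k)%N - x n| <= 2 * M * 2^-1 ^+ n.
  (* The factor 1 - 2^-k is the partial sum of the geometric series; with it the induction step is
     an equality. *)
  suff : `|x (n + k)%N - x n| <= 2 * M * 2^-1 ^+ n * (1 - 2^-1 ^+ k).
    move/le_trans; apply; rewrite ler_piMr ?mulr_ge0 ?exprn_ge0 ?invr_ge0 //.
  elim: k => [|k IH]; first by rewrite addn0 subrr normr0 expr0 subrr mulr0.
  rewrite addnS -(subrKA (x (n + k)%N)); apply: le_trans (ler_normD _ _) _.
  apply: le_trans (lerD (H _) IH) _.
  rewrite exprD !exprS le_eqVlt; apply/orP; left; apply/eqP.
  by field.
have : cvg (x @ \oo).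
  apply/cauchy_cvgP/cauchy_exP => e e0.
  have [N HN] : exists N, 4 * M * 2^-1 ^+ N < e.
    have : geometric (4 * M) (2^-1 : R) @ \oo --> (0 : R).
      by apply: cvg_geometric; rewrite ger0_norm; lra.
    move=> /cvgrPdist_lt/(_ e e0)[N _ HN]; exists N; have := HN N (leqnn _).
    by rewrite sub0r normrN; apply: le_lt_trans; exact: ler_norm.
  exists (x N); exists N => // m /= Nm.
  rewrite -ball_normE /= distrC -(subnKC Nm).
  apply: le_lt_trans (d _ _) _; apply: le_lt_trans HN.
  by rewrite ler_wpM2r ?exprn_ge0 ?invr_ge0 //; lra.
move=> /cvg_ex[l xl]; exists l => n.
apply/ler_addgt0Pl => e e0.
move: xl => /cvgrPdist_lt/(_ e e0)[N _ HN].
rewrite -(subrKA (x (n + N)%N)); apply: le_trans (ler_normD _ _) _.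
rewrite addrC; apply: lerD; last by rewrite distrC.
by rewrite distrC ltW //; apply: HN; rewrite /= leq_addl.
Qed.

Variables (a b s0 K B : R) (F : R -> rV -> rV) (u0 : rV).
Hypothesis s0ab : a <= s0 <= b.
Hypothesis K0 : 0 <= K.
Hypothesis Kab : K * (b - a) <= 2^-1.
Hypothesis F_lip : forall s w z, a <= s <= b -> `|F s w - F s z| <= K * `|w - z|.
Hypothesis F_cont : forall u : R -> rV, continuous u -> continuous (fun s => F s (u s)).
Hypothesis F_bound : forall s, a <= s <= b -> `|F s u0| <= B.

(** Clamping time to [a, b] makes the iterates continuous on the whole line, as taking primitives
    demands, and makes estimates known on [a, b] valid at every time. *)
Let cl (s : R) : R := Num.max a (Num.min b s).

Let cl_itv s : a <= cl s <= b.
Proof.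
have ab : a <= b by move: s0ab => /andP[h1 h2]; exact: le_trans h2.
by rewrite /cl le_max lexx /= ge_max ab ge_min lexx.
Qed.

Let cl_id s : a <= s <= b -> cl s = s.
Proof. by move=> /andP[as_ sb]; rewrite /cl min_r // max_r. Qed.

Let cl_cont : continuous cl.
Proof.
move=> s; apply: (@continuous_max R R (cst a) (fun s => Num.min b s)).
  exact: cvg_cst.
apply: (@continuous_min R R (cst b) id); [exact: cvg_cst|exact: cvg_id].
Qed.

(** The interval is enlarged by 1 on both sides so that the derivatives at a and b are two-sided. *)
Let is_sol (v : R -> rV) (G : R -> rV) := G s0 = u0 /\
  forall x, a - 1 < x < b + 1 -> is_derive x (1 : R) G (F x (v x)).

Let nxt (v : R -> rV) := get (is_sol v).

Let nxtP v : continuous v -> is_sol v (nxt v).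
Proof.
move=> cv; apply: getPex; apply: primitive_rV; first by move: s0ab; lra.
exact: F_cont.
Qed.

Let nxt_cont v : continuous v -> continuous (nxt v \o cl).
Proof.
move=> /nxtP[_ H] s; apply: continuous_comp; first exact: cl_cont.
apply: differentiable_continuous; apply/derivable1_diffP.
have := cl_itv s => cs.
have h : a - 1 < cl s < b + 1 by lra.
exact: (@ex_derive _ _ _ _ _ _ _ (H _ h)).
Qed.

Let v_ (n : nat) : R -> rV := iter n (fun v => nxt v \o cl) (cst u0).

Let v_cont n : continuous (v_ n).
Proof.
elim: n => [|n IH] /=; first by move=> s; exact: cvg_cst.
exact: nxt_cont.
Qed.

Let B0 : 0 <= B.
Proof. by apply: le_trans (F_bound s0ab). Qed.

Let nxt_diff v w e : continuous v -> continuous w -> 0 <= e ->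
  (forall s, `|v s - w s| <= e) ->
  forall s, `|nxt v (cl s) - nxt w (cl s)| <= e * 2^-1.
Proof.
move=> cv cw e0 vw s; have [v0 dv] := nxtP cv; have [w0 dw] := nxtP cw.
have Ke : 0 <= K * e by rewrite mulr_ge0.
have D x : a <= x <= b -> is_derive x (1 : R) (nxt v - nxt w) (F x (v x) - F x (w x)).
  move=> xab; have xab' : a - 1 < x < b + 1 by lra.
  by have := dv x xab'; have := dw x xab' => *; exact: is_deriveB.
have Dle x : a <= x <= b -> `|F x (v x) - F x (w x)| <= K * e.
  by move=> xab; apply: le_trans (F_lip _ _ xab) _; exact: ler_wpM2l.
have := mvt_mx Ke D Dle (cl_itv s) s0ab.
rewrite !fctE v0 w0 subrr subr0 => /le_trans; apply.
have cs := cl_itv s.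
have : `|cl s - s0| <= b - a by rewrite ler_norml; move: s0ab; lra.
move=> h; apply: (@le_trans _ _ (K * e * (b - a))); first exact: ler_wpM2l.
by rewrite mulrAC mulrC ler_wpM2l.
Qed.

Let v_diff n s : `|v_ n.+1 s - v_ n s| <= B * (b - a) * 2^-1 ^+ n.
Proof.
elim: n s => [|n IH] s; last first.
  have e0 := le_trans (normr_ge0 _) (IH s).
  rewrite exprS mulrCA mulrC.
  have h := nxt_diff (@v_cont n.+1) (@v_cont n) e0 IH s.
  exact: h.
rewrite /= expr0 mulr1; have [n0 dn] := nxtP (@v_cont 0).
have D x : a <= x <= b -> is_derive x (1 : R) (nxt (cst u0)) (F x u0).
  by move=> xab; have := dn x; apply; lra.
have := mvt_mx B0 D F_bound (cl_itv s) s0ab.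
rewrite n0 => /le_trans; apply; apply: ler_wpM2l => //.
by have cs := cl_itv s; rewrite ler_norml; move: s0ab; lra.
Qed.

(** The condition K (b - a) <= 1/2 makes the iteration contract by 1/2. The first increment is at
    most B (b - a), and summing the geometric series gives the factor 2. The last clause keeps a
    solution in the region where a truncated field agrees with the original one. *)
Lemma picard : exists u : R -> rV, [/\ u s0 = u0,
  (forall s, a <= s <= b -> is_derive s (1 : R) u (F s (u s))) &
  forall s, a <= s <= b -> `|u s - u0| <= 2 * (B * (b - a))].
Proof.
have [v vv] := choice (fun s => geometric_cvg (fun n => v_diff n s)).
pose M := B * (b - a).
have M0 : 0 <= M by rewrite mulr_ge0 //; move: s0ab; lra.
have small e : 0 < e -> exists n, 2 * M * 2^-1 ^+ n < e.
  move=> e0; have : geometric (2 * M) (2^-1 : R) @ \oo --> (0 : R).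
    by apply: cvg_geometric; rewrite ger0_norm; lra.
  move=> /cvgrPdist_lt/(_ e e0)[N _ HN]; exists N; have := HN N (leqnn _).
  by rewrite sub0r normrN; apply: le_lt_trans; exact: ler_norm.
have v_c : continuous v.
  move=> s; apply/cvgrPdist_lt => e e0.
  have [|n Hn] := small (e / 3); first lra.
  have := @v_cont n s; move=> /cvgrPdist_lt/(_ (e / 3)) H.
  have {}H := H (ltac:(lra)); apply: filterS H => t Ht.
  have := vv s n; have := vv t n; rewrite -/M => h1 h2.
  have -> : v s - v t = - (v_ n s - v s) + ((v_ n s - v_ n t) + (v_ n t - v t)).
    by apply/rowP => j; rewrite !mxE; ring.
  apply: le_lt_trans (ler_normD _ _) _; rewrite normrN.
  apply: le_lt_trans (lerD (lexx _) (ler_normD _ _)) _; lra.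
have [n0 dn] := nxtP v_c.
(* The iterate of index n + 1 is close to v by convergence and to [nxt v] by contraction. *)
have fix_ s : v s = nxt v (cl s).
  apply/eqP; rewrite -subr_eq0 -normr_le0; apply/ler_addgt0Pl => e e0.
  rewrite addr0; have [|n Hn] := small (e / 2); first lra.
  have e1 : 0 <= 2 * M * 2^-1 ^+ n := le_trans (normr_ge0 _) (vv s n).
  have h1 := nxt_diff (@v_cont n) v_c e1 (fun s => vv s n) s.
  have h2 := vv s n.+1; rewrite exprS -/M in h2.
  rewrite -(subrKA (v_ n.+1 s)); apply: le_trans (ler_normD _ _) _.
  rewrite distrC /= in h2; rewrite /=.
  apply: le_trans (lerD h2 h1) _.
  have -> : 2 * M * (2^-1 * 2^-1 ^+ n) = 2 * M * 2^-1 ^+ n * 2^-1 by ring.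
  lra.
exists (nxt v); split => //.
  move=> s sab; have := dn s; rewrite fix_ (cl_id sab); apply; lra.
move=> s sab; have := vv s 0%N; rewrite fix_ (cl_id sab) /= distrC expr0 mulr1.
exact.
Qed.

End Picard.

(** * Smooth functions on sets that need not be open *)

Section SmoothOn.
Context {R : realType} {E : normedModType R}.
Implicit Types S : set E.

Lemma smooth_on_eq {F : normedModType R} S (f g : E -> F) :
  (forall p, S p -> f p = g p) -> smooth_on S f -> smooth_on S g.
Proof.
move=> fg sf p Sp; have [U [f' [oU Up cf ff']]] := sf p Sp.
by exists U, f'; split => // q Uq Sq; rewrite -fg // ff'.
Qed.

Lemma smooth_on_sub {F : normedModType R} S S' (f : E -> F) : S' `<=` S ->
  smooth_on S f -> smooth_on S' f.
Proof.
move=> SS sf p /SS Sp; have [U [f' [oU Up cf ff']]] := sf p Sp.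
by exists U, f'; split => // q Uq /SS Sq; rewrite ff'.
Qed.

Lemma smooth_on_cst {F : normedModType R} S (c : F) : smooth_on S (fun=> c).
Proof.
move=> p _; exists setT, (fun=> c); split => //; first exact: openT.
by move=> k; apply: Ck_cst; exact: openT.
Qed.

Lemma smooth_on2 {F G H : normedModType R} S (op : F -> G -> H)
    (f : E -> F) (g : E -> G) :
  (forall U k (f' : E -> F) (g' : E -> G), open U -> Ck U k f' -> Ck U k g' ->
    Ck U k (fun p => op (f' p) (g' p))) ->
  smooth_on S f -> smooth_on S g -> smooth_on S (fun p => op (f p) (g p)).
Proof.
move=> Hop sf sg p Sp.
have [U [f' [oU Up cf ff']]] := sf p Sp; have [U' [g' [oU' Up' cg gg']]] := sg p Sp.
exists (U `&` U'), (fun q => op (f' q) (g' q)); split => //; first exact: openI.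
  move=> k; apply: Hop; first exact: openI.
    by apply: Ck_sub (cf k) => q [].
  by apply: Ck_sub (cg k) => q [].
by move=> q [Uq U'q] Sq; rewrite ff' // gg'.
Qed.

Lemma smooth_onD {F : normedModType R} S (f g : E -> F) :
  smooth_on S f -> smooth_on S g -> smooth_on S (fun p => f p + g p).
Proof. by apply: (@smooth_on2 _ _ _ _ +%R) => *; exact: CkD. Qed.

Lemma smooth_on_mulmx S m n l (f : E -> 'M[R]_(m, n)) (g : E -> 'M[R]_(n, l)) :
  smooth_on S f -> smooth_on S g -> smooth_on S (fun p => f p *m g p).
Proof. by apply: (@smooth_on2 _ _ _ _ (@mulmx _ m n l)) => *; exact: Ck_mulmx. Qed.

Lemma smooth_on_scale_mx S m n (a : E -> R^o) (f : E -> 'M[R]_(m, n)) :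
  smooth_on S a -> smooth_on S f -> smooth_on S (fun p => a p *: f p).
Proof.
by apply: (@smooth_on2 _ _ _ _ (fun (c : R^o) (M : 'M[R]_(m, n)) => c *: M)) => *;
  exact: Ck_scale_mx.
Qed.

Lemma smooth_on_sum {F : normedModType R} S I (r : seq I) (f : I -> E -> F) :
  (forall i, smooth_on S (f i)) -> smooth_on S (fun p => \sum_(i <- r) f i p).
Proof.
move=> sf; elim: r => [|i r IH].
  by apply: smooth_on_eq _ (@smooth_on_cst F S 0) => p _; rewrite big_nil.
by apply: smooth_on_eq _ (smooth_onD (sf i) IH) => p _; rewrite big_cons.
Qed.

Lemma smooth_on_coord S m n (f : E -> 'M[R]_(m, n)) i j :
  smooth_on S f -> smooth_on S (fun p => f p i j : R^o).
Proof.
move=> sf p Sp; have [U [f' [oU Up cf ff']]] := sf p Sp.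
exists U, (fun q => f' q i j); split => //.
  by move=> k; apply: (Ck_mxP k f' oU).1.
by move=> q Uq Sq; rewrite ff'.
Qed.

Lemma smooth_on_mx S m n (f : E -> 'M[R]_(m, n)) :
  (forall i j, smooth_on S (fun p => f p i j : R^o)) -> smooth_on S f.
Proof.
move=> sf; apply: (@smooth_on_eq _ _ (fun p =>
    \sum_(i <- index_enum 'I_m) \sum_(j <- index_enum 'I_n) f p i j *: delta_mx i j)).
  by move=> p _; rewrite -matrix_sum_delta.
apply: smooth_on_sum => i; apply: smooth_on_sum => j.
by apply: smooth_on_scale_mx => //; exact: smooth_on_cst.
Qed.

Lemma smooth_on_continuous {F : normedModType R} S (f : E -> F) :
  smooth_on S f -> {within S, continuous f}.
Proof.
move=> sf; apply/subspace_continuousP => p Sp.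
have [U [f' [oU Up cf ff']]] := sf p Sp.
have c : f' @ p --> f p by rewrite ff' //; exact: (cf 0%N p Up).
apply: (@cvg_trans _ (f' @ within S (nbhs p))); last first.
  by apply: cvg_trans c; apply: cvg_app; exact: cvg_within.
apply: near_eq_cvg; rewrite near_withinE.
by apply: filterS (open_nbhs_nbhs (conj oU Up)) => q Uq Sq; exact/esym/ff'.
Qed.

Lemma deriv_in_ext {F : normedModType R} S (f g : E -> F) u p :
  S p -> (forall q, S q -> f q = g q) -> deriv_in S f u p = deriv_in S g u p.
Proof.
move=> Sp fg; rewrite /deriv_in; congr (lim _).
have e h : S (p + h *: u) -> diff_quot f u p h = diff_quot g u p h.
  by move=> Sh; rewrite /diff_quot !fg.
rewrite eqEsubset; split; apply: near_eq_cvg; rewrite /steps near_withinE.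
  by apply: nearW => h Sh; rewrite e.
by apply: nearW => h Sh; rewrite e.
Qed.

(* [f'] witnesses both the derivatives of [f] at [p] and its smoothness there *)
Lemma smooth_on_deriv_inE {F : normedModType R} S (f : E -> F) p :
  smooth_on S f -> S p -> exists U f', [/\ open U, U p, forall k, Ck U k f',
    forall q, U q -> S q -> f q = f' q &
    forall q u, U q -> S q -> ProperFilter (steps S u q) ->
      deriv_in S f u q = 'D_u f' q].
Proof.
move=> sf Sp; have [U [f' [oU Up cf ff']]] := sf p Sp.
exists U, f'; split => // q u Uq Sq PF; apply: (deriv_inE PF oU Uq Sq ff').
by apply: diff_derivable; apply: (cf 1%N).1.
Qed.

Lemma smooth_on_deriv {F : normedModType R} S (f : E -> F) u :
  (forall p, S p -> ProperFilter (steps S u p)) ->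
  smooth_on S f -> smooth_on S (deriv_in S f u).
Proof.
move=> PF sf p Sp; have [U [f' [oU Up cf ff' df]]] := smooth_on_deriv_inE sf Sp.
exists U, ('D_u f'); split => //; first by move=> k; apply: (cf k.+1).2.
by move=> q Uq Sq; apply: df => //; exact: PF.
Qed.

Lemma is_derive_mulmx m n l (f : E -> 'M[R]_(m, n)) (g : E -> 'M[R]_(n, l)) u p df dg :
  is_derive p u f df -> is_derive p u g dg ->
  is_derive p u (fun q => f q *m g q) (df *m g p + f p *m dg).
Proof.
move=> [Df <-] [Dg <-].
have Dfij i j : is_derive p u (fun q => f q i j) ('D_u f p i j).
  by split; [exact: (derivable_mxP _ _ _).1|rewrite derive_mx // mxE].
have Dgij i j : is_derive p u (fun q => g q i j) ('D_u g p i j).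
  by split; [exact: (derivable_mxP _ _ _).1|rewrite derive_mx // mxE].
have Dfgij i j : is_derive p u (fun q => (f q *m g q) i j)
    (('D_u f p *m g p + f p *m 'D_u g p) i j).
  have -> : (fun q => (f q *m g q) i j) =
      \sum_(h < n) ((fun q => f q i h) * (fun q => g q h j)).
    by apply/funext => q; rewrite mxE fct_sumE.
  rewrite !mxE -big_split /=.
  apply: is_derive_eq; apply: eq_bigr => h _.
  by rewrite /GRing.scale /=; ring.
have Dfg : derivable (fun q => f q *m g q) p u.
  by apply/derivable_mxP => i j; have [] := Dfgij i j.
by split => //; rewrite derive_mx //; apply/matrixP => i j; rewrite mxE;
  have [_ ->] := Dfgij i j.
Qed.

Lemma deriv_in_mulmx S m n l (f : E -> 'M[R]_(m, n)) (g : E -> 'M[R]_(n, l)) u p :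
  S p -> ProperFilter (steps S u p) -> smooth_on S f -> smooth_on S g ->
  deriv_in S (fun q => f q *m g q) u p =
  deriv_in S f u p *m g p + f p *m deriv_in S g u p.
Proof.
move=> Sp PF sf sg.
have [U [f' [oU Up cf ff' df]]] := smooth_on_deriv_inE sf Sp.
have [U' [g' [oU' Up' cg gg' dg]]] := smooth_on_deriv_inE sg Sp.
rewrite df // dg // ff' // gg' //.
have Df : derivable f' p u by apply: diff_derivable; apply: (cf 1%N).1.
have Dg : derivable g' p u by apply: diff_derivable; apply: (cg 1%N).1.
have [Dfg Dfg'] := is_derive_mulmx (derivableP Df) (derivableP Dg).
rewrite (@deriv_inE _ _ _ _ (U `&` U') _ (fun q => f' q *m g' q)) //; last 2 first.
- exact: openI.
- by move=> q [Uq U'q] Sq; rewrite ff' // gg'.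
Qed.

Lemma deriv_in_cst {F : normedModType R} S (c : F) u p :
  S p -> ProperFilter (steps S u p) -> deriv_in S (fun=> c) u p = 0.
Proof.
move=> Sp PF; rewrite (@deriv_inE _ _ _ _ setT _ (fun=> c)) ?derive_cst //.
exact: openT.
Qed.

Lemma steps_openI S W u p : open W -> W p -> steps (W `&` S) u p = steps S u p.
Proof.
move=> oW Wp; have : \forall h \near (0 : R)^', W (p + h *: u).
  apply: cvg_within; have : (fun h : R => p + h *: u) @ 0 --> p.
    rewrite -[X in _ --> X]addr0 -[X in _ --> _ + X](scale0r u).
    by apply: cvgD; [exact: cvg_cst|apply: cvgZr_tmp; exact: cvg_id].
  by move/(_ _ (open_nbhs_nbhs (conj oW Wp))).
move=> nW; rewrite /steps eqEsubset; split => P; rewrite /within /= => H.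
  by apply: filterS2 nW H => h Wh H Sh; apply: H.
by apply: filterS H => h H [_ Sh]; exact: H.
Qed.

Lemma deriv_in_openI {F : normedModType R} S W (f : E -> F) u p : open W -> W p ->
  deriv_in (W `&` S) f u p = deriv_in S f u p.
Proof. by move=> oW Wp; rewrite /deriv_in steps_openI. Qed.

End SmoothOn.

(** * Restriction to a fixed time *)

Section Slice.
Context {R : realType} {E E' F : normedModType R}.

Lemma open_slice (U : set (E * E')) (t : E') : open U -> open [set p : E | U (p, t)].
Proof.
apply: (@open_comp _ _ (fun p : E => (p, t))) => p _.
by apply: cvg_pair; [exact: cvg_id|exact: cvg_cst].
Qed.

Lemma open_slice2 (U : set (E * E')) (p : E) : open U -> open [set t : E' | U (p, t)].
Proof.
apply: (@open_comp _ _ (fun t : E' => (p, t))) => t _.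
by apply: cvg_pair; [exact: cvg_cst|exact: cvg_id].
Qed.

Lemma Ck_slice (U : set (E * E')) k (f : E * E' -> F) (t : E') : open U ->
  Ck U k f -> Ck [set p | U (p, t)] k (fun p => f (p, t)).
Proof.
move=> oU; elim: k f => [|k IH] f.
  move=> cf p Up; apply: (@continuous_comp _ _ _ (fun p : E => (p, t)) f).
    by apply: cvg_pair; [exact: cvg_id|exact: cvg_cst].
  exact: cf.
move=> [df cf].
have dp p : is_diff p (fun p : E => (p, t)) (fun v => (v, 0)).
  have h1 : differentiable (id : E -> E) p by [].
  have h2 : differentiable (cst t : E -> E') p by [].
  by split; [exact: differentiable_pair|rewrite diff_pair // diff_cst diff_val].
split=> [p Up|v].
  by apply: (@differentiable_comp _ _ _ _ (fun p : E => (p, t)) f) => //; exact: df.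
apply: Ck_ext (IH _ (cf (v, 0))); first exact: open_slice.
move=> p Up; rewrite (deriveE _ (df _ Up)) deriveE; last first.
  by apply: (@differentiable_comp _ _ _ _ (fun p : E => (p, t)) f) => //; exact: df.
by rewrite (@diff_comp _ _ _ _ (fun p : E => (p, t)) f) //= ?diff_val //; exact: df.
Qed.

Lemma smooth_on_slice (S : set E) (S' : set E') (f : E * E' -> F) (t : E') :
  S' t -> smooth_on (S `*` S') f -> smooth_on S (fun p => f (p, t)).
Proof.
move=> S't sf p Sp; have [U [f' [oU Up cf ff']]] := sf (p, t) (conj Sp S't).
exists [set q | U (q, t)], (fun q => f' (q, t)); split => //.
- exact: open_slice.
- by move=> k; exact: Ck_slice.
- by move=> q Uq Sq; rewrite ff'.
Qed.

End Slice.

(** * Charts with boundary and covariant derivatives *)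

Section Chart.
Context {R : realType} {n : nat} {M : topologicalType}.
Variable A : bd_atlas R n M.
Implicit Types (a : chart A) (p w : 'rV[R]_n).

Lemma chart_img_nbhs a p : chart_img a p -> exists2 e : R, 0 < e &
  forall q : 'rV[R]_n, `|q - p| < e -> half_space q -> chart_img a q.
Proof.
rewrite /chart_img; have [W [oW ->]] := coord_open a => -[Wp _].
have /nbhs_ballP[e e0 eW] := open_nbhs_nbhs (conj oW Wp).
exists e => // q qp hq; split => //; apply: eW.
by rewrite -ball_normE /= distrC.
Qed.

Lemma chart_img_half a p : chart_img a p -> half_space p.
Proof. by rewrite /chart_img; have [W [oW ->]] := coord_open a => -[]. Qed.

Lemma half_space_segment p q (c : R) : half_space p -> half_space q ->
  0 <= c <= 1 -> half_space (p + c *: (q - p)).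
Proof.
move=> hp hq /andP[c0 c1] i i0; rewrite !mxE.
have -> : p ord0 i + c * (q ord0 i - p ord0 i) =
  (1 - c) * p ord0 i + c * q ord0 i by ring.
by rewrite addr_ge0 ?mulr_ge0 ?subr_ge0 ?hp ?hq.
Qed.

(** Positive increments along a basis vector never leave the half-space, so one-sided partial
    derivatives have unique limits at boundary points too. *)
Lemma chart_steps a i p : chart_img a p ->
  ProperFilter (steps (chart_img a) (e_ i : 'rV[R]_n) p).
Proof.
move=> ap; have [r r0 Hr] := chart_img_nbhs ap.
apply: steps_proper => e e0; pose h := Num.min (e / 2) (r / 2).
have h0 : 0 < h by rewrite lt_min !divr_gt0.
have he : h <= e / 2 by rewrite ge_min lexx.
have hr : h <= r / 2 by rewrite ge_min lexx orbT.
exists h; split; first by rewrite gt_eqF.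
  by rewrite gtr0_norm //; lra.
apply: Hr => [|j j0].
  rewrite addrAC subrr add0r normrZ gtr0_norm //.
  have : `|e_ i : 'rV[R]_n| <= 1.
    by apply: mx_norm_le => // j l; rewrite mxE; case: (_ && _); rewrite ?normr1 ?normr0.
  move=> e1; apply: (@le_lt_trans _ _ (h * 1)); last lra.
  by rewrite ler_pM2l.
rewrite !mxE addr_ge0 //; first exact: (chart_img_half ap).
by rewrite mulr_ge0 ?(ltW h0) //; case: (_ && _).
Qed.

(** The one-sided partials are those of a smooth extension, whose differential is linear in w. The
    open set W allows g to be smooth only near the point, as transition functions are on an
    overlap. *)
Lemma derive_chart_line {F : normedModType R} a W (g : 'rV[R]_n -> F) (q : R -> R)
    p w (s dq : R) :
  open W -> W (p + q s *: w) -> smooth_on (W `&` chart_img a) g ->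
  (\forall t \near s, chart_img a (p + q t *: w)) ->
  is_derive s (1 : R) q dq ->
  is_derive s (1 : R) (fun t => g (p + q t *: w))
    (dq *: \sum_i w ord0 i *: deriv_in (chart_img a) g (e_ i) (p + q s *: w)).
Proof.
move=> oW Ws sg nq dqs; have aqs := nbhs_singleton nq.
have [U [g' [oU Us cg gg' dg]]] := smooth_on_deriv_inE sg (conj Ws aqs).
have dq' : differentiable (q : R^o -> R^o) s.
  by apply/derivable1_diffP; have [] := dqs.
have dg' : differentiable g' (p + q s *: w) by apply: (cg 1%N).1.
have [D1 D2] := derive_comp_line 1 dq' dg'.
have nU Y : open Y -> Y (p + q s *: w) -> \forall t \near s, Y (p + q t *: w).
  move=> oY Ys; have : (fun t : R => p + q t *: w) @ s --> p + q s *: w.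
    apply: cvgD; first exact: cvg_cst.
    by apply: cvgZr_tmp; exact: (differentiable_continuous dq').
  by move/(_ _ (open_nbhs_nbhs (conj oY Ys))).
apply: (@near_eq_is_derive _ _ _ (fun t => g' (p + q t *: w))).
  by apply: filterS3 (nU _ oU Us) (nU _ oW Ws) nq => t Ut Wt at_; rewrite gg'.
split; first by apply/derivable1_diffP.
rewrite D2; congr (_ *: _); first by have [] := dqs.
transitivity (\sum_i w ord0 i *: 'D_(e_ i) g' (p + q s *: w)); last first.
  apply: eq_bigr => i _; rewrite -(deriv_in_openI _ _ _ oW Ws).
  have PF : ProperFilter (steps (W `&` chart_img a) (e_ i) (p + q s *: w)).
    by rewrite steps_openI //; exact: chart_steps.
  by rewrite dg.
under eq_bigr do rewrite deriveE //.
rewrite deriveE //; move: ('d g' _) => L.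
rewrite [in LHS](row_sum_delta w) linear_sum; apply: eq_bigr => i _.
by rewrite linearZ.
Qed.

Section Cov.
Context {k : nat}.
Variable a : chart A.
Variable G : 'rV[R]_n -> 'I_n -> 'M[R]_k.
Hypothesis G_smooth : forall i, smooth_on (chart_img a) (fun q => G q i).
Implicit Types s : 'rV[R]_n -> 'rV[R]_k.

(* The rows are the covariant derivatives D_i s. *)
Definition cov_grad s (q : 'rV[R]_n) : 'M[R]_(n, k) :=
  \matrix_(i, j) (deriv_in (chart_img a) s (e_ i) q + s q *m G q i) ord0 j.

Lemma cov_vecE u s q : cov_vec a G u s q = u *m cov_grad s q.
Proof.
rewrite /cov_vec mulmx_sum_row; apply: eq_bigr => i _; congr (_ *: _).
by apply/rowP => j; rewrite !mxE.
Qed.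

Lemma smooth_on_cov_grad s : smooth_on (chart_img a) s ->
  smooth_on (chart_img a) (cov_grad s).
Proof.
move=> ss; apply: smooth_on_mx => i j.
apply: (@smooth_on_eq _ _ _ _ (fun q =>
    (deriv_in (chart_img a) s (e_ i) q + s q *m G q i) ord0 j)).
  by move=> q _; rewrite [in RHS]mxE.
apply: smooth_on_coord; apply: smooth_onD; last exact: smooth_on_mulmx.
by apply: smooth_on_deriv => // q; exact: chart_steps.
Qed.

Lemma smooth_on_cov_vec u s : smooth_on (chart_img a) s ->
  smooth_on (chart_img a) (cov_vec a G u s).
Proof.
move=> ss; apply: (@smooth_on_eq _ _ _ _ (fun q => u *m cov_grad s q)).
  by move=> q _; rewrite cov_vecE.
by apply: smooth_on_mulmx; [exact: smooth_on_cst|exact: smooth_on_cov_grad].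
Qed.

(** Freezing X at its value in p changes the second derivative only by a first-order term, with z
    the coordinate derivative of X along itself. Such terms will vanish against n at the maximum. *)
Lemma cov_covE (X : 'rV[R]_n -> 'rV[R]_n) x s : chart_dom a x ->
  local_field a x X -> smooth_on (chart_img a) s ->
  let p := chart_coord a x in
  exists z, cov a G X (cov a G X s) p =
    cov_vec a G (X p) (cov_vec a G (X p) s) p + cov_vec a G z s p.
Proof.
move=> ax [W [oW Wp sX]] ss p; have ap : chart_img a p by exists x.
have sg := smooth_on_cov_grad ss.
pose S' := W `&` chart_img a.
have S'S : S' `<=` chart_img a by move=> q [].
have PF i : ProperFilter (steps S' (e_ i) p).
  by rewrite steps_openI //; exact: chart_steps.
have dX i : deriv_in (chart_img a) (cov a G X s) (e_ i) p =
    deriv_in S' X (e_ i) p *m cov_grad s p + X p *m deriv_in (chart_img a) (cov_grad s) (e_ i) p.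
  rewrite -(deriv_in_openI _ _ _ oW Wp) -(deriv_in_openI _ (cov_grad s) _ oW Wp).
  rewrite (@deriv_in_ext _ _ _ _ _ (fun q => X q *m cov_grad s q)) //; last first.
    by move=> q _; rewrite /cov cov_vecE.
  by rewrite deriv_in_mulmx //; exact: smooth_on_sub sg.
have dw i : deriv_in (chart_img a) (cov_vec a G (X p) s) (e_ i) p =
    X p *m deriv_in (chart_img a) (cov_grad s) (e_ i) p.
  rewrite (@deriv_in_ext _ _ _ _ _ (fun q => X p *m cov_grad s q)) //; last first.
    by move=> q _; rewrite cov_vecE.
  have PF' := chart_steps i ap.
  rewrite deriv_in_mulmx //; last exact: smooth_on_cst.
  by rewrite deriv_in_cst // mul0mx add0r.
exists (\sum_i X p ord0 i *: deriv_in S' X (e_ i) p).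
rewrite (cov_vecE _ s p) mulmx_suml.
transitivity (\sum_i X p ord0 i *: (deriv_in (chart_img a) (cov a G X s) (e_ i) p
  + cov a G X s p *m G p i)); first by [].
rewrite [X in _ = X + _]/cov_vec -big_split /=.
apply: eq_bigr => i _.
by rewrite -scalemxAl -scalerDr dX dw -addrA addrC.
Qed.

End Cov.
End Chart.

(** * Algebra of the fibers and their coordinates *)

Section LinearMap.
Context {R : realType} {U W : lmodType R} {f : U -> W}.
Hypothesis fL : linear f.

Let F : {linear U -> W} := HB.pack f (GRing.isLinear.Build _ _ _ _ f fL).

Lemma linear_fun0 : f 0 = 0. Proof. exact: (linear0 F). Qed.

Lemma linear_funZ c u : f (c *: u) = c *: f u. Proof. exact: (linearZZ F). Qed.

Lemma linear_funD u v : f (u + v) = f u + f v. Proof. exact: (linearD F). Qed.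

Lemma linear_funB u v : f (u - v) = f u - f v. Proof. exact: (linearB F). Qed.

Lemma linear_fun_sum I (s : seq I) (g : I -> U) :
  f (\sum_(i <- s) g i) = \sum_(i <- s) f (g i).
Proof. exact: (linear_sum F). Qed.

End LinearMap.

Section Fiber.
Context {R : realType} {n r : nat} {M : topologicalType} {A : bd_atlas R n M}.
Variable V : metric_bundle A r.
Implicit Types (x : M) (a : chart A).

Lemma ipDl x (u v w : fiber V x) : ip (u + v) w = ip u w + ip v w.
Proof. by rewrite -[u]scale1r ip_linear mul1r scale1r. Qed.

Lemma ip0l x (w : fiber V x) : ip 0 w = 0.
Proof.
apply: (addrI (ip 0 w)); by rewrite -ipDl !addr0.
Qed.

Lemma ipZl x c (u w : fiber V x) : ip (c *: u) w = c * ip u w.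
Proof. by rewrite -[c *: u]addr0 ip_linear ip0l addr0. Qed.

Lemma ipNl x (u w : fiber V x) : ip (- u) w = - ip u w.
Proof. by rewrite -scaleN1r ipZl mulN1r. Qed.

Lemma ipBl x (u v w : fiber V x) : ip (u - v) w = ip u w - ip v w.
Proof. by rewrite ipDl ipNl. Qed.

Lemma ipZr x c (u w : fiber V x) : ip w (c *: u) = c * ip w u.
Proof. by rewrite ip_sym ipZl ip_sym. Qed.

Lemma ipBr x (u v w : fiber V x) : ip w (u - v) = ip w u - ip w v.
Proof. by rewrite ip_sym ipBl !(ip_sym w). Qed.

Lemma ip_suml x I (s : seq I) (f : I -> fiber V x) w :
  ip (\sum_(i <- s) f i) w = \sum_(i <- s) ip (f i) w.
Proof.
elim: s => [|i s IH]; first by rewrite !big_nil ip0l.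
by rewrite !big_cons ipDl IH.
Qed.

Lemma ip_sumr x I (s : seq I) (f : I -> fiber V x) w :
  ip w (\sum_(i <- s) f i) = \sum_(i <- s) ip w (f i).
Proof. by rewrite ip_sym ip_suml; apply: eq_bigr => i _; rewrite ip_sym. Qed.

(** Cauchy-Schwarz, by expanding the square of |v| u - |u| v. *)
Lemma ip_le_norm x (u v : fiber V x) : ip u v <= `|u| * `|v|.
Proof.
have [->|v0] := eqVneq v 0; first by rewrite ip_sym ip0l normr0 mulr0.
have nv : 0 < `|v| by rewrite normr_gt0.
have : 0 <= `| `|v| *: u - `|u| *: v | ^+ 2 by rewrite sqr_ge0.
rewrite -ip_norm ipBl !ipBr !ipZl !ipZr !ip_norm (ip_sym v u).
have [->|u0] := eqVneq u 0; first by rewrite ip0l normr0 mul0r.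
have nu : 0 < `|u| by rewrite normr_gt0.
move: (ip u v) `|u| `|v| nu nv => i p q p0 q0 h.
have : 0 <= 2 * (p * q) * (p * q - i) by apply: le_trans h _; nra.
by rewrite pmulr_rge0 ?subr_ge0 // !mulr_gt0.
Qed.

Lemma triv_inv_linear a x : chart_dom a x -> linear (triv_inv V a x).
Proof.
move=> ax c u v; rewrite -[LHS](@trivK _ _ _ _ _ V _ _ ax _) frameK //.
have := @trivK _ _ _ _ _ V _ _ ax (c *: triv_inv V a x u + triv_inv V a x v).
by rewrite triv_linear // !frameK.
Qed.

Lemma triv_invZ a x c u : chart_dom a x ->
  triv_inv V a x (c *: u) = c *: triv_inv V a x u.
Proof. by move=> ax; exact: linear_funZ (triv_inv_linear ax) _ _. Qed.

Lemma triv_invD a x u v : chart_dom a x ->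
  triv_inv V a x (u + v) = triv_inv V a x u + triv_inv V a x v.
Proof. by move=> ax; exact: linear_funD (triv_inv_linear ax) _ _. Qed.

Lemma triv_invB a x u v : chart_dom a x ->
  triv_inv V a x (u - v) = triv_inv V a x u - triv_inv V a x v.
Proof. by move=> ax; exact: linear_funB (triv_inv_linear ax) _ _. Qed.

Lemma triv_inv_sum a x I (s : seq I) (f : I -> 'rV[R]_r) : chart_dom a x ->
  triv_inv V a x (\sum_(i <- s) f i) = \sum_(i <- s) triv_inv V a x (f i).
Proof. by move=> ax; exact: linear_fun_sum (triv_inv_linear ax) _ _ _. Qed.

Lemma trivZ a x c (u : fiber V x) : chart_dom a x ->
  triv a (c *: u) = c *: triv a u.
Proof. by move=> ax; exact: linear_funZ (@triv_linear _ _ _ _ _ V _ _ ax) _ _. Qed.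

Lemma trivB a x (u v : fiber V x) : chart_dom a x ->
  triv a (u - v) = triv a u - triv a v.
Proof. by move=> ax; exact: linear_funB (@triv_linear _ _ _ _ _ V _ _ ax) _ _. Qed.

Lemma triv_sum a x I (s : seq I) (f : I -> fiber V x) : chart_dom a x ->
  triv a (\sum_(i <- s) f i) = \sum_(i <- s) triv a (f i).
Proof. by move=> ax; exact: linear_fun_sum (@triv_linear _ _ _ _ _ V _ _ ax) _ _ _. Qed.

(** The base point [chart_point a (chart_coord a x)] equals x only propositionally, so vectors over
    the two are compared in the total space, where no cast between fibers appears. *)
Definition total_pt a (p : 'rV[R]_n) (y : 'rV[R]_r) : total_space V :=
  TotalPt (triv_inv V a (chart_point a p) y).

Lemma total_ptE a x (v : fiber V x) : chart_dom a x ->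
  TotalPt v = total_pt a (chart_coord a x) (triv a v).
Proof.
move=> ax; rewrite /total_pt.
have : chart_point a (chart_coord a x) = x by exact: coordK.
by move: (chart_point a (chart_coord a x)) => x' xx'; subst x'; rewrite trivK.
Qed.

Lemma chart_point_dom a (p : 'rV[R]_n) : chart_img a p -> chart_dom a (chart_point a p).
Proof. by move=> [x ax <-]; rewrite coordK. Qed.

Lemma chart_pointK a (p : 'rV[R]_n) : chart_img a p -> chart_coord a (chart_point a p) = p.
Proof. by move=> [x ax <-]; rewrite coordK. Qed.

Definition fip a (p : 'rV[R]_n) (w z : 'rV[R]_r) : R :=
  ip (triv_inv V a (chart_point a p) w) (triv_inv V a (chart_point a p) z).

Definition gram a (p : 'rV[R]_n) : 'M[R]_r :=
  \matrix_(j, l) fip a p (delta_mx ord0 j) (delta_mx ord0 l).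

Lemma fipE a p w z : chart_img a p -> fip a p w z = (w *m gram a p *m z^T) ord0 ord0.
Proof.
move=> /chart_point_dom ap; rewrite /fip {1}(row_sum_delta w) {1}(row_sum_delta z).
rewrite !triv_inv_sum // ip_sumr mxE; apply: eq_bigr => l _.
rewrite ip_suml !mxE mulr_suml; apply: eq_bigr => j _.
rewrite !triv_invZ // ipZl ipZr !mxE /fip; ring.
Qed.

Lemma gram_smooth a : smooth_on (chart_img a) (gram a).
Proof.
apply: smooth_on_mx => i j.
apply: (@smooth_on_eq _ _ _ _ (fun p => fip a p (delta_mx ord0 i) (delta_mx ord0 j) : R^o)).
  by move=> p _; rewrite mxE.
exact: ip_smooth.
Qed.

End Fiber.

Lemma cvg_sum_seq {R : realType} {V : normedModType R} {T I : Type}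
    (F : set_system T) {FF : Filter F} (r : seq I) (f : I -> T -> V) (l : I -> V) :
  (forall i, f i @ F --> l i) ->
  (fun x => \sum_(i <- r) f i x) @ F --> \sum_(i <- r) l i.
Proof.
move=> fl; elim: r => [|i r IH].
  by rewrite big_nil; under eq_fun do rewrite big_nil; exact: cvg_cst.
by rewrite big_cons; under eq_fun do rewrite big_cons; apply: cvgD.
Qed.

Lemma cvg_to_within {T U : Type} (F : set_system T) {FF : Filter F}
    (G : set_system U) (f : T -> U) (D : set U) :
  f @ F --> G -> (\forall x \near F, D (f x)) -> f @ F --> within D G.
Proof.
by move=> fG nD P GP; apply: filterS2 nD (fG _ GP) => x Dx; apply.
Qed.

(** * Parallel transport along a line in a chart *)

Section Transport.
Context {R : realType}.

(* [ramp] is flat at 0 and at 1, so that a curve [p + ramp s *: w] between two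
   points of a half-space stays in it slightly beyond [[0, 1]] and is smooth on
   an open interval. *)
Definition ramp (s : R) : R := 3 * s ^+ 2 - 2 * s ^+ 3.
Definition dramp (s : R) : R := 6 * (s * (1 - s)).

Lemma is_derive_ramp s : is_derive s (1 : R) ramp (dramp s).
Proof.
have -> : ramp = 3 *: (@GRing.exp R ^~ 2%N) - 2 *: (@GRing.exp R ^~ 3%N) by [].
apply: is_derive_eq.
have e (t : R) : 3 * (t * 1 + t * 1) - 2 * (t * (t * 1 + t * 1) + t * t * 1) = dramp t.
  by rewrite /dramp; ring.
exact: e.
Qed.

(** The values stay in [0, 1] as long as s lies between -1/2 and 3/2; the smaller window used
    throughout also keeps the derivative below 2. *)
Lemma ramp_itv s : - (1 / 4) < s < 5 / 4 -> 0 <= ramp s <= 1.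
Proof.
move=> h; have -> : ramp s = s ^+ 2 * (3 - 2 * s) by rewrite /ramp; ring.
apply/andP; split; first by rewrite mulr_ge0 ?sqr_ge0 //; lra.
have : 0 <= (1 - s) ^+ 2 * (1 + 2 * s) by rewrite mulr_ge0 ?sqr_ge0 //; lra.
by move=> h1; rewrite -subr_ge0; move: h1; congr (_ <= _); ring.
Qed.

Lemma dramp_le s : - (1 / 4) <= s <= 5 / 4 -> `|dramp s| <= 2.
Proof.
move=> h; have h1 : 0 <= (s + 1 / 4) * (5 / 4 - s) by rewrite mulr_ge0 //; lra.
have h2 : 0 <= (s - 1 / 2) ^+ 2 by rewrite sqr_ge0.
rewrite /dramp ler_norml; lra.
Qed.

Lemma dramp_gt0 s : 0 < s < 1 -> 0 < dramp s.
Proof. by move=> h; rewrite /dramp !mulr_gt0 //; lra. Qed.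

Lemma ramp0 : ramp 0 = 0. Proof. by rewrite /ramp; ring. Qed.
Lemma ramp1 : ramp 1 = 1. Proof. by rewrite /ramp; ring. Qed.

Context {n r : nat}.
Implicit Types (G : 'rV[R]_n -> 'I_n -> 'M[R]_r) (p w : 'rV[R]_n).

(** The connection form evaluated on w. *)
Definition along G w p : 'M[R]_r := \sum_i w ord0 i *: G p i.

(* The equation of parallel transport along [p + ramp s *: w] *)
Definition transport G p w (y : R -> 'rV[R]_r) := forall s : R,
  - (1 / 4) < s < 5 / 4 ->
  is_derive s (1 : R) y (- (dramp s *: (y s *m along G w (p + ramp s *: w)))).

Lemma along_norm G w p B : 0 <= B -> (forall i, `|G p i| <= B) ->
  `|along G w p| <= n%:R * `|w| * B.
Proof.
move=> B0 GB; rewrite /along; apply: le_trans (ler_norm_sum _ _ _) _.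
have -> : n%:R * `|w| * B = \sum_(k < n) (`|w| * B).
  by rewrite sumr_const card_ord -mulrA mulr_natl.
by apply: ler_sum => k _; rewrite normrZ ler_pM //; exact: mx_norm_ge.
Qed.

(** Since |dramp| <= 2, the equation has Lipschitz constant K = 2 r n B |w|. On a window of length
    3/2 the Picard condition reads K <= 1/3, and the Picard bound becomes 3 K |y0|. *)
Lemma transport_exists G p w (S : set 'rV[R]_n) B s0 y0 :
  (forall c, 0 <= c <= 1 -> S (p + c *: w)) ->
  (forall i, {within S, continuous (fun q => G q i)}) ->
  0 <= B -> (forall c i, 0 <= c <= 1 -> `|G (p + c *: w) i| <= B) ->
  2 * r%:R * n%:R * B * `|w| <= 1 / 3 ->
  - (1 / 4) < s0 < 5 / 4 ->
  exists y, [/\ y s0 = y0, transport G p w y &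
    forall s : R, - (1 / 4) < s < 5 / 4 ->
      `|y s - y0| <= 6 * r%:R * n%:R * B * `|w| * `|y0|].
Proof.
move=> Sw Gc B0 GB small s0i.
(* Clamping the parameter of the segment makes the coefficients continuous for all s; on the window
   it changes nothing, as [ramp] takes values in [0, 1] there. *)
pose cl (c : R) : R := Num.max 0 (Num.min 1 c).
have cl_itv c : 0 <= cl c <= 1.
  by rewrite /cl le_max lexx /= ge_max ler01 ge_min lexx.
have cl_id c : 0 <= c <= 1 -> cl c = c.
  by move=> /andP[c0 c1]; rewrite /cl min_r // max_r.
have cl_cont : continuous cl.
  move=> s; apply: (@continuous_max R R (cst 0) (fun s => Num.min 1 s)).
    exact: cvg_cst.
  by apply: (@continuous_min R R (cst 1) id); [exact: cvg_cst|exact: cvg_id].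
have ramp_cont : continuous ramp.
  move=> s; apply: differentiable_continuous; apply/derivable1_diffP.
  by have [] := is_derive_ramp s.
have dramp_cont : continuous dramp.
  move=> s; rewrite /dramp; apply: cvgM; first exact: cvg_cst.
  apply: cvgM; first exact: cvg_id.
  by apply: cvgB; [exact: cvg_cst|exact: cvg_id].
pose th s := p + cl (ramp s) *: w.
have th_cont : continuous th.
  move=> s; apply: cvgD; first exact: cvg_cst.
  apply: cvgZr_tmp; apply: continuous_comp; [exact: ramp_cont|exact: cl_cont].
pose W s := along G w (th s).
have W_cont : continuous W.
  move=> s; apply: cvg_sum_seq => i; apply: cvgZl_tmp.
  have /subspace_continuousP/(_ (th s) (Sw _ (cl_itv _))) H := Gc i.
  have th_in : th @ s --> within S (nbhs (th s)).
    apply: cvg_to_within; first exact: th_cont.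
    by apply: nearW => t; exact: Sw.
  exact: (@cvg_comp _ _ _ th (fun q => G q i) (nbhs s) (within S (nbhs (th s))) _ th_in H).
pose F s (u : 'rV[R]_r) := - (dramp s *: (u *m W s)).
pose K := 2 * r%:R * n%:R * B * `|w|.
have K0 : 0 <= K by rewrite !mulr_ge0.
have WK s : `|W s| <= n%:R * `|w| * B.
  by apply: along_norm => // i; exact: GB.
have FK s u : - (1 / 4) <= s <= 5 / 4 -> `|F s u| <= K * `|u|.
  move=> hs; rewrite normrN normrZ.
  apply: le_trans (ler_pM _ _ (dramp_le hs) (mulmx_norm_le _ _)) _ => //.
  apply: (@le_trans _ _ (2 * (r%:R * `|u| * (n%:R * `|w| * B)))).
    by rewrite ler_pM2l // ler_wpM2l ?mulr_ge0.
  by rewrite /K le_eqVlt; apply/orP; left; apply/eqP; ring.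
have F_lip s u z : - (1 / 4) <= s <= 5 / 4 -> `|F s u - F s z| <= K * `|u - z|.
  by move=> hs; rewrite /F -opprD -scalerBr -mulmxBl; exact: FK.
have F_cont u : continuous u -> continuous (fun s => F s (u s)).
  move=> cu s; apply: cvgN; apply: cvgZ; first exact: dramp_cont.
  apply/cvg_mxP => i j.
  have -> : (fun x => (u x *m W x) i j) = (fun x => \sum_l u x i l * W x l j).
    by apply/funext => x; rewrite mxE.
  rewrite mxE; apply: cvg_sum_seq => l; apply: cvgM.
    by have /cvg_mxP := cu s; apply.
  by have /cvg_mxP := W_cont s; apply.
have s0i' : - (1 / 4) <= s0 <= 5 / 4 by lra.
have Kab : K * (5 / 4 - - (1 / 4)) <= 2^-1 by rewrite /K in K0 *; lra.
have [y [y_s0 dy ybd]] :=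
  picard s0i' K0 Kab F_lip F_cont (fun s hs => FK s y0 hs).
exists y; split => // s hs; last first.
  have := ybd s; rewrite -/K => h; apply: le_trans (h _) _; first lra.
  have -> : 6 * r%:R * n%:R * B * `|w| = 3 * K by rewrite /K; ring.
  lra.
have hs' : - (1 / 4) <= s <= 5 / 4 by lra.
have := dy s hs'; rewrite /F /W /th cl_id //; exact: ramp_itv.
Qed.

End Transport.

Section AlongLine.
Context {R : realType} {n r : nat} {M : topologicalType} {A : bd_atlas R n M}.
Variables (V : metric_bundle A r) (a : chart A).
Variable G : 'rV[R]_n -> 'I_n -> 'M[R]_r.
Hypothesis G_metric : metric_compatible a
  (fun p w z => ip (triv_inv V a (chart_point a p) w) (triv_inv V a (chart_point a p) z)) G.

Lemma cov_vec_cst i v p : chart_img a p ->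
  cov_vec a G (e_ i) (fun=> v) p = v *m G p i.
Proof.
move=> ap; rewrite /cov_vec (bigD1 i) //= big1 ?addr0; last first.
  by move=> j ji; rewrite mxE (negPf ji) andbF scale0r.
have PF := chart_steps i ap.
by rewrite deriv_in_cst // add0r mxE !eqxx scale1r.
Qed.

(** This is metric compatibility tested on the constant sections of the frame. *)
Lemma gram_deriv p i : chart_img a p ->
  deriv_in (chart_img a) (gram V a) (e_ i) p =
  G p i *m gram V a p + gram V a p *m (G p i)^T.
Proof.
move=> ap; have PF := chart_steps i ap.
have sg := @gram_smooth _ _ _ _ _ V a.
have [U [g' [oU Up cg gg' dg]]] := smooth_on_deriv_inE sg ap.
apply/matrixP => j l; rewrite dg // derive_mx; last first.
  by apply: diff_derivable; apply: (cg 1%N).1.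
rewrite mxE.
have := G_metric (@smooth_on_cst _ _ _ (chart_img a) (delta_mx ord0 j))
  (@smooth_on_cst _ _ _ (chart_img a) (delta_mx ord0 l))
  (e_ i) ap.
rewrite !cov_vec_cst // -!/(fip V a _ _ _) !fipE //.
have -> : deriv_in (chart_img a) (fun q => fip V a q (delta_mx ord0 j) (delta_mx ord0 l) : R^o)
    (e_ i) p = 'D_(e_ i) (fun q => g' q j l : R^o) p.
  apply: (deriv_inE PF oU Up ap).
    by move=> q Uq aq; rewrite -gg' // mxE.
  apply: (derivable_mxP _ _ _).1; apply: diff_derivable; exact: (cg 1%N).1.
move=> ->; have entry (Q : 'M[R]_r) :
    (delta_mx (@ord0 0) j *m Q *m (delta_mx (@ord0 0) l)^T) ord0 ord0 = Q j l.
  have -> : @ord0 0 = 0 by [].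
  by rewrite -rowE trmx_delta -colE !mxE.
rewrite trmx_mul -(mulmxA _ (G p i)) entry.
by rewrite !mulmxA -(mulmxA _ _ (G p i)^T) entry [in RHS]mxE.
Qed.

Variables (p w : 'rV[R]_n).
Hypothesis line : forall c : R, 0 <= c <= 1 -> chart_img a (p + c *: w).

Lemma chart_img_ramp s : - (1 / 4) < s < 5 / 4 -> chart_img a (p + ramp s *: w).
Proof. by move=> hs; apply/line/ramp_itv. Qed.

Lemma near_ramp (s : R) : - (1 / 4) < s < 5 / 4 ->
  \forall t \near s, - (1 / 4) < (t : R) < 5 / 4.
Proof.
move=> /andP[h1 h2]; near=> t; apply/andP; split; near: t.
  exact: lt_nbhsr.
exact: lt_nbhsl.
Unshelve. all: by end_near. Qed.

(** Leibniz rule with a parallel second factor: the derivative of the Gram matrix cancels the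
    connection term of y and supplies the one of x, so that the covariant derivative of x
    remains. *)
Lemma is_derive_fip_transport (x y : R -> 'rV[R]_r) (dx : 'rV[R]_r) (s : R) :
  is_derive s (1 : R) x dx -> transport G p w y -> - (1 / 4) < s < 5 / 4 ->
  is_derive s (1 : R) (fun t => fip V a (p + ramp t *: w) (x t) (y t))
    (fip V a (p + ramp s *: w) (dx + dramp s *: (x s *m along G w (p + ramp s *: w))) (y s)).
Proof.
move=> Dx /[swap] hs /(_ s hs) Dy; have as_ := chart_img_ramp hs.
set th := p + ramp s *: w in Dy as_ *.
have nJ := near_ramp hs.
have nth : \forall t \near s, chart_img a (p + ramp t *: w).
  by apply: filterS nJ => t; exact: chart_img_ramp.
have DH : is_derive s (1 : R) (fun t => gram V a (p + ramp t *: w))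
    (dramp s *: (along G w th *m gram V a th + gram V a th *m (along G w th)^T)).
  have sg : smooth_on (setT `&` chart_img a) (gram V a).
    by rewrite setTI; exact: gram_smooth.
  have := derive_chart_line openT I sg nth (is_derive_ramp s).
  rewrite -/th; congr (is_derive _ _ _ (_ *: _)).
  rewrite /along mulmx_suml linear_sum mulmx_sumr -big_split /=; apply: eq_bigr => i _.
  rewrite gram_deriv // scalerDr -scalemxAl.
  by rewrite (_ : (w ord0 i *: G th i)^T = w ord0 i *: (G th i)^T) ?linearZ //= -scalemxAr.
have DyT : is_derive s (1 : R) (fun t => (y t)^T) (- (dramp s *: (y s *m along G w th)))^T.
  apply/is_derive_mxP => i j; have /is_derive_mxP/(_ j i) h := Dy.
  have -> : (fun t => (y t)^T i j) = (fun t => y t j i).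
    by apply/funext => t; rewrite mxE.
  by rewrite [X in is_derive _ _ _ X]mxE.
have D := is_derive_mulmx (is_derive_mulmx Dx DH) DyT.
have {}D := (is_derive_mxP _ _ _).1 D ord0 ord0.
apply: (@near_eq_is_derive _ _ _
  (fun t => (x t *m gram V a (p + ramp t *: w) *m (y t)^T) ord0 ord0)).
  by apply: filterS nth => t at_; rewrite fipE.
rewrite fipE //; move: D; congr (is_derive _ _ _ _); congr (fun Q : 'M[R]_1 => Q ord0 ord0).
rewrite -/th; set Q := along G w th.
have -> : (- (dramp s *: (y s *m Q)))^T = - (dramp s *: (Q^T *m (y s)^T)).
  by rewrite -trmx_mul; apply/matrixP => i j; rewrite !mxE.
rewrite !(mulmxDl, mulmxDr) mulmxN -!scalemxAr -!scalemxAl !(mulmxDl, mulmxDr) !mulmxA.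
by rewrite scalerDr addrA addrK.
Qed.

End AlongLine.

(** * Invariance of C under transport along lines *)

Section CkReal.
Context {R : realType}.

Lemma derive_real {F : normedModType R} (f : R^o -> F) (s v : R^o) :
  differentiable f s -> 'D_v f s = v *: 'D_1 f s.
Proof.
by move=> df; rewrite !deriveE // -{1}[v]mulr1 -[v * 1]/(v *: (1 : R^o)) linearZ.
Qed.

Lemma Ck_id (U : set R^o) k : open U -> Ck U k (id : R^o -> R^o).
Proof.
move=> oU; case: k => [|k]; first by move=> s _; exact: cvg_id.
split=> [s _|v]; first by [].
by apply: Ck_ext (Ck_cst k v oU) => // s _; rewrite derive_id.
Qed.

(** Bootstrap: if Y is C^k, so is its derivative Y B, hence Y is C^(k+1). *)
Lemma Ck_linear_ode r (J : set R^o) (Y : R^o -> 'rV[R]_r) (B : R^o -> 'M[R]_r) :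
  open J -> (forall k, Ck J k B) ->
  (forall s, J s -> is_derive s (1 : R) Y (Y s *m B s)) -> forall k, Ck J k Y.
Proof.
move=> oJ cB dY; have diffY s : J s -> differentiable Y s.
  by move=> /dY[dYs _]; apply/derivable1_diffP.
elim=> [|k IH]; first by move=> s /diffY/differentiable_continuous.
split=> // v; have c := Ck_mulmx oJ (Ck_cst k (v%:M : 'M[R]_1) oJ) (Ck_mulmx oJ IH (cB k)).
apply: Ck_ext c => // s Js.
by rewrite derive_real; [have [_ ->] := dY s Js; rewrite mul_scalar_mx|exact: diffY].
Qed.

Lemma Ck_ramp k : Ck setT k (ramp : R^o -> R^o).
Proof.
have oT : open [set: R^o] by exact: openT.
have c := Ck_id k oT; have c3 := Ck_cst k (3 : R^o) oT; have c2 := Ck_cst k (- 2 : R^o) oT.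
apply: Ck_ext (CkD oT (CkM oT c3 (CkM oT c c)) (CkM oT c2 (CkM oT c (CkM oT c c)))) => //.
by move=> s _; rewrite /ramp; ring.
Qed.

Lemma Ck_dramp k : Ck setT k (dramp : R^o -> R^o).
Proof.
have oT : open [set: R^o] by exact: openT.
have c := Ck_id k oT; have c6 := Ck_cst k (6 : R^o) oT; have c6' := Ck_cst k (- 6 : R^o) oT.
apply: Ck_ext (CkD oT (CkM oT c6 c) (CkM oT c6' (CkM oT c c))) => //.
by move=> s _; rewrite /dramp; ring.
Qed.

End CkReal.

Section TransportInvariance.
Context {R : realType} {n r : nat} {M : topologicalType} {A : bd_atlas R n M}.
Variables (V : metric_bundle A r) (T : R).
Variable D : chart A -> R -> 'rV[R]_n -> 'I_n -> 'M[R]_r.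
Hypothesis D_conn : is_connection (transition_mx V) T D.
Variables (t : R) (C : set (total_space V)).
Hypothesis tT : 0 <= t <= T.
Hypothesis C_par : parallel_invariant (fun a => D a t) C.

Lemma connection_smooth a i : smooth_on (chart_img a) (fun q => D a t q i).
Proof.
by have [h _] := D_conn; exact: (smooth_on_slice (S' := seg 0 T) tT (h a i)).
Qed.

Let overlap (a b : chart A) : set 'rV[R]_n :=
  chart_coord a @` (chart_dom a `&` chart_dom b).

Let overlapP a b q : overlap a b q <-> chart_img a q /\ chart_dom b (chart_point a q).
Proof.
split=> [[x [ax bx] <-]|[[x ax <-]]]; first by rewrite coordK //; split => //; exists x.
by rewrite coordK // => bx; exists x.
Qed.

Let overlap_open a b q : overlap a b q ->
  exists W, [/\ open W, W q & W `&` chart_img a `<=` overlap a b].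
Proof.
move=> /overlapP[aq bq].
have /subspace_continuousP/(_ q aq) := @point_cont _ _ _ A a.
move/(_ _ (open_nbhs_nbhs (conj (dom_open b) bq))).
rewrite /= /within /= nbhs_simpl /= nbhsE => -[W [oW Wq] WS].
by exists W; split => // z [Wz az]; apply/overlapP; split => //; exact: WS.
Qed.

Let transition_smooth_on a b : smooth_on (overlap a b) (transition_mx V a b).
Proof.
apply: smooth_on_mx => j l.
apply: (smooth_on_eq _ (smooth_on_coord ord0 l (@triv_smooth _ _ _ _ _ V a b (delta_mx ord0 j)))).
by move=> q _; rewrite mxE.
Qed.

Variables (a : chart A) (p w : 'rV[R]_n) (y : R -> 'rV[R]_r) (s0 s1 : R).
Hypothesis line : forall c : R, 0 <= c <= 1 -> chart_img a (p + c *: w).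
Hypothesis y_tr : transport (D a t) p w y.
Hypothesis s0i : 0 <= s0 <= 1.
Hypothesis s1i : 0 <= s1 <= 1.

(** Affine change of parameter from [0, 1] onto the piece between s0 and s1; s1 < s0 is allowed,
    which reverses the curve. *)
Let tau (s : R^o) : R^o := s0 + s *: (s1 - s0).
Let J : set R^o := [set s | - (1 / 4) < tau s < 5 / 4].
Let th (s : R^o) : 'rV[R]_n := p + ramp (tau s) *: w.
Let c (s : R) : M := chart_point a (th s).
Let Y (s : R^o) : 'rV[R]_r := y (tau s).

Let tau_cont : continuous tau.
Proof. by move=> s; apply: cvgD; [exact: cvg_cst|apply: cvgZr_tmp; exact: cvg_id]. Qed.

Let J_open : open J.
Proof.
have -> : J = tau @^-1` ([set x | - (1 / 4) < x] `&` [set x | x < 5 / 4]).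
  by apply/seteqP; split => s /=; [move=> /andP[]|move=> [h1 h2]; apply/andP].
apply: open_comp => [s _|]; first exact: tau_cont.
by apply: openI; [exact: open_gt|exact: open_lt].
Qed.

Let J01 s : 0 <= s <= 1 -> J s.
Proof.
move=> hs; rewrite /J /= /tau.
have -> : s0 + s *: (s1 - s0) = (1 - s) * s0 + s * s1 by rewrite /GRing.scale /=; ring.
move: s0i s1i hs => h0 h1 hs.
have : 0 <= (1 - s) * s0 + s * s1 by rewrite addr_ge0 // mulr_ge0 //; lra.
have : 0 <= (1 - s) * (1 - s0) + s * (1 - s1) by rewrite addr_ge0 // mulr_ge0 //; lra.
lra.
Qed.

Let th_img s : J s -> chart_img a (th s).
Proof. by move=> Js; apply/line/ramp_itv. Qed.

Let Ck_tau k : Ck setT k tau.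
Proof.
have oT : open [set: R^o] by exact: openT.
by apply: Ck_ext (CkD oT (Ck_cst k (s0 : R^o) oT) (CkM oT (Ck_id k oT) (Ck_cst k (s1 - s0 : R^o) oT))).
Qed.

Let Ck_Q k : Ck J k (fun s => ramp (tau s) : R^o).
Proof.
apply: Ck_sub (@subsetT _ J) _.
(* [Ck_comp_line] speaks of matrix-valued maps, hence the passage through 1 x 1 matrices. *)
pose m (x : R^o) : 'M[R]_1 := (ramp x)%:M.
have cm : Ck setT k m.
  apply/Ck_mxP => [|i j]; first exact: openT.
  apply: Ck_ext (Ck_ramp k); first exact: openT.
  by move=> x _; rewrite !ord1 /m mxE eqxx mulr1n.
have h := @Ck_comp_line _ _ 1 1 setT setT k m id s0 (s1 - s0) openT openT
  (fun _ _ => I) cm (Ck_id k openT).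
have := (Ck_mxP k _ openT).1 h ord0 ord0.
by apply: Ck_ext => [|x _]; [exact: openT|rewrite /m mxE eqxx mulr1n].
Qed.

Let Ck_dQ k : Ck J k (fun s => dramp (tau s) : R^o).
Proof.
apply: Ck_sub (@subsetT _ J) _.
pose m (x : R^o) : 'M[R]_1 := (dramp x)%:M.
have cm : Ck setT k m.
  apply/Ck_mxP => [|i j]; first exact: openT.
  apply: Ck_ext (Ck_dramp k); first exact: openT.
  by move=> x _; rewrite !ord1 /m mxE eqxx mulr1n.
have h := @Ck_comp_line _ _ 1 1 setT setT k m id s0 (s1 - s0) openT openT
  (fun _ _ => I) cm (Ck_id k openT).
have := (Ck_mxP k _ openT).1 h ord0 ord0.
by apply: Ck_ext => [|x _]; [exact: openT|rewrite /m mxE eqxx mulr1n].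
Qed.

Let is_derive_comp_tau {F : normedModType R} (g : R -> F) (s : R) (dg : F) :
  is_derive (tau s) (1 : R) g dg ->
  is_derive s (1 : R) (fun x => g (tau x)) ((s1 - s0) *: dg).
Proof.
move=> [Dg <-]; have dg' : differentiable (g : R^o -> F) (tau s) by apply/derivable1_diffP.
have di : differentiable (id : R^o -> R^o) s by [].
have [h1 h2] := @derive_comp_line _ _ _ g id s0 (s1 - s0) s 1 di dg'.
split; first exact/derivable1_diffP.
rewrite h2 derive_id scale1r; exact: derive_real.
Qed.

Let dQ s := (s1 - s0) * dramp (tau s).

Let is_derive_Q (s : R) : is_derive s (1 : R) (fun x => ramp (tau x)) (dQ s).
Proof. exact: (is_derive_comp_tau (is_derive_ramp _)). Qed.

Let is_derive_Y s : J s ->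
  is_derive s (1 : R) Y (- (dQ s *: (Y s *m along (D a t) w (th s)))).
Proof.
by move=> Js; have := is_derive_comp_tau (y_tr Js); rewrite scalerN scalerA.
Qed.

Let Ck_along k : Ck J k (fun s => along (D a t) w (th s)).
Proof.
apply: (@Ck_sum _ _ _ J k _ (index_enum 'I_n) (fun i s => w ord0 i *: D a t (th s) i) J_open) => i.
apply: Ck_scale_mx => //; first exact: Ck_cst.
exact: (@smooth_on_comp_line _ _ _ _ (chart_img a) J (fun q => D a t q i)
  (fun s => ramp (tau s)) p w J_open th_img (@connection_smooth a i) Ck_Q).
Qed.

Let Ck_Y k : Ck J k Y.
Proof.
apply: (@Ck_linear_ode _ _ _ _ (fun s => - (dQ s) *: along (D a t) w (th s))) => //.
  move=> m; apply: Ck_scale_mx => //.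
  apply: Ck_ext (CkM J_open (Ck_cst m (- (s1 - s0) : R^o) J_open) (Ck_dQ m)) => // s _.
  by rewrite /dQ mulNr.
by move=> s Js; rewrite -scalemxAr scaleNr; exact: is_derive_Y.
Qed.

Let th_cont s : J s -> {for s, continuous th}.
Proof.
move=> Js; apply: cvgD; first exact: cvg_cst.
by apply: cvgZr_tmp; exact: (Ck_Q 0).
Qed.

Let c_cont s : J s -> {for s, continuous c}.
Proof.
move=> Js; have /subspace_continuousP/(_ _ (th_img Js)) H := @point_cont _ _ _ A a.
apply: (@cvg_comp _ _ _ th (chart_point a) (nbhs s) (within (chart_img a) (nbhs (th s))) _ _ H).
apply: cvg_to_within; first exact: th_cont.
by apply: filterS (open_nbhs_nbhs (conj J_open Js)) => x; exact: th_img.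
Qed.

Let Jb (b : chart A) : set R^o := J `&` [set s | chart_dom b (c s)].

Let Jb_open b : open (Jb b).
Proof.
rewrite openE => s [Js bs]; apply: filterI; first exact: open_nbhs_nbhs.
exact: (c_cont Js (open_nbhs_nbhs (conj (dom_open b) bs))).
Qed.

Let th_overlap b s : Jb b s -> overlap a b (th s).
Proof. by move=> [Js bs]; apply/overlapP; split => //; exact: th_img. Qed.

Let CkJb m1 m2 b (g : 'rV[R]_n -> 'M[R]_(m1, m2)) k : smooth_on (overlap a b) g ->
  Ck (Jb b) k (fun s => g (th s)).
Proof.
move=> sg; have cq m : Ck (Jb b) m (fun s => ramp (tau s) : R^o).
  by apply: Ck_sub (Ck_Q m) => s [].
exact: (@smooth_on_comp_line _ _ _ _ _ (Jb b) g (fun s => ramp (tau s)) p w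
  (@Jb_open b) (@th_overlap b) sg cq).
Qed.

Let dline {F : normedModType R} b (g : 'rV[R]_n -> F) s :
  smooth_on (overlap a b) g -> Jb b s ->
  is_derive s (1 : R) (fun x => g (th x))
    (dQ s *: \sum_i w ord0 i *: deriv_in (chart_img a) g (e_ i) (th s)).
Proof.
move=> sg bs; have [W [oW Ws WS]] := overlap_open (th_overlap bs).
have nth : \forall x \near s, chart_img a (p + ramp (tau x) *: w).
  by case: bs => Js _; apply: filterS (open_nbhs_nbhs (conj J_open Js)) => x; exact: th_img.
exact: (@derive_chart_line _ _ _ _ _ a W g (fun x => ramp (tau x)) p w s (dQ s) oW Ws
  (smooth_on_sub WS sg) nth (is_derive_Q s)).
Qed.

Let W_ (s : R) : fiber V (c s) := triv_inv V a (c s) (Y s).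

Let triv_W b s : Jb b s -> triv b (W_ s) = Y s *m transition_mx V a b (th s).
Proof.
move=> [Js bs]; have acs : chart_dom a (c s) := chart_point_dom (th_img Js).
rewrite /W_ {1}(row_sum_delta (Y s)) triv_inv_sum // triv_sum //.
rewrite mulmx_sum_row; apply: eq_bigr => j _; rewrite triv_invZ // trivZ //.
by congr (_ *: _); apply/rowP => l; rewrite !mxE.
Qed.

Let curve_smooth : smooth_curve A c.
Proof.
split.
  apply/subspace_continuousP => s s01; apply: cvg_trans (c_cont (J01 s01)).
  by apply: cvg_app; exact: cvg_within.
move=> b s [s01 bs]; exists (Jb b), (fun s => chart_coord b (c s)); split => //.
- by split => //; exact: J01.
- by move=> k; exact: (@CkJb _ _ b (fun q => chart_coord b (chart_point a q)) k (@transition_smooth _ _ _ A a b)).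
Qed.

(** The equation holds in chart [a] by construction, but [parallel] asks for it in every chart b.
    There the section is Y times the transition matrix, and the transformation law of the connection
    coefficients converts one equation into the other. *)
Let transport_parallel : parallel (fun a => D a t) W_.
Proof.
move=> b; split=> [s [s01 bs]|s s01 bs].
  have Jbs : Jb b s by split => //; exact: J01.
  exists (Jb b), (fun s => triv b (W_ s)); split => // k.
  have oJb := @Jb_open b; have sub : Jb b `<=` J by move=> x [].
  apply: Ck_ext (Ck_mulmx oJb (Ck_sub sub (Ck_Y k)) (@CkJb _ _ b (transition_mx V a b) k (@transition_smooth_on a b))) => //.
  by move=> x Jx; rewrite triv_W.
have Jbs : Jb b s by split => //; exact: J01.
have [Js _] := Jbs.
have PF : ProperFilter (steps (seg 0 1) (1 : R^o) (s : R^o)).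
  exact: seg_steps_proper.
have Dwa : is_derive s (1 : R) (fun s => triv b (W_ s))
    (- (dQ s *: (Y s *m along (D a t) w (th s))) *m transition_mx V a b (th s) +
     Y s *m (dQ s *: \sum_i w ord0 i *: deriv_in (chart_img a) (transition_mx V a b) (e_ i) (th s))).
  apply: (@near_eq_is_derive _ _ _ (fun s => Y s *m transition_mx V a b (th s))).
    by apply: filterS (open_nbhs_nbhs (conj (@Jb_open b) Jbs)) => x Jx; rewrite triv_W.
  apply: is_derive_mulmx; first exact: is_derive_Y.
  exact: @dline _ b (transition_mx V a b) s (@transition_smooth_on a b) Jbs.
have Dca := @dline _ b (fun q => chart_coord b (chart_point a q)) s (@transition_smooth _ _ _ A a b) Jbs.
have s01' : seg 0 1 (s : R^o) by [].
have [D1 E1] := Dwa; have [D2 E2] := Dca.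
(* The curve is differentiable on both sides of every point of [0, 1], so the one-sided derivatives
   in [parallel] are ordinary ones. *)
rewrite (deriv_inE PF openT I s01' (fun _ _ _ => erefl) D1) E1.
rewrite (deriv_inE PF openT I s01' (fun _ _ _ => erefl) D2) E2.
have [_ conn] := D_conn.
have acs : chart_dom a (c s) := chart_point_dom (th_img Js).
have E i := conn a b (c s) t i acs bs tT.
rewrite /= (_ : chart_coord a (c s) = th s) in E; last exact/chart_pointK/th_img.
set tr := transition_mx V a b (th s) in E *.
(* X1 is the derivative of the transition matrix along w, which cancels by the product rule; X2 is
   the connection term of chart b. *)
pose X1 := \sum_i w ord0 i *: deriv_in (chart_img a) (transition_mx V a b) (e_ i) (th s).
pose X2 := \sum_i w ord0 i *: \sum_j Defs.jacobian a b (th s) i j *: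
  (tr *m D b t (chart_coord b (c s)) j).
have -> : (- (dQ s *: (Y s *m along (D a t) w (th s)))) *m tr =
    - (dQ s *: (Y s *m (X1 + X2))).
  rewrite mulNmx -scalemxAl -mulmxA /along mulmx_suml -big_split /=.
  congr (- (_ *: (_ *m _))); apply: eq_bigr => i _.
  by rewrite -scalemxAl E scalerDr.
rewrite -/X1.
have -> : \sum_j (dQ s *: \sum_i w ord0 i *: deriv_in (chart_img a)
      (fun q => chart_coord b (chart_point a q)) (e_ i) (th s)) ord0 j *:
    (triv b (W_ s) *m D b t (chart_coord b (c s)) j) = dQ s *: (Y s *m X2).
  rewrite triv_W // -/tr /X2 mulmx_sumr [in RHS]scaler_sumr.
  under [RHS]eq_bigr do rewrite -scalemxAr mulmx_sumr !scaler_sumr.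
  rewrite exchange_big /=; apply: eq_bigr => j _.
  rewrite mxE summxE mulr_sumr scaler_suml; apply: eq_bigr => i _.
  by rewrite !mxE -scalemxAr !scalerA !mulmxA mulrA.
by rewrite mulmxDr scalerDr -scalemxAr opprD addrAC addrNK addNr.
Qed.

(** Both orientations matter: points of C are moved forward into a prescribed fiber, and backward to
    the fiber over the maximum point. *)
Lemma transport_invariant :
  C (total_pt V a (p + ramp s0 *: w) (y s0)) -> C (total_pt V a (p + ramp s1 *: w) (y s1)).
Proof.
have := C_par curve_smooth transport_parallel.
rewrite /W_ /c /th /Y.
have -> : tau 0 = s0 by rewrite /tau scale0r addr0.
by have -> : tau 1 = s1 by rewrite /tau scale1r addrC subrK.
Qed.

End TransportInvariance.

(** * Distance to closed convex subsets of a fiber *)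

Section DistSet.
Context {R : realType} {W : normedModType R}.
Implicit Types (w c : W) (X : set W).

Lemma dist_set_le w X c : X c -> dist_set w X <= `|w - c|.
Proof. by move=> Xc; apply: ge_inf; [exists 0 => _ [z _ <-]|exists c]. Qed.

Lemma dist_set_ge w X (m : R) : X !=set0 -> (forall c, X c -> m <= `|w - c|) ->
  m <= dist_set w X.
Proof.
move=> [c Xc] H; apply: lb_le_inf; first by exists `|w - c|, c.
by move=> _ [z Xz <-]; exact: H.
Qed.

Lemma dist_set_lt w X (e : R) : X !=set0 -> dist_set w X < e ->
  exists2 c, X c & `|w - c| < e.
Proof.
move=> [c Xc] /inf_lt[|_ [z Xz <-] ze]; last by exists z.
by exists `|w - c|, c.
Qed.

Lemma dist_set_ge0 w X : 0 <= dist_set w X.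
Proof.
have [->|/set0P X0] := eqVneq X set0; first by rewrite /dist_set image_set0 inf0.
by apply: dist_set_ge => // c _.
Qed.

End DistSet.

Section FiberGeometry.
Context {R : realType} {n r : nat} {M : topologicalType} {A : bd_atlas R n M}.
Variable V : metric_bundle A r.
Implicit Types (x : M) (a : chart A).

(** Moving from v towards c by a fraction s does not bring the point closer to f, so 2 s b <= s^2 q
    with b the inner product in question and q = |c - v|^2. If b were positive, this would fail at s
    = min(1, b/q). *)
Lemma nearest_support x (X : set (fiber V x)) (f v c : fiber V x) :
  convex_set X -> nearest f X v -> X c -> ip (c - v) (f - v) <= 0.
Proof.
move=> cX [Xv dv] Xc; rewrite leNgt; apply/negP => pos.
set b := ip (c - v) (f - v) in pos.
pose q := ip (c - v) (c - v).
have q0 : 0 <= q by rewrite /q ip_norm sqr_ge0.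
have step (s : R) : 0 <= s -> s <= 1 -> 2 * s * b <= s ^+ 2 * q.
  move=> s0 s1; have Xs : X (s *: c + (1 - s) *: v).
    have := cX c v (Itv01 s0 s1); rewrite !inE => /(_ Xc Xv).
    exact.
  have := dist_set_le f Xs; rewrite -dv => /(lerXn2r 2).
  rewrite !nnegrE !normr_ge0 => /(_ isT isT).
  have -> : f - (s *: c + (1 - s) *: v) = (f - v) - s *: (c - v).
    by rewrite scalerBl scale1r scalerBr !opprD !opprK !addrA; congr (_ + _); rewrite addrAC.
  rewrite /q /b; move: (f - v) (c - v) => g h.
  rewrite -!ip_norm !ipBl !ipBr !(ipZl, ipZr) (ip_sym g h).
  rewrite expr2; lra.
have [q1|q1] := leP q b.
  by have := step 1 ler01 (lexx _); rewrite expr1n; lra.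
have qp : 0 < q by lra.
have := step (b / q); rewrite divr_ge0 // ?(ltW pos) // ler_pdivrMr // mul1r (ltW q1).
move=> /(_ isT isT); rewrite expr2.
have -> : b / q * (b / q) * q = b / q * b by rewrite -!mulrA mulVf ?mulr1 ?gt_eqF.
have -> : 2 * (b / q) * b = 2 * (b / q * b) by ring.
have : 0 < b / q * b by rewrite !mulr_gt0 ?invr_gt0.
lra.
Qed.

Lemma smooth_on_near {E F : normedModType R} (S : set E) (f : E -> F) p (e : R) :
  smooth_on S f -> S p -> 0 < e -> exists2 d : R, 0 < d &
    forall q, S q -> `|q - p| < d -> `|f q - f p| < e.
Proof.
move=> /smooth_on_continuous/subspace_continuousP/(_ p) H Sp e0.
have /cvgrPdist_lt/(_ e e0) := H Sp; rewrite near_withinE => /nbhs_ballP[d d0 Hd].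
exists d => // q Sq qp; rewrite distrC; apply: Hd => //.
by rewrite -ball_normE /= distrC.
Qed.

Lemma trmx_norm_le m k (N : 'M[R]_(m, k)) : `|N^T| <= `|N|.
Proof. by apply: mx_norm_le => // i j; rewrite mxE; exact: mx_norm_ge. Qed.

Lemma quad_form_le (N : 'M[R]_r) (y z : 'rV[R]_r) :
  `|(y *m N *m z^T) ord0 ord0| <= r%:R * r%:R * `|N| * `|y| * `|z|.
Proof.
apply: le_trans (mx_norm_ge _ _ _) _; apply: le_trans (mulmx_norm_le _ _) _.
apply: (@le_trans _ _ (r%:R * (r%:R * `|y| * `|N|) * `|z|)).
  rewrite ler_pM ?mulr_ge0 //; last exact: trmx_norm_le.
  by rewrite ler_wpM2l // mulmx_norm_le.
by rewrite le_eqVlt; apply/orP; left; apply/eqP; ring.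
Qed.

Lemma fip_norm a p y : fip V a p y y = `|triv_inv V a (chart_point a p) y| ^+ 2.
Proof. exact: ip_norm. Qed.

(** The added 1 avoids a square root: the squared norm is at most B |y|^2, and B <= B^2 because B >=
    1. *)
Lemma triv_inv_norm_le a p (H : R) y : chart_img a p -> `|gram V a p| <= H ->
  `|triv_inv V a (chart_point a p) y| <= (r%:R * r%:R * H + 1) * `|y|.
Proof.
move=> ap pH; have H0 : 0 <= H by apply: le_trans pH.
set B := _ + 1; have B1 : 1 <= B by rewrite lerDr !mulr_ge0.
rewrite -(@ler_pXn2r _ 2) ?nnegrE ?mulr_ge0 //; last lra.
rewrite -fip_norm fipE // exprMn.
apply: le_trans (ler_norm _) _; apply: le_trans (quad_form_le _ _ _) _.
rewrite -mulrA -expr2; apply: ler_wpM2r; first exact: sqr_ge0.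
apply: (@le_trans _ _ B); last by rewrite expr2 ler_peMl //; lra.
by rewrite /B (le_trans (ler_wpM2l _ pH)) ?mulr_ge0 // lerDl.
Qed.

Lemma triv_inv_continuous a x : chart_dom a x -> continuous (triv_inv V a x).
Proof.
move=> ax y; apply/(@cvgrPdist_lt _ _ _ (nbhs y) (nbhs_filter (y : 'rV[R]_r))) => e e0.
have ap : chart_img a (chart_coord a x) by exists x.
have H z := triv_inv_norm_le z ap (lexx _).
rewrite coordK // in H; set B := _ + 1 in H.
have B0 : 0 < B by rewrite ltr_wpDl ?mulr_ge0.
apply/nbhs_ballP; exists (e / B) => [|z]; first by rewrite /= divr_gt0.
rewrite -ball_normE /= => yz.
rewrite -triv_invB //; apply: le_lt_trans (H _) _.
by rewrite mulrC -ltr_pdivlMr.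
Qed.

(** At p1 the lower bound is a minimum over the unit sphere of the coordinate space; continuity of
    the Gram matrix propagates it to nearby points at the cost of a factor 1/2. *)
Lemma norm_equiv a p1 : chart_img a p1 -> exists d c B : R,
  [/\ 0 < d, 0 < c, 0 < B & forall q, chart_img a q -> `|q - p1| < d -> forall y,
    c * `|y| <= `|triv_inv V a (chart_point a q) y| <= B * `|y| ].
Proof.
move=> ap; have ax := chart_point_dom ap; set x := chart_point a p1 in ax.
have [c0 c0_gt0 Hc0] : exists2 c0, 0 < c0 & forall y, c0 * `|y| <= `|triv_inv V a x y|.
  pose S := [set y : 'rV[R]_r | `|y| = 1].
  have scale y : y != 0 -> S (`|y|^-1 *: y).
    move=> y0; rewrite /S /= normrZ ger0_norm ?invr_ge0 // mulVf //.
    by rewrite normr_eq0.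
  (* The sphere is empty when the rank is 0. *)
  have [S0|/set0P S0] := eqVneq S set0.
    exists 1 => // y; have [->|y0] := eqVneq y 0; first by rewrite normr0 mulr0.
    by have := scale y y0; rewrite S0.
  have cS : compact S.
    apply: bounded_closed_compact.
      by exists 1; split => // M' M1 y /= ->; exact: ltW.
    apply: (@closed_comp _ _ (fun y : 'rV[R]_r => `|y|) [set 1]) => [y _|].
      exact: norm_continuous.
    exact: closed_eq.
  have cf : {within S, continuous (fun y => `|triv_inv V a x y|)}.
    apply: continuous_subspaceT => y; apply: (@continuous_comp _ _ _ (triv_inv V a x)).
      exact: triv_inv_continuous.
    exact: norm_continuous.
  have [y0 + ymin] := EVT_min_rV S0 cS cf; rewrite inE => Sy0.
  exists `|triv_inv V a x y0|.
    rewrite normr_gt0; apply/eqP => e; move: Sy0; rewrite /S /=.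
    rewrite -(@frameK _ _ _ _ _ V _ _ ax y0) e (linear_fun0 (@triv_linear _ _ _ _ _ V _ _ ax)).
    by rewrite normr0 => /eqP; rewrite eq_sym oner_eq0.
  move=> y; have [->|yn0] := eqVneq y 0; first by rewrite normr0 mulr0.
  have := ymin _ (mem_set (scale y yn0)); rewrite triv_invZ // normrZ.
  have yp : 0 < `|y| by rewrite normr_gt0.
  rewrite ger0_norm ?invr_ge0 // => h; rewrite -[leRHS]mul1r.
  by rewrite -(mulfV (lt0r_neq0 yp)) -mulrA mulrC ler_wpM2l.
(* With this e the Gram matrix perturbs the squared norm by at most c0^2 |y|^2 / 2, and the
   remaining half exceeds (c0/2)^2 |y|^2. *)
pose e := c0 ^+ 2 / (2 * (r%:R * r%:R + 1)).
have rr0 : 0 <= r%:R * r%:R :> R by rewrite mulr_ge0.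
have e0 : 0 < e by rewrite divr_gt0 ?exprn_gt0 // mulr_gt0 //; lra.
have [d d0 Hd] := smooth_on_near (@gram_smooth _ _ _ _ _ V a) ap e0.
exists d, (c0 / 2), (r%:R * r%:R * (`|gram V a p1| + e) + 1); split => //.
- by rewrite divr_gt0.
- by rewrite ltr_wpDl // !mulr_ge0 // addr_ge0 // ltW.
move=> q aq qd y; have gq := Hd q aq qd; apply/andP; split; last first.
  apply: triv_inv_norm_le => //; rewrite -(subrK (gram V a p1) (gram V a q)).
  by apply: le_trans (ler_normD _ _) _; rewrite addrC lerD2l ltW.
rewrite -(@ler_pXn2r _ 2) ?nnegrE ?mulr_ge0 ?divr_ge0 ?(ltW c0_gt0) //.
rewrite -fip_norm.
have h1 : c0 ^+ 2 * `|y| ^+ 2 <= fip V a p1 y y.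
  rewrite fip_norm -exprMn (@ler_pXn2r _ 2) ?nnegrE ?mulr_ge0 ?(ltW c0_gt0) //.
have h2 : fip V a p1 y y - fip V a q y y <= r%:R * r%:R * e * `|y| ^+ 2.
  rewrite !fipE //.
  have -> : (y *m gram V a p1 *m y^T) ord0 ord0 - (y *m gram V a q *m y^T) ord0 ord0 =
      - (y *m (gram V a q - gram V a p1) *m y^T) ord0 ord0.
    by rewrite mulmxBr mulmxBl !mxE opprB.
  apply: le_trans (ler_norm _) _; rewrite normrN.
  apply: le_trans (quad_form_le _ _ _) _; rewrite -mulrA -expr2.
  apply: ler_wpM2r; first exact: sqr_ge0.
  by apply: ler_wpM2l => //; exact: ltW.
have h3 : r%:R * r%:R * e <= c0 ^+ 2 / 2.
  have he : e * (2 * (r%:R * r%:R + 1)) = c0 ^+ 2.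
    by rewrite /e divfK // gt_eqF // mulr_gt0 //; lra.
  move: (r%:R * r%:R) he => u he; lra.
have y2 : 0 <= `|y| ^+ 2 by exact: sqr_ge0.
have h4 := ler_wpM2r y2 h3.
have h5 : 0 <= c0 ^+ 2 * `|y| ^+ 2 by rewrite mulr_ge0 ?sqr_ge0.
have -> : (c0 / 2 * `|y|) ^+ 2 = c0 ^+ 2 * `|y| ^+ 2 / 4 by field.
lra.
Qed.

Lemma triv_triv_inv_continuous a b x : chart_dom a x -> chart_dom b x ->
  continuous (fun y => triv b (triv_inv V a x y)).
Proof.
move=> ax bx y; have e z : triv b (triv_inv V a x z) =
    \sum_j z ord0 j *: triv b (triv_inv V a x (delta_mx ord0 j)).
  rewrite {1}(row_sum_delta z) triv_inv_sum // triv_sum //; apply: eq_bigr => j _.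
  by rewrite triv_invZ // trivZ.
rewrite /continuous_at e; under eq_fun do rewrite e.
apply: (@cvg_sum_seq _ _ _ _ (nbhs y) (nbhs_filter (y : 'rV[R]_r))) => j.
by apply: cvgZr_tmp; exact: coord_continuous.
Qed.

Lemma total_closed_fiber a p (C : set (total_space V)) : chart_img a p ->
  total_closed C -> closed [set y | C (total_pt V a p y)].
Proof.
move=> ap cC; have ax := chart_point_dom ap.
rewrite -[X in closed X]setCK; apply: open_closedC; rewrite openE => y /= nCy.
have [b [bx [P nP HP]]] := cC _ nCy.
move: nP => [[P1 P2] [nP1 nP2] sP].
have nP : nbhs (y : 'rV[R]_r) [set z | P2 (triv b (triv_inv V a (chart_point a p) z))].
  exact: (triv_triv_inv_continuous ax bx nP2).
apply: filterS nP => z P2z.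
by apply: HP => //; apply: sP; split => //; exact: nbhs_singleton.
Qed.

(** Compactness is taken from the coordinate space: the distance is minimised there over the points
    of C no farther from f than c1, a closed set that is bounded by [norm_equiv]. *)
Lemma nearest_exists x (C : set (total_space V)) (f : fiber V x) :
  total_closed C -> fib C x !=set0 -> exists v, nearest f (fib C x) v.
Proof.
move=> cC [c1 Cc1]; have [a ax] := dom_cover A x.
have ap : chart_img a (chart_coord a x) by exists x.
have [d [c [B [d0 c0 B0 H]]]] := norm_equiv ap.
have {}H y : c * `|y| <= `|triv_inv V a x y|.
  have := H _ ap; rewrite subrr normr0 coordK // => /(_ d0 y).
  by move=> /andP[].
have Cy y : C (total_pt V a (chart_coord a x) y) <-> fib C x (triv_inv V a x y).
  by rewrite /fib /= /total_pt coordK.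
pose K := [set y | C (total_pt V a (chart_coord a x) y)] `&`
  [set y | `|f - triv_inv V a x y| <= `|f - c1| ].
have cont : continuous (fun y : 'rV[R]_r => `|f - triv_inv V a x y|).
  move=> y; have FF := nbhs_filter (y : 'rV[R]_r).
  apply: (@continuous_comp _ _ _ (fun y => f - triv_inv V a x y)).
    by apply: cvgB; [exact: cvg_cst|exact: triv_inv_continuous].
  exact: norm_continuous.
have K0 : K !=set0.
  by exists (triv a c1); split; rewrite /= ?Cy trivK.
have cK : compact K.
  apply: bounded_closed_compact.
    exists ((`|f| + `|f - c1|) / c); split; first exact: num_real.
    move=> m mgt y [_ /= yle]; apply: le_trans (ltW mgt).
    rewrite ler_pdivlMr // mulrC; apply: le_trans (H y) _.
    rewrite -(subKr f (triv_inv V a x y)); apply: le_trans (ler_normB _ _) _.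
    by rewrite lerD2l.
  apply: closedI; first exact: total_closed_fiber.
  apply: (@closed_comp _ _ (fun y => `|f - triv_inv V a x y|) [set s | s <= `|f - c1| ]) => [y _|].
    exact: cont.
  exact: closed_le.
have [y0 + ymin] := EVT_min_rV K0 cK (continuous_subspaceT cont).
rewrite inE => -[Cy0 y0le]; exists (triv_inv V a x y0); split; first exact/Cy.
apply/eqP; rewrite eq_le dist_set_le ?andbT; last exact/Cy.
apply: dist_set_ge => [|z Cz]; first by exists c1.
have [zle|/ltW zge] := leP `|f - z| `|f - c1|; last exact: le_trans zge.
have := ymin (triv a z); rewrite trivK //; apply.
by rewrite inE; split; rewrite /= ?Cy trivK.
Qed.

End FiberGeometry.

(** * Space derivatives at a maximum of the distance *)

Section SpatialMaximum.
Context {R : realType}.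

Lemma small_scale (X Y : R) : 0 <= X -> 0 < Y ->
  exists2 k0 : R, 0 < k0 & forall k, 0 < k -> k <= k0 -> k * X < Y.
Proof.
move=> X0 Y0; exists (Y / (X + 1)) => [|k k0 kY]; first by rewrite divr_gt0 //; lra.
have X1 : 0 < X + 1 by lra.
move: kY; rewrite ler_pdivlMr // mulrDr; lra.
Qed.

(** The intermediate point must be interior because [dramp] vanishes at 0. *)
Lemma MVT_derive_lt (f df : R -> R) (a b : R) : a < b ->
  (forall x, a <= x <= b -> is_derive x (1 : R) f (df x)) ->
  exists2 c, a < c < b & f b - f a = df c * (b - a).
Proof.
move=> ab H.
have H1 x : x \in `]a, b[ -> is_derive x (1 : R) f (df x).
  by rewrite in_itv /= => /andP[ax xb]; apply: H; rewrite !ltW.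
have cf : {within `[a, b], continuous f}.
  apply: derivable_within_continuous => x; rewrite in_itv /= => xab.
  exact: (@ex_derive _ _ _ _ _ _ _ (H x xab)).
have [c + e] := MVT ab H1 cf.
by rewrite in_itv /= => cab; exists c.
Qed.

(** As [dramp] vanishes at 0, so does the derivative of F, and the usual test says nothing. But
    [dramp] is positive on ]0, 1[, so a positive E, or a zero E with positive E2 at 0, would make F
    increase just after 0. *)
Lemma ramp_derivative_test (F E E2 : R -> R) :
  (forall s : R, 0 <= s <= 1 -> is_derive s (1 : R) F (dramp s * E s)) ->
  (forall s : R, 0 <= s <= 1 -> is_derive s (1 : R) E (dramp s * E2 s)) ->
  {for 0, continuous E2} -> (forall s : R, 0 <= s <= 1 -> F s <= F 0) ->
  E 0 <= 0 /\ (E 0 = 0 -> E2 0 <= 0).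
Proof.
move=> dF dE cE2 Fmax.
have cE : {for 0, continuous E}.
  apply: differentiable_continuous; apply/derivable1_diffP.
  by have [] := dE 0 (ltac:(lra)).
have pos (g : R -> R) : {for 0, continuous g} -> 0 < g 0 ->
    exists e, [/\ 0 < e, e < 1 & forall s, 0 <= s <= e -> 0 < g s].
  move=> cg g0; have /cvgrPdist_lt/(_ _ g0) := cg => /nbhs_ballP[d d0 Hd].
  exists (Num.min (d / 2) (1 / 2)); have m1 : Num.min (d / 2) (1 / 2) <= d / 2.
    by rewrite ge_min lexx.
  have m2 : Num.min (d / 2) (1 / 2) <= 1 / 2 by rewrite ge_min lexx orbT.
  have d0' : 0 < d by [].
  split; [by rewrite lt_min !divr_gt0|lra|move=> s hs].
  have : ball (0 : R) d s by rewrite -ball_normE /= sub0r normrN ger0_norm; lra.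
  by move/Hd => /=; rewrite ltr_distlC; lra.
have incr (g h : R -> R) e : 0 < e -> e < 1 ->
    (forall s : R, 0 <= s <= 1 -> is_derive s (1 : R) g (dramp s * h s)) ->
    (forall s, 0 < s < e -> 0 < h s) -> forall s, 0 < s <= e -> g 0 < g s.
  move=> e0 e1 dg hpos s hs.
  have s0 : 0 < s by lra.
  have [c cs ec] := MVT_derive_lt s0 (fun x (hx : 0 <= x <= s) => dg x (ltac:(lra))).
  rewrite -subr_gt0 ec !mulr_gt0 ?dramp_gt0 ?hpos //; lra.
split=> [|E0].
  rewrite leNgt; apply/negP => E0; have [e [e0 e1 He]] := pos E cE E0.
  have := incr F E e e0 e1 dF (fun s hs => He s (ltac:(lra))) e (ltac:(lra)).
  by have := Fmax e (ltac:(lra)); lra.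
rewrite leNgt; apply/negP => E20; have [e [e0 e1 He]] := pos E2 cE2 E20.
have Epos s : 0 < s <= e -> 0 < E s.
  move=> hs; have := incr E E2 e e0 e1 dE (fun s hs => He s (ltac:(lra))) s hs.
  by rewrite E0.
have := incr F E e e0 e1 dF (fun s hs => Epos s (ltac:(lra))) e (ltac:(lra)).
by have := Fmax e (ltac:(lra)); lra.
Qed.

Context {n r : nat} {M : topologicalType} {A : bd_atlas R n M}.
Variables (V : metric_bundle A r) (T : R).
Variable D : chart A -> R -> 'rV[R]_n -> 'I_n -> 'M[R]_r.
Hypothesis D_metric : is_metric_connection V T D.

Let D_conn : is_connection (transition_mx V) T D := proj1 D_metric.

Lemma connection_bound a p t : chart_img a p -> 0 <= t <= T ->
  exists d B : R, [/\ 0 < d, 0 <= B & forall q s i, chart_img a q -> 0 <= s <= T ->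
    `|q - p| < d -> `|s - t| < d -> `|D a s q i| <= B].
Proof.
move=> ap tT; have [sD _] := D_conn.
have H (i : 'I_n) : exists d : R, 0 < d /\
    forall q s, chart_img a q -> 0 <= s <= T ->
    `|q - p| < d -> `|s - t| < d -> `|D a s q i| <= `|D a t p i| + 1.
  have [d d0 Hd] := smooth_on_near (sD a i) (conj ap tT : cylinder a T (p, t)) ltr01.
  exists d; split => // q s aq sT qp st.
  have /= h : `|D a s q i - D a t p i| < 1.
    apply: (Hd (q, s)); first by split.
    by rewrite prod_normE /= gt_max qp st.
  rewrite -(subrK (D a t p i) (D a s q i)); apply: le_trans (ler_normD _ _) _; lra.
have [d Hd] := choice H.
exists (\big[Num.min/1]_i d i), (\sum_i (`|D a t p i| + 1)); split.
- by apply: lt_bigmin => // i _; exact: (Hd i).1.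
- by apply: sumr_ge0 => i _; rewrite addr_ge0.
move=> q s i aq sT qp st.
have le_d : \big[Num.min/1]_j d j <= d i by exact: bigmin_le_cond.
apply: le_trans ((Hd i).2 q s aq sT (lt_le_trans qp le_d) (lt_le_trans st le_d)) _.
rewrite (bigD1 i) //= lerDl; apply: sumr_ge0 => j _; exact: addr_ge0.
Qed.

Lemma fipZl a p c w z : chart_img a p -> fip V a p (c *: w) z = c * fip V a p w z.
Proof. by move=> /chart_point_dom ap; rewrite /fip triv_invZ // ipZl. Qed.

Variables (a : chart A) (t : R).
Hypothesis tT : 0 <= t <= T.
Let G := D a t.
Let G_metric : metric_compatible a
  (fun p w z => ip (triv_inv V a (chart_point a p) w) (triv_inv V a (chart_point a p) z)) G.
Proof. by have [_ /(_ a t tT)] := D_metric. Qed.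

Lemma is_derive_fip_section p w y (s : 'rV[R]_n -> 'rV[R]_r) (x : R) :
  (forall c : R, 0 <= c <= 1 -> chart_img a (p + c *: w)) ->
  smooth_on (chart_img a) s -> transport G p w y -> - (1 / 4) < x < 5 / 4 ->
  is_derive x (1 : R) (fun x => fip V a (p + ramp x *: w) (s (p + ramp x *: w)) (y x))
    (dramp x * fip V a (p + ramp x *: w) (cov_vec a G w s (p + ramp x *: w)) (y x)).
Proof.
move=> line ss ytr hx; have ax := chart_img_ramp line hx.
have Ds : is_derive x (1 : R) (fun x => s (p + ramp x *: w))
    (dramp x *: \sum_i w ord0 i *: deriv_in (chart_img a) s (e_ i) (p + ramp x *: w)).
  have ss' : smooth_on (setT `&` chart_img a) s by rewrite setTI.
  apply: (derive_chart_line openT I ss' _ (is_derive_ramp x)).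
  by apply: filterS (near_ramp hx) => z; exact: chart_img_ramp.
have := is_derive_fip_transport G_metric line Ds ytr hx.
rewrite -fipZl //; congr (is_derive _ _ _ (fip _ _ _ _ _)).
rewrite -scalerDr /cov_vec /along mulmx_sumr -big_split /=; congr (_ *: _).
by apply: eq_bigr => i _; rewrite scalerDr scalemxAr.
Qed.

Variables (C : set (total_space V)) (ff : forall x, fiber V x).
Variables (x0 : M) (v : fiber V x0).
Hypothesis C_par : parallel_invariant (fun b => D b t) C.
Hypothesis C_convex : convex_set (fib C x0).
Hypothesis C_ne : forall x, fib C x !=set0.
Hypothesis ff_smooth : smooth_on (chart_img a) (local_section a ff).
Hypothesis ax0 : chart_dom a x0.
Hypothesis v_nearest : nearest (ff x0) (fib C x0) v.
Hypothesis ff_max : forall x, dist_set (ff x) (fib C x) <= dist_set (ff x0) (fib C x0).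
Hypothesis ff_pos : 0 < dist_set (ff x0) (fib C x0).

Let p0 := chart_coord a x0.
Let nv := ff x0 - v.
Let nu := triv a nv.
Let s := local_section a ff.

Lemma fip_center w z : fip V a p0 w z = ip (triv_inv V a x0 w) (triv_inv V a x0 z).
Proof. by rewrite /fip coordK. Qed.

Let ap0 : chart_img a p0. Proof. by exists x0. Qed.

Let sp0 : s p0 = triv a (ff x0).
Proof.
rewrite /s /local_section /p0.
by rewrite coordK.
Qed.

Let G_cont i : {within chart_img a, continuous (fun q => G q i)}.
Proof. by apply: smooth_on_continuous; exact: (connection_smooth D_conn tT). Qed.

Section Direction.
Variables (w : 'rV[R]_n) (B : R).
Hypothesis line : forall c : R, 0 <= c <= 1 -> chart_img a (p0 + c *: w).
Hypothesis B0 : 0 <= B.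
Hypothesis GB : forall (c : R) i, 0 <= c <= 1 -> `|G (p0 + c *: w) i| <= B.
Hypothesis small : 2 * r%:R * n%:R * B * `|w| <= 1 / 3.

Let trans u0 (c : R) : - (1 / 4) < c < 5 / 4 -> exists y, y c = u0 /\ transport G p0 w y.
Proof.
move=> hc; have [y [y0 yt _]] := transport_exists u0 line G_cont B0 GB small hc.
by exists y.
Qed.

Let th0 : p0 + ramp 0 *: w = p0. Proof. by rewrite ramp0 scale0r addr0. Qed.

Let fip_const y z (c : R) : transport G p0 w y -> transport G p0 w z -> 0 <= c <= 1 ->
  fip V a (p0 + ramp c *: w) (z c) (y c) = fip V a p0 (z 0) (y 0).
Proof.
move=> yt zt /andP[c0 c1].
have D0 x : 0 <= x <= c ->
    is_derive x (1 : R) (fun x => fip V a (p0 + ramp x *: w) (z x) (y x)) 0.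
  move=> hx; have hx' : - (1 / 4) < x < 5 / 4 by lra.
  have := is_derive_fip_transport G_metric line (zt x hx') yt hx'.
  by rewrite addNr -[X in fip _ _ _ X _](scale0r (z x)) fipZl ?mul0r //; exact: chart_img_ramp.
have [d _] := MVT_derive c0 D0.
by rewrite mul0r th0 => /eqP; rewrite subr_eq0 => /eqP.
Qed.

(** Let y be the parallel extension of n and F = <f, y> along the line. Then (F - <v, n>) / |n| is
    at most the distance of f from C, with equality at 0. Hence F is maximal at 0, and up to factors
    [dramp] its derivatives are the pairings of y with D_w f and D_w D_w f. *)
Lemma spatial_first_second :
  fip V a p0 (cov_vec a G w s p0) nu <= 0 /\
  (fip V a p0 (cov_vec a G w s p0) nu = 0 ->
   fip V a p0 (cov_vec a G w (cov_vec a G w s) p0) nu <= 0).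
Proof.
have [y [y0 yt]] := trans nu (c := 0) (ltac:(lra)).
have ss := ff_smooth.
have G_smooth i : smooth_on (chart_img a) (fun q => G q i) by exact: (connection_smooth D_conn tT).
have ss1 := smooth_on_cov_vec G_smooth w ss.
have ss2 := smooth_on_cov_vec G_smooth w ss1.
pose Fs (s' : 'rV[R]_n -> 'rV[R]_r) (x : R) :=
  fip V a (p0 + ramp x *: w) (s' (p0 + ramp x *: w)) (y x).
have dFs s' (x : R) : smooth_on (chart_img a) s' -> 0 <= x <= 1 ->
    is_derive x (1 : R) (Fs s') (dramp x * Fs (cov_vec a G w s') x).
  by move=> ss' hx; apply: is_derive_fip_section => //; lra.
have Fs0 s' : Fs s' 0 = fip V a p0 (s' p0) nu by rewrite /Fs th0 y0.
rewrite -(Fs0 (cov_vec a G w s)) -(Fs0 (cov_vec a G w (cov_vec a G w s))).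
apply: ramp_derivative_test.
- by move=> x; exact: dFs.
- by move=> x; exact: dFs.
- apply: differentiable_continuous; apply/derivable1_diffP.
  by have [] := dFs _ 0 ss2 (ltac:(lra)).
move=> x hx; have hx' : - (1 / 4) < x < 5 / 4 by lra.
have ax := chart_img_ramp line hx'; have dx := chart_point_dom ax.
have d0 : 0 < `|nv| by rewrite /nv; have [_ ->] := v_nearest.
have nv2 : fip V a p0 nu nu = `|nv| ^+ 2 by rewrite fip_center /nu trivK // ip_norm.
have ny : `|triv_inv V a (chart_point a (p0 + ramp x *: w)) (y x)| = `|nv|.
  apply/eqP; rewrite -(eqrXn2 (n := 2)) //.
  by rewrite -fip_norm (fip_const yt yt hx) y0 nv2.
have Fv : Fs s 0 = fip V a p0 (triv a v) nu + `|nv| ^+ 2.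
  rewrite /Fs th0 y0 -nv2 !fip_center sp0 !trivK // -ipDl.
  by rewrite /nv subrKC.
(* A point c of C over the line is transported back to x0, where the hyperplane supporting C at v
   bounds its component along n; Cauchy-Schwarz then bounds |f - c| from below. *)
have key : (Fs s x - fip V a p0 (triv a v) nu) / `|nv| <=
    dist_set (ff (chart_point a (p0 + ramp x *: w))) (fib C (chart_point a (p0 + ramp x *: w))).
  apply: dist_set_ge => // c Cc; rewrite ler_pdivrMr //.
  have [z [zx zt]] := trans (triv a c) hx'.
  have Cz : fib C x0 (triv_inv V a x0 (z 0)).
    have h0 : 0 <= (0 : R) <= 1 by rewrite lexx ler01.
    have := transport_invariant D_conn tT C_par line zt hx h0.
    rewrite th0 zx {1}/total_pt trivK // /total_pt /p0 coordK //.
    by apply.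
  have := nearest_support C_convex v_nearest Cz.
  rewrite -/nv -[X in ip _ X](@trivK _ _ _ _ _ V _ _ ax0) -/nu ipBl -fip_center.
  rewrite -[X in ip X _](@trivK _ _ _ _ _ V _ _ ax0 v) -fip_center.
  have := ip_le_norm (ff (chart_point a (p0 + ramp x *: w)) - c)
    (triv_inv V a (chart_point a (p0 + ramp x *: w)) (y x)).
  rewrite ny ipBl.
  have -> : ip (ff (chart_point a (p0 + ramp x *: w)))
    (triv_inv V a (chart_point a (p0 + ramp x *: w)) (y x)) = Fs s x.
    by rewrite /Fs /fip /s /local_section trivK.
  have -> : ip c (triv_inv V a (chart_point a (p0 + ramp x *: w)) (y x)) =
    fip V a (p0 + ramp x *: w) (z x) (y x) by rewrite /fip zx trivK.
  rewrite (fip_const yt zt hx) y0. lra.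
have := le_trans key (ff_max _); have [_ <-] := v_nearest.
rewrite -/nv ler_pdivrMr // -expr2 Fv; lra.
Qed.

End Direction.

(** First and second covariant derivative in a frozen direction u, paired with n. Linearity of L and
    the homogeneity of H under scaling are the only algebraic properties used. *)
Let L (u : 'rV[R]_n) : R := fip V a p0 (cov_vec a G u s p0) nu.
Let H (u : 'rV[R]_n) : R := fip V a p0 (cov_vec a G u (cov_vec a G u s) p0) nu.

Let G_smooth i : smooth_on (chart_img a) (fun q => G q i).
Proof. exact: (connection_smooth D_conn tT). Qed.

Let cov_vecZl c u g q : cov_vec a G (c *: u) g q = c *: cov_vec a G u g q.
Proof. by rewrite !cov_vecE scalemxAl. Qed.

Let cov_vecZr c u g : smooth_on (chart_img a) g ->
  cov_vec a G u (fun q => c *: g q) p0 = c *: cov_vec a G u g p0.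
Proof.
move=> sg; rewrite /cov_vec scaler_sumr; apply: eq_bigr => i _.
have PF := chart_steps i ap0.
rewrite (@deriv_in_ext _ _ _ _ _ (fun q => c%:M *m g q)) //; last first.
  by move=> q _; rewrite mul_scalar_mx.
rewrite deriv_in_mulmx //; last exact: smooth_on_cst.
rewrite deriv_in_cst // mul0mx add0r mul_scalar_mx -scalemxAl -scalerDr.
by rewrite !scalerA mulrC.
Qed.

Let LZ c u : L (c *: u) = c * L u.
Proof. by rewrite /L cov_vecZl fipZl. Qed.

Let LD u u' : L (u + u') = L u + L u'.
Proof.
rewrite /L !cov_vecE mulmxDl /fip triv_invD ?ipDl //; exact: chart_point_dom.
Qed.

Let HZ c u : H (c *: u) = c ^+ 2 * H u.
Proof.
rewrite /H cov_vecZl fipZl //.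
have -> : cov_vec a G (c *: u) s = (fun q => c *: cov_vec a G u s q).
  by apply/funext => q; rewrite cov_vecZl.
rewrite cov_vecZr; last exact: smooth_on_cov_vec.
by rewrite fipZl // mulrA expr2.
Qed.

(** The signs of L u and H u do not change when u is scaled by k > 0, so u may be taken short enough
    for the segment to lie in the chart and for transport along it to exist. *)
Lemma spatial_direction (u : 'rV[R]_n) :
  (forall i : 'I_n, i = 0%N :> nat -> 0 < p0 ord0 i \/ 0 <= u ord0 i) ->
  L u <= 0 /\ (L u = 0 -> H u <= 0).
Proof.
move=> adm; have [e e0 He] := chart_img_nbhs ap0.
have [d [B [d0 B0 HB]]] := connection_bound ap0 tT.
(* At most one index has value 0. If u points outward there, then p0 lies in the interior and its
   coordinate is the room available before the boundary. *)
have [m m0 Hm] : exists2 m, 0 < m & forall i : 'I_n, i = 0%N :> nat ->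
    m <= p0 ord0 i \/ 0 <= u ord0 i.
  have [[i0 [i00 ui0]]|H0] := pselect (exists i0 : 'I_n, i0 = 0%N :> nat /\ u ord0 i0 < 0).
    exists (p0 ord0 i0); first by case: (adm i0 i00) => //; rewrite leNgt ui0.
    move=> i i0'; left; suff -> : i = i0 by [].
    by apply: val_inj; rewrite /= i0' i00.
  exists 1 => // i i0; right; rewrite leNgt; apply/negP => ui; apply: H0.
  by exists i.
have u0 := normr_ge0 u.
have [k1 k10 K1] := small_scale u0 e0.
have [k2 k20 K2] := small_scale u0 d0.
have [k3 k30 K3] := small_scale u0 m0.
have c0 : 0 <= 2 * r%:R * n%:R * B * `|u| by rewrite !mulr_ge0.
have c3 : 0 < 1 / 3 :> R by rewrite divr_gt0.
have [k4 k40 K4] := small_scale c0 c3.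
(* In this order: stay within the chart radius, within the region where the connection is bounded by
   B, inside the half-space, and below the Picard threshold 1/3. *)
pose k := Num.min (Num.min k1 k2) (Num.min k3 k4).
have k0 : 0 < k by rewrite !lt_min k10 k20 k30 k40.
have kk1 : k <= k1 by rewrite !ge_min lexx.
have kk2 : k <= k2 by rewrite !ge_min lexx orbT.
have kk3 : k <= k3 by rewrite !ge_min lexx !orbT.
have kk4 : k <= k4 by rewrite !ge_min lexx !orbT.
have nle (c : R) : 0 <= c <= 1 -> `|c *: (k *: u)| <= k * `|u|.
  move=> /andP[c0' c1]; rewrite !normrZ ger0_norm // (gtr0_norm k0).
  by rewrite ler_piMl // mulr_ge0 // ltW.
have line (c : R) : 0 <= c <= 1 -> chart_img a (p0 + c *: (k *: u)).
  move=> hc; apply: He.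
    by rewrite addrAC subrr add0r; apply: le_lt_trans (nle c hc) _; exact: K1.
  move=> i i0; rewrite !mxE; have [c0' c1] := andP hc.
  case: (Hm i i0) => [mi|ui]; last first.
    by rewrite addr_ge0 ?mulr_ge0 ?(ltW k0) //; exact: (chart_img_half ap0).
  have := le_lt_trans (nle c hc) (K3 _ k0 kk3).
  have := mx_norm_ge (c *: (k *: u)) ord0 i; rewrite !mxE ler_norml.
  by move=> /andP[h1 _] h2; lra.
have GB (c : R) i : 0 <= c <= 1 -> `|G (p0 + c *: (k *: u)) i| <= B.
  move=> hc; apply: HB => //; first exact: line.
    by rewrite addrAC subrr add0r; apply: le_lt_trans (nle c hc) _; exact: K2.
  by rewrite subrr normr0.
have small : 2 * r%:R * n%:R * B * `|k *: u| <= 1 / 3.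
  by rewrite normrZ (gtr0_norm k0) mulrCA; apply: ltW; exact: K4.
have [h1 h2] := spatial_first_second line B0 GB small.
have L1 : k * L u <= 0 by rewrite -LZ.
have H1 : k * L u = 0 -> k ^+ 2 * H u <= 0 by rewrite -LZ -HZ.
split; first by rewrite -(pmulr_rle0 _ k0).
by move=> Lu0; rewrite -(pmulr_rle0 _ (exprn_gt0 2 k0)) H1 // Lu0 mulr0.
Qed.

Variable g : chart A -> R -> 'rV[R]_n -> 'M[R]_n.
Hypothesis g_riemannian : is_riemannian T g.

(** The vector z is the metric dual of the boundary-defining coordinate, so it is orthogonal to the
    boundary, and its squared length is its own component [z ord0 i0]; it remains to normalise it
    and reverse its sign. *)
Lemma outer_unit_normal_exists (i0 : 'I_n) : i0 = 0%N :> nat ->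
  exists nu, outer_unit_normal g a t p0 nu.
Proof.
move=> i00; have [_ gpos _] := g_riemannian.
have [gsym {}gpos] := gpos a t p0 tT ap0.
set m := g a t p0 in gsym gpos.
have mu : m \in unitmx.
  rewrite -row_free_unit -kermx_eq0; apply/eqP/row_matrixP => i; rewrite row0.
  apply/eqP; apply/negPn/negP => /gpos; rewrite /metric_form.
  by rewrite -row_mul mulmx_ker row0 mul0mx mxE ltxx.
pose z : 'rV[R]_n := delta_mx ord0 i0 *m invmx m.
have zm w : metric_form m z w = w ord0 i0.
  by rewrite /metric_form /z mulmxKV // -[delta_mx _ _ *m _]rowE !mxE.
have z0 : z != 0.
  apply/eqP => z0; have := zm (delta_mx ord0 i0).
  rewrite /metric_form z0 !mul0mx !mxE !eqxx => /eqP.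
  by rewrite eq_sym oner_eq0.
have zz : 0 < z ord0 i0 by rewrite -zm gpos.
have mfZ c w w' : metric_form m (c *: w) w' = c * metric_form m w w'.
  by rewrite /metric_form -!scalemxAl mxE.
have sq : 0 < Num.sqrt (z ord0 i0) by rewrite sqrtr_gt0.
pose c := - (Num.sqrt (z ord0 i0))^-1.
exists (c *: z); split.
- rewrite -/m mfZ zm mxE /c mulrA mulrNN -expr2 exprVn sqr_sqrtr ?ltW // mulVf //.
  by rewrite gt_eqF.
- by move=> u u0; rewrite -/m mfZ zm u0 // mulr0.
- move=> i i_0; have -> : i = i0 by apply: val_inj; rewrite /= i_0 i00.
  by rewrite mxE /c mulNr oppr_lt0 mulr_gt0 // invr_gt0.
Qed.

Hypothesis boundary_le : boundary A x0 -> forall u, outer_unit_normal g a t p0 u -> L u <= 0.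

(** In the interior u and -u are both admissible. At the boundary this holds for tangential vectors
    only; for the normal w, the inward -w is admissible and the boundary hypothesis provides the
    opposite inequality. Tangential vectors and w span. *)
Lemma spatial_critical (u : 'rV[R]_n) : L u = 0 /\ H u <= 0.
Proof.
have LN w : L (- w) = - L w by rewrite -scaleN1r LZ mulN1r.
have HN w : H (- w) = H w by rewrite -scaleN1r HZ sqrrN expr1n mul1r.
have [int|nint] := pselect (forall i : 'I_n, i = 0%N :> nat -> 0 < p0 ord0 i).
  have adm (w : 'rV[R]_n) : forall i : 'I_n, i = 0%N :> nat -> 0 < p0 ord0 i \/ 0 <= w ord0 i.
    by move=> i i0; left; exact: int.
  have [h1 h2] := spatial_direction (adm u); have [h3 _] := spatial_direction (adm (- u)).
  rewrite LN in h3; have Lu : L u = 0 by lra.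
  by split => //; exact: h2.
have [i0 [i00 pi0]] : exists i0 : 'I_n, i0 = 0%N :> nat /\ p0 ord0 i0 = 0.
  apply: contrapT => H0; apply: nint => i i0.
  rewrite lt_neqAle (chart_img_half ap0 i0) andbT eq_sym; apply/eqP => pi0.
  by apply: H0; exists i.
have bd : boundary A x0 by exists a, i0.
have [w wn] := outer_unit_normal_exists i00.
have [_ _ /(_ i0 i00) w0] := wn.
have uniq (i : 'I_n) : i = 0%N :> nat -> i = i0.
  by move=> i_0; apply: val_inj; rewrite /= i_0 i00.
have adm (z : 'rV[R]_n) : 0 <= z ord0 i0 ->
    forall i : 'I_n, i = 0%N :> nat -> 0 < p0 ord0 i \/ 0 <= z ord0 i.
  by move=> z0 i /uniq ->; right.
have Lw : L w = 0.
  have h1 := boundary_le bd wn.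
  have Nw0 : 0 <= (- w) ord0 i0 by rewrite mxE; lra.
  have [h2 _] := spatial_direction (adm _ Nw0).
  by rewrite LN in h2; lra.
have Lt (z : 'rV[R]_n) : z ord0 i0 = 0 -> L z = 0.
  move=> z0; have z0' : 0 <= z ord0 i0 by rewrite z0.
  have Nz0 : 0 <= (- z) ord0 i0 by rewrite mxE z0 oppr0.
  have [h1 _] := spatial_direction (adm _ z0').
  have [h2 _] := spatial_direction (adm _ Nz0).
  by rewrite LN in h2; lra.
have Lz (z : 'rV[R]_n) : L z = 0.
  rewrite -(subrK ((z ord0 i0 / w ord0 i0) *: w) z) LD LZ Lw mulr0 addr0.
  by apply: Lt; rewrite !mxE divfK ?subrr // lt_eqF.
split; first exact: Lz.
(* One of u and -u is admissible, and H is even. *)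
have [u0|/ltW u0] := leP 0 (u ord0 i0).
  by have [_ h] := spatial_direction (adm _ u0); exact/h/Lz.
have Nu0 : 0 <= (- u) ord0 i0 by rewrite mxE; lra.
by have [_ h] := spatial_direction (adm _ Nu0); rewrite -HN; exact/h/Lz.
Qed.

(** All first-order terms vanish against n: the D_Y f, the correction by the derivative of X along
    itself in D^2, and the term produced by freezing X at x0. What is left is a sum of values of
    H. *)
Lemma spatial_elliptic (Nb : 'rV[R]_n -> 'I_n -> 'M[R]_n) k l
    (X : 'I_k -> 'rV[R]_n -> 'rV[R]_n) (Y : 'I_l -> 'rV[R]_n -> 'rV[R]_n) :
  (forall i, local_field a x0 (X i)) ->
  ip (triv_inv V a x0 (\sum_(i < k) cov2 a Nb G (X i) (X i) s p0)) nv
  + ip (triv_inv V a x0 (\sum_(j < l) cov a G (Y j) s p0)) nv <= 0.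
Proof.
move=> lX; have e y : ip (triv_inv V a x0 y) nv = fip V a p0 y nu.
  by rewrite fip_center trivK.
have second i : ip (triv_inv V a x0 (cov2 a Nb G (X i) (X i) s p0)) nv <= 0.
  rewrite /cov2; have [z ->] := cov_covE G_smooth ax0 (lX i) ff_smooth.
  rewrite triv_invB // triv_invD // ipBl ipDl !e.
  have [Lz _] := spatial_critical z.
  have [Lc _] := spatial_critical (cov a Nb (X i) (X i) p0).
  have [_ Hx] := spatial_critical (X i p0).
  rewrite -/(L z) -/(L (cov a Nb (X i) (X i) p0)) -/(H (X i p0)) Lz Lc.
  by rewrite addr0 subr0.
have first j : ip (triv_inv V a x0 (cov a G (Y j) s p0)) nv = 0.
  by rewrite e; have [] := spatial_critical (Y j p0).
rewrite !triv_inv_sum // !ip_suml (eq_bigr (fun=> 0) (fun j _ => first j)).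
rewrite big1_eq addr0; apply: sumr_le0 => i _; exact: second.
Qed.

End SpatialMaximum.

(** * Upper semicontinuity of the distance *)

Section UpperSemicontinuous.
Context {R : realType} {X : topologicalType}.

Lemma usc_max (K : set X) (u : X -> R) : compact K -> K !=set0 ->
  (forall x e, K x -> 0 < e -> \forall y \near x, K y -> u y < u x + e) ->
  exists2 x, K x & forall y, K y -> u y <= u x.
Proof.
move=> /compact_near_coveringP/near_covering_withinP cK [x0 Kx0] usc.
have ubd : exists m, forall y, K y -> u y <= m.
  have H : \forall m \near +oo, K `<=` (fun y => u y <= m).
    apply: (cK R (pinfty_nbhs R) (fun m y => u y <= m)) => x Kx.
    have h1 := usc x 1 Kx ltr01.
    have h2 : \forall m \near +oo, u x + 1 <= m.
      by exists (u x + 1); split => [|m /ltW]; first exact: num_real.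
    exists ([set y | K y -> u y < u x + 1], [set m | u x + 1 <= m]); first by split.
    by move=> [y m] /= [Hy Hm] Ky; apply: le_trans Hm; exact/ltW/Hy.
  have [m Hm] := @filter_ex _ (pinfty_nbhs R) _ _ H.
  by exists m => y; exact: Hm.
have [m0 Hm0] := ubd.
pose S := u @` K; have S0 : S !=set0 by exists (u x0), x0.
have hS : has_sup S by split => //; exists m0 => _ [y Ky <-]; exact: Hm0.
pose m := sup S.
have lem y : K y -> u y <= m by move=> Ky; apply: ub_le_sup => //; [exact: hS.2|exists y].
apply: contrapT => H.
have ltm y : K y -> u y < m.
  move=> Ky; rewrite lt_neqAle lem // andbT; apply/eqP => uym; apply: H.
  by exists y => // z Kz; rewrite uym; exact: lem.
(* If the supremum m is not attained, each point has a neighbourhood on which u stays below m by a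
   fixed gap; compactness makes the gap uniform, against the definition of m. *)
have HH : \forall e \near 0^'+, K `<=` (fun y => u y <= m - e).
  apply: (cK R (0 : R)^'+ (fun e y => u y <= m - e)) => x Kx.
  pose g := (m - u x) / 2.
  have g0 : 0 < g by rewrite divr_gt0 // subr_gt0 ltm.
  have h1 := usc x g Kx g0.
  have h2 : \forall e \near (0 : R)^'+, e <= g by exact: nbhs_right_le.
  exists ([set y | K y -> u y < u x + g], [set e | e <= g]); first by split.
  move=> [y e] /= [Hy Hm] Ky; have := Hy Ky; rewrite /g in Hm *; lra.
have [e /= [He e0]] : exists e, K `<=` (fun y => u y <= m - e) /\ 0 < e.
  have h2 : \forall e \near (0 : R)^'+, 0 < e by exact: nbhs_right_gt.
  by have [e] := @filter_ex _ ((0 : R)^'+) _ _ (filterI HH h2); exists e.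
have [_ [y Ky <-] uy] := sup_adherent e0 hS.
by have := He y Ky; rewrite leNgt uy.
Qed.

End UpperSemicontinuous.

Section TotalSpace.
Context {R : realType} {n r : nat} {M : topologicalType} {A : bd_atlas R n M}.
Variables (V : metric_bundle A r) (T : R).

Lemma chart_nbhs (a : chart A) x (e : R) : chart_dom a x -> 0 < e ->
  nbhs x [set y | chart_dom a y /\ `|chart_coord a y - chart_coord a x| < e].
Proof.
move=> ax e0; have /subspace_continuousP/(_ x ax) := @coord_cont _ _ _ A a.
move=> /cvgrPdist_lt/(_ e e0); rewrite near_withinE => H.
apply: filterS2 H (open_nbhs_nbhs (conj (dom_open a) ax)) => y Hy ay.
by split => //; rewrite distrC; exact: Hy.
Qed.

(** Squared norms are compared through the Gram matrix, and N^2 + (e/2)^2 <= (N + e/2)^2 replaces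
    the extraction of a root. The other e/2 pays for the change from y to z. *)
Lemma triv_inv_norm_usc (a : chart A) p y (e : R) : chart_img a p -> 0 < e ->
  exists2 d : R, 0 < d & forall q z, chart_img a q -> `|q - p| < d -> `|z - y| < d ->
    `|triv_inv V a (chart_point a q) z| < `|triv_inv V a (chart_point a p) y| + e.
Proof.
move=> ap e0; have [d1 [c [B [d10 c0 B0 HB]]]] := norm_equiv V ap.
set N := `|triv_inv V a (chart_point a p) y|.
have rr0 : 0 <= r%:R * r%:R * `|y| * `|y| by rewrite !mulr_ge0.
pose h := (e / 2) ^+ 2 / (r%:R * r%:R * `|y| * `|y| + 1).
have den : 0 < r%:R * r%:R * `|y| * `|y| + 1 by lra.
have h0 : 0 < h by rewrite divr_gt0 // exprn_gt0 // divr_gt0.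
have [d2 d20 Hd2] := smooth_on_near (@gram_smooth _ _ _ _ _ V a) ap h0.
exists (Num.min (Num.min d1 d2) (e / 2 / B)).
  by rewrite !lt_min d10 d20 !divr_gt0.
move=> q z aq; rewrite !lt_min => /andP[/andP[qd1 qd2] _] /andP[_ zB].
have dq := chart_point_dom aq.
have h1 : `|triv_inv V a (chart_point a q) (z - y)| < e / 2.
  have /andP[_ hh] := HB q aq qd1 (z - y); apply: le_lt_trans hh _.
  by rewrite mulrC -ltr_pdivlMr.
have h2 : `|triv_inv V a (chart_point a q) y| <= N + e / 2.
  have N0 : 0 <= N by exact: normr_ge0.
  rewrite -(@ler_pXn2r _ 2) ?nnegrE //; last lra.
  rewrite -fip_norm.
  have h3 : fip V a q y y - fip V a p y y <= (e / 2) ^+ 2.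
    rewrite !fipE //.
    have -> : (y *m gram V a q *m y^T) ord0 ord0 - (y *m gram V a p *m y^T) ord0 ord0 =
        (y *m (gram V a q - gram V a p) *m y^T) ord0 ord0.
      by rewrite mulmxBr mulmxBl !mxE.
    apply: le_trans (ler_norm _) _; apply: le_trans (quad_form_le _ _ _) _.
    have -> : r%:R * r%:R * `|gram V a q - gram V a p| * `|y| * `|y| =
      `|gram V a q - gram V a p| * (r%:R * r%:R * `|y| * `|y|) by ring.
    have := Hd2 q aq qd2 => /ltW hg.
    apply: le_trans (ler_wpM2r rr0 hg) _.
    have he : h * (r%:R * r%:R * `|y| * `|y| + 1) = (e / 2) ^+ 2 by rewrite divfK // gt_eqF.
    by rewrite -he ler_wpM2l ?(ltW h0) // lerDl.
  rewrite (fip_norm V a p) -/N in h3.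
  have : N ^+ 2 + (e / 2) ^+ 2 <= (N + e / 2) ^+ 2.
    rewrite sqrrD lerD2r lerDl mulrn_wge0 // mulr_ge0 //; lra.
  lra.
rewrite -(subrK y z) triv_invD //; apply: le_lt_trans (ler_normD _ _) _; lra.
Qed.

Variable d : total_space V -> total_space V -> R.
Hypothesis d_metric : total_metric d.
Variable C : R -> set (total_space V).
Hypothesis C_cont : pointed_hausdorff_continuous d T C.

Lemma total_metric_nbhs (o : total_space V) N : total_nbhs o N ->
  exists2 e : R, 0 < e & forall q, d o q < e -> N q.
Proof. by have [_ _ _ H] := d_metric => /H. Qed.

(** The point of C s that is found lies over some q near p and not necessarily over p, because d
    measures distances in the total space. *)
Lemma fiber_lsc (a : chart A) p y t (e : R) : chart_img a p -> 0 <= t <= T -> 0 < e ->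
  C t (total_pt V a p y) -> exists2 del : R, 0 < del & forall s, 0 <= s <= T ->
    `|s - t| < del -> exists q z, [/\ chart_img a q, `|q - p| < e, `|z - y| < e &
      C s (total_pt V a q z)].
Proof.
move=> ap tT e0 Cy; set o := total_pt V a p y in Cy.
have ax := chart_point_dom ap.
pose N (pt : total_space V) := exists q z,
  [/\ pt = total_pt V a q z, chart_img a q, `|q - p| < e & `|z - y| < e].
have oN : total_nbhs o N.
  exists a; split => //.
  exists ([set x | chart_dom a x /\ `|chart_coord a x - p| < e] `*`
          [set z | `|z - y| < e]).
    exists ([set x | chart_dom a x /\ `|chart_coord a x - p| < e],
            [set z | `|z - y| < e]) => //; split => /=.
      by have := chart_nbhs ax e0; rewrite chart_pointK.
    rewrite frameK //; apply/nbhs_ballP; exists e => // z.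
    by rewrite -ball_normE /= distrC.
  move=> x w ax' [[_ h1] h2]; exists (chart_coord a x), (triv a w); split => //.
    exact: total_ptE.
  by exists x.
have [e' e'0 He'] := total_metric_nbhs oN.
have [doo _ _ _] := d_metric.
(* Radius 0 suffices, since the only point of C t to be approximated is the center o itself. *)
have [del del0 Hdel] := C_cont o 0 e'0 tT.
exists del => // s sT st; have [_ H] := Hdel s sT st.
have oo : d o o <= 0 by rewrite (doo o o).2.
have [pt Cpt dpt] := H o Cy oo.
have [q [z [ept aq qe ze]]] := He' _ dpt.
by exists q, z; split => //; rewrite -ept.
Qed.

Variable f : R -> forall x, fiber V x.
Hypothesis f_smooth : smooth_family T f.

Lemma local_section_coord (a : chart A) s x : chart_dom a x ->
  local_section a (f s) (chart_coord a x) = triv a (f s x).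
Proof. by move=> ax; rewrite /local_section coordK. Qed.

Lemma family_cont (a : chart A) p t (e : R) : chart_img a p -> 0 <= t <= T -> 0 < e ->
  exists2 del : R, 0 < del & forall q s, chart_img a q -> 0 <= s <= T ->
    `|q - p| < del -> `|s - t| < del ->
    `|local_section a (f s) q - local_section a (f t) p| < e.
Proof.
move=> ap tT e0.
have [del d0 H] := smooth_on_near (@f_smooth a) (conj ap tT : cylinder a T (p, t)) e0.
exists del => // q s aq sT qp st.
by apply: (H (q, s)); [split|rewrite prod_normE /= gt_max qp st].
Qed.

Lemma family_limit_mem x t : 0 <= t <= T -> total_closed (C t) ->
  (forall del : R, 0 < del -> exists s, [/\ 0 <= s <= T, `|s - t| < del &
    C s (TotalPt (f s x))]) -> C t (TotalPt (f t x)).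
Proof.
move=> tT cC H; apply: contrapT => /cC nC; set o := TotalPt (f t x) in nC.
have [e e0 He] := total_metric_nbhs nC.
have [_ _ tri nb] := d_metric.
(* The 1 places f(s, x) in the ball of radius 1 to which Hausdorff closeness is applied; the two
   halves of e add up in the triangle inequality. *)
have e2 : 0 < Num.min (e / 2) 1 by rewrite lt_min ltr01 divr_gt0.
have : total_nbhs o [set q | d o q < Num.min (e / 2) 1] by apply/nb; exists (Num.min (e / 2) 1).
move=> [b [bx [P nP HP]]]; rewrite /= in bx nP.
have bp : chart_img b (chart_coord b x) by exists x.
move: nP => [[P1 P2] [nP1 /nbhs_ballP[eta eta0 HP2]] sP].
have [d1 d10 Hd1] := family_cont bp tT eta0.
have e3 : 0 < e / 2 by rewrite divr_gt0.
have [d2 d20 Hd2] := C_cont o 1 e3 tT.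
have d12 : 0 < Num.min d1 d2 by rewrite lt_min d10 d20.
have [s [sT]] := H _ d12; rewrite lt_min => /andP[sd1 sd2] Cs.
have : d o (TotalPt (f s x)) < Num.min (e / 2) 1.
  apply: HP => //; apply: sP; split; first exact: nbhs_singleton.
  apply: HP2; rewrite -ball_normE /= distrC.
  have := Hd1 _ s bp sT; rewrite subrr normr0 => /(_ d10 sd1).
  by rewrite !local_section_coord.
rewrite lt_min => /andP[h1 h2].
have [q Cq dq] := (Hd2 s sT sd2).1 _ Cs (ltW h2).
by apply: (He q) => //; apply: le_lt_trans (tri _ (TotalPt (f s x)) _) _; lra.
Qed.

Variable D : chart A -> R -> 'rV[R]_n -> 'I_n -> 'M[R]_r.
Hypothesis D_metric : is_metric_connection V T D.
Hypothesis C_par : forall t, 0 <= t <= T -> parallel_invariant (fun a => D a t) (C t).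

(** A nearby point z of C s over q' is carried into the given fiber over q by transport along the
    segment from q' to q. This remains in C s and moves z by an amount proportional to the length of
    the segment. *)
Lemma fiber_usc (a : chart A) p t y (e : R) : chart_img a p -> 0 <= t <= T -> 0 < e ->
  C t (total_pt V a p y) -> exists2 del : R, 0 < del & forall q s,
    chart_img a q -> 0 <= s <= T -> `|q - p| < del -> `|s - t| < del ->
    exists2 z, C s (total_pt V a q z) &
      `|triv_inv V a (chart_point a q) (local_section a (f s) q - z)| <
      `|triv_inv V a (chart_point a p) (local_section a (f t) p - y)| + e.
Proof.
move=> ap tT e0 Cy.
have [d1 d10 Hd1] := triv_inv_norm_usc (local_section a (f t) p - y) ap e0.
have d13 : 0 < d1 / 3 by rewrite divr_gt0.
have [d2 d20 Hd2] := family_cont ap tT d13.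
have [d3 [B [d30 B0 HB]]] := connection_bound D_metric ap tT.
have [d4 d40 Hd4] := chart_img_nbhs ap.
pose K := r%:R * n%:R * B.
have K0 : 0 <= K by rewrite !mulr_ge0.
pose Y := `|y| + d1 / 3.
have Y0 : 0 < Y by rewrite ltr_wpDl.
have c6 : 0 <= 6 * K * Y by rewrite !mulr_ge0 // ltW.
have [k1 k10 K1] := small_scale c6 d13.
have c2 : 0 <= 2 * K by rewrite mulr_ge0.
have t3 : 0 < 1 / 3 :> R by rewrite divr_gt0.
have [k2 k20 K2] := small_scale c2 t3.
(* The error d1 splits into thirds: the variation of f, the displacement z - y, and transport. The
   bounds d3 and d4 keep the segment where the connection is bounded and inside the chart; its
   length is below 2 rho, hence the final half. *)
pose rho := Num.min (Num.min (d1 / 3) (Num.min d3 d4)) (Num.min k1 k2 / 2).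
have rho0 : 0 < rho by rewrite !(lt_min, divr_gt0) ?d30 ?d40 ?k10 ?k20 ?d10.
have [r1 r2 r3 r4] : [/\ rho <= d1 / 3, rho <= d3, rho <= d4 & rho <= Num.min k1 k2 / 2].
  by split; rewrite /rho !ge_min lexx ?orbT.
clearbody rho.
have [d5 d50 Hd5] := fiber_lsc ap tT rho0 Cy.
exists (Num.min (Num.min d2 d5) rho); first by rewrite !lt_min d20 d50 rho0.
move=> q s aq sT; rewrite !lt_min => /andP[/andP[qd2 qd5] qr] /andP[/andP[sd2 sd5] sr].
have [q' [z [aq' q'r zr Cz]]] := Hd5 s sT sd5.
pose w := q - q'.
have near_seg (c : R) : 0 <= c <= 1 -> `|q' + c *: w - p| < rho.
  move=> /andP[c0 c1].
  have -> : q' + c *: w - p = (1 - c) *: (q' - p) + c *: (q - p).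
    by apply/rowP => j; rewrite !mxE; ring.
  apply: le_lt_trans (ler_normD _ _) _; rewrite !normrZ ger0_norm ?subr_ge0 // ger0_norm //.
  have [->|cn0] := eqVneq c 0; first by rewrite subr0 mul1r mul0r addr0.
  have cp : 0 < c by rewrite lt_neqAle eq_sym cn0.
  have h1 : (1 - c) * `|q' - p| <= (1 - c) * rho by rewrite ler_wpM2l ?subr_ge0 // ltW.
  have h2 : c * `|q - p| < c * rho by rewrite ltr_pM2l.
  lra.
have line (c : R) : 0 <= c <= 1 -> chart_img a (q' + c *: w).
  move=> hc; apply: Hd4; first exact: lt_le_trans (near_seg c hc) r3.
  by apply: half_space_segment => //; [exact: (chart_img_half aq')|exact: (chart_img_half aq)].
have GB (c : R) i : 0 <= c <= 1 -> `|D a s (q' + c *: w) i| <= B.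
  move=> hc; apply: HB => //; first exact: line.
    exact: lt_le_trans (near_seg c hc) r2.
  exact: lt_le_trans sr r2.
have w2 : `|w| < Num.min k1 k2.
  have -> : w = (q - p) - (q' - p) by rewrite /w opprB addrA subrK.
  apply: le_lt_trans (ler_normB _ _) _; lra.
have small : 2 * r%:R * n%:R * B * `|w| <= 1 / 3.
  have [->|w0] := eqVneq w 0; first by rewrite normr0 mulr0 ltW.
  have wp : 0 < `|w| by rewrite normr_gt0.
  have := K2 _ wp (ltW (lt_le_trans w2 _)); rewrite ge_min lexx orbT => /(_ isT).
  by rewrite /K => h; apply: ltW; move: h; congr (_ < _); ring.
have [D_conn _] := D_metric.
have h0 : - (1 / 4) < (0 : R) < 5 / 4 by lra.
have Gc i : {within chart_img a, continuous (fun q => D a s q i)}.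
  by apply: smooth_on_continuous; exact: (connection_smooth D_conn sT).
have [u [u0 ut ub]] := transport_exists z line Gc B0 GB small h0.
have i0 : 0 <= (0 : R) <= 1 by lra.
have i1 : 0 <= (1 : R) <= 1 by lra.
have := transport_invariant D_conn sT (C_par sT) line ut i0 i1.
rewrite ramp0 ramp1 scale0r addr0 scale1r u0 /w subrKC => /(_ Cz) Cu.
exists (u 1) => //; apply: Hd1 => //.
  by apply: lt_le_trans qr (le_trans r1 _); lra.
have uz : `|u 1 - z| <= d1 / 3.
  apply: le_trans (ub 1 _) _; first lra.
  have zY : `|z| <= Y.
    rewrite -(subrK y z); apply: le_trans (ler_normD _ _) _; rewrite /Y.
    by rewrite addrC lerD2l; exact: ltW (lt_le_trans zr r1).
  have c6' : 0 <= 6 * r%:R * n%:R * B * `|w| by rewrite !mulr_ge0.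
  apply: le_trans (ler_wpM2l c6' zY) _.
  have [->|w0] := eqVneq w 0; first by rewrite normr0 mulr0 mul0r ltW.
  have wp : 0 < `|w| by rewrite normr_gt0.
  have := K1 _ wp (ltW (lt_le_trans w2 _)); rewrite ge_min lexx => /(_ isT).
  by rewrite /K => h; apply: ltW; move: h; congr (_ < _); ring.
have -> : local_section a (f s) q - u 1 - (local_section a (f t) p - y) =
  (local_section a (f s) q - local_section a (f t) p) - (u 1 - z) - (z - y).
  by apply/rowP => j; rewrite !mxE; ring.
have h1 := Hd2 q s aq sT qd2 sd2.
apply: le_lt_trans (ler_normB _ _) _; apply: le_lt_trans (lerD (ler_normB _ _) (lexx _)) _.
lra.
Qed.

(** Phrased with a point c' rather than with [dist_set], so that nearby fibers are also seen to be
    nonempty. *)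
Lemma dist_usc x t c (e : R) : 0 <= t <= T -> fib (C t) x c -> 0 < e ->
  \forall z \near (x, t), 0 <= z.2 <= T ->
    exists2 c', fib (C z.2) z.1 c' & `|f z.2 z.1 - c'| < `|f t x - c| + e.
Proof.
move=> tT Cc e0; have [a ax] := dom_cover A x.
have ap : chart_img a (chart_coord a x) by exists x.
have Cc' : C t (total_pt V a (chart_coord a x) (triv a c)) by rewrite -total_ptE.
have [del del0 H] := fiber_usc ap tT e0 Cc'.
exists ([set y | chart_dom a y /\ `|chart_coord a y - chart_coord a x| < del],
        [set s | `|s - t| < del]).
  split => /=; first exact: chart_nbhs.
  by apply/nbhs_ballP; exists del => // s; rewrite -ball_normE /= distrC.
move=> [y s] /= [[ay yd] sd] sT.
have aq : chart_img a (chart_coord a y) by exists y.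
have [z Cz] := H _ s aq sT yd sd.
rewrite !local_section_coord // !coordK // triv_invB // triv_invB // !trivK // => h.
by exists (triv_inv V a y z) => //; move: Cz; rewrite /total_pt coordK.
Qed.

End TotalSpace.

(** * The backward time step *)

Section DerivLinear.
Context {R : realType} {E F F' : normedModType R}.

Lemma is_deriv_in_linear (S : set E) (g : E -> F) (L : F -> F') u p l :
  linear L -> continuous L -> is_deriv_in S g u p l ->
  is_deriv_in S (fun q => L (g q)) u p (L l).
Proof.
move=> lL cL gl; rewrite /is_deriv_in.
have -> : diff_quot (fun q => L (g q)) u p = L \o diff_quot g u p.
  by apply/funext => h; rewrite /diff_quot /= (linear_funZ lL) (linear_funB lL).
exact: (continuous_cvg _ (cL l) gl).
Qed.

End DerivLinear.

Section Box.
Context {R : realType} {r : nat}.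
Variables (c : 'rV[R]_r) (b : R).
Hypothesis b0 : 0 <= b.

(* Precomposing with this Lipschitz truncation makes a locally Lipschitz vector
   field globally Lipschitz without changing it near [c]. *)
Definition cube_proj (w : 'rV[R]_r) : 'rV[R]_r :=
  \row_j Num.max (c ord0 j - b) (Num.min (c ord0 j + b) (w ord0 j)).

Lemma cube_proj_near w : `|cube_proj w - c| <= b.
Proof.
apply: mx_norm_le => // i j; rewrite !mxE (ord1 i).
set m := Num.max _ _; rewrite ler_norml.
have h1 : c ord0 j - b <= m by rewrite le_max lexx.
have h2 : m <= c ord0 j + b.
  by rewrite ge_max ge_min lexx andbT lerBlDr -addrA lerDl addr_ge0.
by rewrite /GRing.zero /=; lra.
Qed.

Lemma cube_proj_id w : `|w - c| <= b -> cube_proj w = w.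
Proof.
move=> wc; apply/rowP => j; rewrite mxE.
have := le_trans (mx_norm_ge (w - c) ord0 j) wc; rewrite !mxE ler_norml => /andP[h1 h2].
by rewrite min_r ?max_r //; lra.
Qed.

Lemma cube_proj_lip w z : `|cube_proj w - cube_proj z| <= `|w - z|.
Proof.
apply: mx_norm_le => // i j; rewrite !mxE.
have := mx_norm_ge (w - z) ord0 j; rewrite !mxE.
set W := w ord0 j; set Z := z ord0 j; set lo := _ - b; set hi := _ + b => h.
apply: le_trans h.
have lh : lo <= hi by rewrite /lo /hi; move: b0; lra.
clearbody lo hi W Z.
case: (leP hi W) => h1; case: (leP hi Z) => h2; rewrite ?(max_r lh);
  case: (leP lo W) => h3; case: (leP lo Z) => h4;
  rewrite ler_norml; have := ler_norm (W - Z); have := ler_norm (- (W - Z)); rewrite normrN; lra.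
Qed.

End Box.

Section TimeStep.
Context {R : realType} {n r : nat} {M : topologicalType} {A : bd_atlas R n M}.
Variables (V : metric_bundle A r) (T : R) (T_gt0 : 0 < T).
Variable phi : forall x, fiber V x -> fiber V x.
Hypothesis phi_lipschitz : locally_lipschitz phi.
Variable f : R -> forall x, fiber V x.
Hypothesis f_smooth : smooth_family T f.

(** [time_deriv] is a bare limit; that it converges is seen in the coordinates of f and carried to
    the fiber by the continuous linear map [triv_inv]. *)
Lemma family_time_deriv t x : 0 <= t <= T ->
  is_deriv_in (seg 0 T : set R^o) (fun s : R^o => f s x) (1 : R^o) (t : R^o) (time_deriv T f t x).
Proof.
move=> tT; have [a ax] := dom_cover A x.
have ap : chart_img a (chart_coord a x) by exists x.
have PF := seg_steps_proper T_gt0 tT.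
have [U [f' [oU Ut cf ff']]] := @f_smooth a _ (conj ap tT : cylinder a T (chart_coord a x, t)).
pose U2 := [set s : R^o | U (chart_coord a x, s)].
have oU2 : open U2 by exact: open_slice2.
have df' : derivable (fun s : R^o => f' (chart_coord a x, s)) t 1.
  apply/derivable1_diffP.
  apply: (@differentiable_comp _ _ _ _ (fun s : R^o => (chart_coord a x, s)) f').
    by apply: differentiable_pair => //; exact: differentiable_cst.
  exact: (cf 1%N).1.
have e (s : R^o) : U2 s -> seg 0 T s -> triv a (f s x) = f' (chart_coord a x, s).
  by move=> Us sT; rewrite -ff' //= local_section_coord.
have h := deriv_in_cvg (S := seg 0 T) oU2 Ut tT e df'.
have := is_deriv_in_linear (triv_inv_linear V ax) (@triv_inv_continuous _ _ _ _ _ V a x ax) h.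
have -> : (fun q : R^o => triv_inv V a x (triv a (f q x))) = (fun s : R^o => f s x).
  by apply/funext => s; rewrite trivK.
move=> H; have -> // : time_deriv T f t x = triv_inv V a x ('D_1 (fun s : R^o => f' (chart_coord a x, s)) t).
exact: cvg_lim H.
Qed.

Lemma family_backward t x (e : R) : 0 <= t <= T -> 0 < e ->
  exists2 h0 : R, 0 < h0 & forall h, 0 < h -> h < h0 -> 0 <= t - h ->
    `|f t x - f (t - h) x - h *: time_deriv T f t x| <= e * h.
Proof.
move=> tT e0; have := @family_time_deriv t x tT.
move=> /cvgrPdist_lt/(_ e e0); rewrite near_withinE => -[h0 /= h00 H].
exists h0 => // h hp hh th.
have := H (- h); rewrite /= sub0r opprK gtr0_norm // => /(_ hh).
have nh : - h != 0 by rewrite oppr_eq0 gt_eqF.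
move=> /(_ nh); rewrite /diff_quot scaleNr /seg /= -[h *: _]/(h * 1) mulr1.
have hT : 0 <= t - h <= T by lra.
move=> /(_ hT) => Hd.
have -> : f t x - f (t - h) x - h *: time_deriv T f t x =
    - (h *: (time_deriv T f t x - (- h)^-1 *: (f (t - h) x - f t x))).
  rewrite scalerBr scalerA invrN mulrN mulfV ?gt_eqF // scaleN1r.
  by rewrite opprK opprD opprB addrC.
by rewrite normrN normrZ gtr0_norm // mulrC ler_wpM2r ?ltW.
Qed.

(** A single number L serves as Lipschitz constant and, through its inverse, as radius and time
    window. All larger L work too, so a compactness argument along L tending to infinity can
    follow. *)
Lemma phi_lipschitz_near (x1 : M) (t1 : R) : 0 <= t1 <= T -> exists L0 : R, 
  \forall x \near x1, forall L t, L0 < L -> 0 <= t <= T -> `|t - t1| < L^-1 ->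
    forall v v' : fiber V x, `|v - f t x| < L^-1 -> `|v' - f t x| < L^-1 ->
      `|phi v - phi v'| <= L * `|v - v'|.
Proof.
move=> tT; have [a ax] := dom_cover A x1.
set p1 := chart_coord a x1; have ap : chart_img a p1 by exists x1.
set w1 := triv a (f t1 x1).
have [k [eta [k0 eta0 Hphi]]] : exists k eta : R, [/\ 0 < k, 0 < eta &
    forall q w w', chart_img a q -> `|q - p1| < eta -> `|w - w1| < eta -> `|w' - w1| < eta ->
    `|triv a (phi (triv_inv V a (chart_point a q) w)) -
      triv a (phi (triv_inv V a (chart_point a q) w'))| <= k * `|w - w'| ].
  pose S := chart_img a `*` [set: 'rV[R]_r].
  pose Fphi (q : 'rV[R]_n * 'rV[R]_r) := triv a (phi (triv_inv V a (chart_point a q.1) q.2)).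
  have H : forall z, (S `*` S) z -> lipschitz_on Fphi (within (S `*` S) (nbhs z)).
    by move=> z Sz; exact: (@phi_lipschitz a z Sz).
  have Sz : (S `*` S) ((p1, w1), (p1, w1)) by [].
  have kp : \forall k \near +oo, 0 < (k : R) by exact: nbhs_pinfty_gt.
  have Hz := H _ Sz; rewrite /lipschitz_on in Hz.
  have [k [/= Hk k0]] := @filter_ex _ (pinfty_nbhs R) _ _ (filterI Hz kp).
  have [eta eta0 Heta] := (nbhs_ballP _ _).1 Hk.
  exists k, eta; split => // q w w' aq qe we w'e.
  have Bz : ball ((p1, w1), (p1, w1)) eta ((q, w), (q, w')).
    by rewrite -ball_normE /= distrC !prod_normE /= !gt_max qe we w'e.
  have := Heta _ Bz (conj (conj aq I) (conj aq I)); rewrite /Fphi /=.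
  by rewrite prod_normE /= subrr normr0 max_r.
have [d1 [c [B [d10 c0 B0 HB]]]] := norm_equiv V ap.
have eta2 : 0 < eta / 2 by rewrite divr_gt0.
have [d2 d20 Hd2] := family_cont f_smooth ap tT eta2.
pose m := Num.min d2 (c * eta / 2).
have m0 : 0 < m by rewrite lt_min d20 divr_gt0 // mulr_gt0.
(* The first summand forces 1/L < m; the second is the Lipschitz constant k in coordinates converted
   to the fiber norms. *)
exists (m^-1 + B * k / c).
have rr0 : 0 < Num.min (Num.min d1 d2) eta by rewrite !lt_min d10 d20 eta0.
apply: filterS (chart_nbhs ax rr0) => x [dx].
rewrite !lt_min -/p1 => /andP[/andP[xd1 xd2] xe] L t LL tT' tL v v' vL v'L.
have L0 : 0 < L.
  by apply: lt_trans LL; rewrite ltr_pwDl ?invr_gt0 // divr_ge0 ?mulr_ge0 // ltW.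
have Lm : L^-1 < m.
  rewrite invf_plt ?posrE //; apply: le_lt_trans LL.
  by rewrite lerDl divr_ge0 ?mulr_ge0 // ltW.
have aq : chart_img a (chart_coord a x) by exists x.
have nlow (u : fiber V x) : c * `|triv a u| <= `|u|.
  by have /andP[+ _] := HB _ aq xd1 (triv a u); rewrite coordK // trivK.
have nup (u : fiber V x) : `|u| <= B * `|triv a u|.
  by have /andP[_] := HB _ aq xd1 (triv a u); rewrite coordK // trivK.
have close (u : fiber V x) : `|u - f t x| < L^-1 -> `|triv a u - w1| < eta.
  move=> uL; rewrite -(subrKA (triv a (f t x))); apply: le_lt_trans (ler_normD _ _) _.
  have h1 : `|triv a u - triv a (f t x)| < eta / 2.
    rewrite -trivB // -(ltr_pM2l c0); apply: le_lt_trans (nlow _) _.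
    apply: lt_trans uL (lt_le_trans Lm _); rewrite /m ge_min mulrA lexx orbT //.
  have := Hd2 _ t aq tT' xd2 (lt_le_trans (lt_trans tL Lm) _).
  rewrite /m ge_min lexx => /(_ isT); rewrite !local_section_coord // -/w1; lra.
have := Hphi _ (triv a v) (triv a v') aq xe (close v vL) (close v' v'L).
rewrite coordK // !trivK // -!trivB // => h.
apply: le_trans (nup _) _; apply: (@le_trans _ _ (B * (k * `|triv a (v - v')|))).
  by rewrite ler_pM2l.
apply: (@le_trans _ _ (B * k / c * `|v - v'|)); last first.
  by rewrite ler_wpM2r // ltW //; apply: lt_trans LL; rewrite ltrDr invr_gt0.
rewrite mulrA -[B * k / c * _]mulrA ler_pM2l ?mulr_gt0 //.
by rewrite mulrC ler_pdivlMr // mulrC.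
Qed.

Variable C : R -> set (total_space V).
Hypothesis C_ode : ode_preserves T phi C.

(* If the distance at time [t - h] is less than [(1 - kap h)] times the distance
   at time [t], the points of [C (t - h)] nearest to [f (t - h) x] flow to points
   of [C t] that are too close to [f t x]. *)
Lemma time_step x t v (K rho kap : R) :
  0 < t <= T -> convex_set (fib (C t) x) -> nearest (f t x) (fib (C t) x) v ->
  0 < K -> 0 < `|f t x - v| -> `|f t x - v| < rho ->
  (forall u u' : fiber V x, `|u - f t x| < rho -> `|u' - f t x| < rho ->
    `|phi u - phi u'| <= K * `|u - u'|) ->
  ip (time_deriv T f t x - phi (f t x)) (f t x - v) <= 0 ->
  K < kap ->
  (exists2 h1 : R, 0 < h1 & forall h, 0 < h -> h < h1 -> fib (C (t - h)) x !=set0 /\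
    dist_set (f (t - h) x) (fib (C (t - h)) x) <= `|f t x - v| * (1 - kap * h)) ->
  False.
Proof.
move=> /andP[t0 tT] cC vn K0; set nv := f t x - v; set d0 := `|nv| => d00 d0rho lip dle Kkap.
move=> [h1 h10 Hh1].
have [a ax] := dom_cover A x.
have ap : chart_img a (chart_coord a x) by exists x.
have [dd [c [B [dd0 c0 B0 HB]]]] := norm_equiv V ap.
have nlow (u : fiber V x) : c * `|triv a u| <= `|u|.
  have := HB _ ap; rewrite subrr normr0 coordK // => /(_ dd0 (triv a u)).
  by rewrite trivK // => /andP[].
have nup (u : fiber V x) : `|u| <= B * `|triv a u|.
  have := HB _ ap; rewrite subrr normr0 coordK // => /(_ dd0 (triv a u)).
  by rewrite trivK // => /andP[].
(* The first bound makes the final inequality kap d0 <= 2 eta + K (d0 + eta) impossible; the second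
   keeps all points within rho of f. *)
pose eta := Num.min ((kap - K) * d0 / (2 * (2 + K))) ((rho - d0) / 2).
have eta0 : 0 < eta.
  by rewrite lt_min !divr_gt0 ?mulr_gt0 //; lra.
have etarho : d0 + eta < rho.
  have : eta <= (rho - d0) / 2 by rewrite ge_min lexx orbT.
  lra.
have etaK : (2 + K) * eta < (kap - K) * d0.
  have h2 : eta <= (kap - K) * d0 / (2 * (2 + K)) by rewrite ge_min lexx.
  have h3 : 0 < (kap - K) * d0 by rewrite mulr_gt0 //; lra.
  have h4 : 0 < 2 * (2 + K) by lra.
  move: h2; rewrite ler_pdivlMr // => h2; lra.
clearbody eta.
have tT' : 0 <= t <= T by rewrite (ltW t0).
have [h2 h20 Hh2] := family_backward x tT' eta0.
set ft := time_deriv T f t x in Hh2 dle.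
(* A coordinate cube of half-width b has size at most eta / 4 in the fiber norm. *)
pose b := eta / (4 * B).
have b0 : 0 < b by rewrite divr_gt0 ?mulr_gt0.
pose psi (w : 'rV[R]_r) := triv a (phi (triv_inv V a x w)).
pose K1 := B * K / c.
have K10 : 0 < K1 by rewrite divr_gt0 ?mulr_gt0.
pose B1 := (`|phi (f t x)| + K * (d0 + eta)) / c.
have B10 : 0 <= B1 by rewrite divr_ge0 ?(ltW c0) // addr_ge0 // mulr_ge0 // ?(ltW K0) //; lra.
have nft : 0 <= `|ft| := normr_ge0 _.
have [h3 h30 Hh3] := small_scale (ltW K10) (divr_gt0 ltr01 (ltr0n R 2)).
have [h4 h40 Hh4] := small_scale (mulr_ge0 (ler0n R 2) B10) b0.
have X5 : 0 <= `|ft| + 2 * eta by lra.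
have e4 : 0 < eta / 4 by rewrite divr_gt0.
have [h5 h50 Hh5] := small_scale X5 e4.
(* Here h3 serves the contraction condition of Picard, h4 keeps the solution in the cube where the
   truncation is invisible, and h5 keeps its starting point within d0 + eta / 2 of f t x. *)
pose h6 := Num.min (Num.min (Num.min h1 h2) (Num.min h3 h4)) (Num.min (Num.min h5 t) 1).
have h60 : 0 < h6 by rewrite !lt_min h10 h20 h30 h40 h50 t0 ltr01.
pose h := h6 / 2.
have h0 : 0 < h by rewrite divr_gt0.
have hh6 : h < h6 by rewrite /h; lra.
have : h < h6 := hh6.
rewrite {1}/h6 !lt_min => /andP[/andP[/andP[hh1 hh2] /andP[hh3 hh4]] /andP[/andP[hh5 hht] hh1']].
clearbody h; clear h6 h60 hh6.
have th : 0 <= t - h by lra.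
have {Hh1}[Cne dh] := Hh1 h h0 hh1.
have {}Hh2 := Hh2 h h0 hh2 th.
have {}Hh3 := Hh3 h h0 (ltW hh3).
have {}Hh4 := Hh4 h h0 (ltW hh4).
have {}Hh5 := Hh5 h h0 (ltW hh5).
have eh : 0 < eta * h by rewrite mulr_gt0.
(* A point nearest up to eta h is enough, as the final comparison has a margin proportional to h. *)
have [ch Cch dch] : exists2 ch, fib (C (t - h)) x ch &
    `|f (t - h) x - ch| < d0 * (1 - kap * h) + eta * h.
  by apply: dist_set_lt => //; apply: le_lt_trans dh _; rewrite ltrDl.
have dch' : `|f (t - h) x - ch| < d0 + eta * h.
  apply: lt_le_trans dch _; rewrite lerD2r ler_piMr ?(ltW d00) //.
  by rewrite lerBlDr lerDl mulr_ge0 ?(ltW h0) //; lra.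
have fth : `|f (t - h) x - f t x| <= h * `|ft| + eta * h.
  rewrite distrC -(subrK (h *: ft) (f t x - f (t - h) x)).
  apply: le_trans (ler_normD _ _) _; rewrite normrZ (gtr0_norm h0) addrC.
  by rewrite lerD2l.
have chf : `|ch - f t x| < d0 + eta / 2.
  rewrite -(subrKA (f (t - h) x)); apply: le_lt_trans (ler_normD _ _) _.
  rewrite distrC; lra.
pose z0 := triv a ch.
have box w : `|w - z0| <= b -> `|triv_inv V a x w - f t x| <= d0 + eta.
  move=> wb; rewrite -(subrKA ch); apply: le_trans (ler_normD _ _) _.
  have : `|triv_inv V a x w - ch| <= eta / 2; last by lra.
  apply: le_trans (nup _) _; rewrite trivB // frameK //.
  apply: (@le_trans _ _ (B * b)); first by rewrite ler_pM2l.
  have -> : B * b = eta / 4 by rewrite /b; field; lra.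
  lra.
pose F (s : R) (w : 'rV[R]_r) := psi (cube_proj z0 b w).
have inbox w : `|triv_inv V a x (cube_proj z0 b w) - f t x| <= d0 + eta.
  by apply: box; apply: cube_proj_near; exact: ltW.
have F_lip0 w w' s : `|F s w - F s w'| <= K1 * `|w - w'|.
  rewrite /F /psi -trivB //.
  set u := triv_inv V a x (cube_proj z0 b w); set u' := triv_inv V a x (cube_proj z0 b w').
  have hu : `|u - f t x| < rho by apply: le_lt_trans etarho; exact: inbox.
  have hu' : `|u' - f t x| < rho by apply: le_lt_trans etarho; exact: inbox.
  have h7 := le_trans (nlow _) (lip u u' hu hu').
  have h8 : `|u - u'| <= B * `|w - w'|.
    apply: le_trans (nup _) _; rewrite trivB // !frameK // ler_pM2l //.
    by apply: cube_proj_lip; exact: ltW.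
  rewrite /K1 mulrAC ler_pdivlMr // mulrC; apply: le_trans h7 _.
  by rewrite [B * K]mulrC -mulrA ler_pM2l.
have F_lip s w w' : t - h <= s <= t -> `|F s w - F s w'| <= K1 * `|w - w'| by move=> _.
have F_cont u : continuous u -> continuous (fun s => F s (u s)).
  move=> cu s; apply/cvgrPdist_lt => e e0.
  have := cu s; move=> /cvgrPdist_lt/(_ (e / K1) (divr_gt0 e0 K10)).
  apply: filterS => s' hs'; apply: le_lt_trans (F_lip0 _ _ s) _.
  by rewrite mulrC -ltr_pdivlMr.
have F_bound s : t - h <= s <= t -> `|F s z0| <= B1.
  move=> _; rewrite /F /psi /B1 ler_pdivlMr // mulrC; apply: le_trans (nlow _) _.
  rewrite -(subrK (phi (f t x)) (phi _)) addrC; apply: le_trans (ler_normD _ _) _.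
  rewrite lerD2l; apply: le_trans (lip _ _ _ _) _.
  - by apply: le_lt_trans etarho; exact: inbox.
  - by rewrite subrr normr0; lra.
  - by rewrite ler_pM2l //; exact: inbox.
have s0i : t - h <= t - h <= t by lra.
have Kab : K1 * (t - (t - h)) <= 2^-1 by rewrite subKr mulrC; lra.
have [u [u0 du ub]] := picard s0i (ltW K10) Kab F_lip F_cont F_bound.
have ubox s : t - h <= s <= t -> `|u s - z0| <= b.
  move=> hs; apply: le_trans (ub s hs) _; rewrite subKr.
  have -> : 2 * (B1 * h) = h * (2 * B1) by ring.
  exact: ltW.
pose U (s : R^o) := triv_inv V a x (u s).
have du' s : t - h <= s <= t -> is_derive s (1 : R) u (triv a (phi (U s))).
  by move=> hs; have := du s hs; rewrite /F /psi cube_proj_id //; exact: ubox.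
have th_t : t - h <= t by lra.
have U_sol s : t - h <= s <= t ->
    is_deriv_in (seg (t - h) t : set R^o) U (1 : R^o) (s : R^o) (phi (U s)).
  move=> hs; have [D1 E1] := du' s hs.
  have := deriv_in_cvg (S := seg (t - h) t : set R^o) openT I hs (fun _ _ _ => erefl) D1.
  move/(is_deriv_in_linear (triv_inv_linear V ax) (@triv_inv_continuous _ _ _ _ _ V a x ax)).
  by rewrite E1 trivK.
have CU : fib (C t) x (U t).
  have U0 : U (t - h) = ch by rewrite /U u0 /z0 trivK.
  have ht : t - h <= t <= t by lra.
  by apply: (@C_ode x (t - h) t th th_t tT U U_sol) => //; rewrite U0.
have supp := nearest_support cC vn CU.
rewrite -/nv in supp.
(* The whole trajectory stays within d0 + eta of f t x, which bounds from below its speed along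
   n. *)
have slow s : t - h <= s <= t ->
    ip (phi (f t x)) nv - K * (d0 + eta) * d0 <= ip (phi (U s)) nv.
  move=> hs; have h7 := box _ (ubox s hs).
  have h8 : `|phi (f t x) - phi (U s)| <= K * (d0 + eta).
    apply: le_trans (lip _ _ _ _) _.
    - by rewrite subrr normr0; lra.
    - by apply: le_lt_trans etarho.
    - by rewrite ler_pM2l // distrC.
  have h9 := ip_le_norm (phi (f t x) - phi (U s)) nv; rewrite ipBl in h9.
  have := ler_wpM2r (ltW d00) h8; rewrite -/d0 in h9 *; lra.
have ipu s : ip (U s) nv = \sum_j u s ord0 j * ip (triv_inv V a x (delta_mx ord0 j)) nv.
  rewrite /U {1}(row_sum_delta (u s)) triv_inv_sum // ip_suml.
  by apply: eq_bigr => j _; rewrite triv_invZ // ipZl.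
have dip s : t - h <= s <= t -> is_derive s (1 : R) (fun s => ip (U s) nv) (ip (phi (U s)) nv).
  move=> hs; have Du := (is_derive_mxP _ _ _).1 (du' s hs) ord0.
  have -> : (fun s => ip (U s) nv) =
    \sum_j (fun s => u s ord0 j) * cst (ip (triv_inv V a x (delta_mx ord0 j)) nv).
    by apply/funext => y; rewrite ipu fct_sumE.
  apply: is_derive_eq.
  rewrite -[in RHS](@trivK _ _ _ _ _ V _ _ ax (phi (U s))) {2}(row_sum_delta (triv a (phi (U s)))).
  rewrite triv_inv_sum // ip_suml; apply: eq_bigr => j _.
  by rewrite triv_invZ // ipZl scaler0 add0r /GRing.scale /= mulrC.
have [s hs] := MVT_derive th_t dip.
rewrite subKr => emvt.
have := slow s hs; rewrite -(ler_pM2r h0) -emvt.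
have -> : U (t - h) = ch by rewrite /U u0 /z0 trivK.
move=> low.
have cs1 := ip_le_norm (f (t - h) x - ch) nv; rewrite ipBl -/d0 in cs1.
have cs2 := ip_le_norm (f t x - f (t - h) x - h *: ft) nv; rewrite !ipBl ipZl -/d0 in cs2.
have b1 := ler_wpM2r (ltW d00) (ltW dch).
have b2 := ler_wpM2r (ltW d00) Hh2.
have dle' := ler_wpM2r (ltW h0) dle; rewrite mul0r ipBl in dle'.
have nn : ip (f t x) nv - ip v nv = d0 ^+ 2 by rewrite -ipBl ip_norm.
rewrite ipBl in supp.
(* Pair f t - U t = (f t - f (t-h)) + (f (t-h) - ch) - (U t - ch) with n. The left side gives at
   least d0^2 because U t lies in C t; on the right, in order, enter the Taylor estimate, the choice
   of ch and the lower bound [slow]. *)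
have fin : h * d0 * (kap * d0) <= h * d0 * (2 * eta + K * (d0 + eta)) by lra.
have hd : 0 < h * d0 by rewrite mulr_gt0.
rewrite ler_pM2l // in fin.
lra.
Qed.

End TimeStep.

(** * Uniform estimates and the weighted maximum *)

Section MaximumTime.
Context {R : realType} {n r : nat} {M : topologicalType} {A : bd_atlas R n M}.
Hypothesis M_compact : compact [set: M].
Variables (V : metric_bundle A r) (T : R) (T_gt0 : 0 < T).
Variable f : R -> forall x, fiber V x.
Hypothesis f_smooth : smooth_family T f.

Lemma uniform_lipschitz (phi : forall x, fiber V x -> fiber V x) t1 :
  locally_lipschitz phi -> 0 <= t1 <= T ->
  exists2 L : R, 0 < L & forall x t, 0 <= t <= T -> `|t - t1| < L^-1 ->
    forall v v' : fiber V x, `|v - f t x| < L^-1 -> `|v' - f t x| < L^-1 ->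
      `|phi x v - phi x v'| <= L * `|v - v'|.
Proof.
move=> phiL tT; move/compact_near_coveringP: M_compact => cM.
pose P (L : R) (x : M) := forall t, 0 <= t <= T -> `|t - t1| < L^-1 ->
    forall v v' : fiber V x, `|v - f t x| < L^-1 -> `|v' - f t x| < L^-1 ->
      `|phi x v - phi x v'| <= L * `|v - v'|.
have H : \forall L \near +oo, [set: M] `<=` P L.
  apply: cM => x _; have [L0 HL] := phi_lipschitz_near phiL f_smooth x tT.
  exists ([set y | forall L t, L0 < L -> 0 <= t <= T -> `|t - t1| < L^-1 ->
    forall v v' : fiber V y, `|v - f t y| < L^-1 -> `|v' - f t y| < L^-1 ->
      `|phi y v - phi y v'| <= L * `|v - v'|], [set L | L0 < L]) => /=.
    by split; [exact: HL|exact: (nbhs_pinfty_gt (num_real L0))].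
  by move=> [y L] /= [Hy L0L] t; exact: Hy.
have L0 : \forall L \near +oo, 0 < (L : R) by exact: nbhs_pinfty_gt.
have [L [HL Lgt0]] := @filter_ex _ (pinfty_nbhs R) _ _ (filterI H L0).
by exists L => // x; exact: HL.
Qed.

Variable d : total_space V -> total_space V -> R.
Hypothesis d_metric : total_metric d.
Variable C : R -> set (total_space V).
Hypothesis C_closed : forall t, 0 <= t <= T -> total_closed (C t).
Hypothesis C_cont : pointed_hausdorff_continuous d T C.
Variable D : chart A -> R -> 'rV[R]_n -> 'I_n -> 'M[R]_r.
Hypothesis D_metric : is_metric_connection V T D.
Hypothesis C_par : forall t, 0 <= t <= T -> parallel_invariant (fun a => D a t) (C t).

(** Just after the first exit this gives nonempty fibers, on which [dist_set] is meaningful, and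
    keeps f within the radius where phi is uniformly Lipschitz. *)
Lemma uniform_near t1 (e : R) : 0 <= t1 <= T -> (forall x, C t1 (TotalPt (f t1 x))) ->
  0 < e -> exists2 del : R, 0 < del & forall x t, 0 <= t <= T -> `|t - t1| < del ->
    exists2 c, fib (C t) x c & `|f t x - c| < e.
Proof.
move=> tT Cf e0; move/compact_near_coveringP: M_compact => cM.
pose P (t : R) (x : M) := 0 <= t <= T -> exists2 c, fib (C t) x c & `|f t x - c| < e.
have H : \forall t \near t1, [set: M] `<=` P t.
  apply: (cM _ (nbhs t1) P) => x _; rewrite /P.
  have := dist_usc d_metric C_cont f_smooth D_metric C_par tT (Cf x) e0.
  by rewrite subrr normr0 add0r; apply.
move/nbhs_ballP: H => [del del0 Hd]; exists del => // x t tT' tt.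
by apply: (Hd t) => //; rewrite -ball_normE /= distrC.
Qed.

Lemma max_distE t x : (forall y, dist_at C f t y <= dist_at C f t x) ->
  max_dist C f t = dist_at C f t x.
Proof.
move=> H; apply/le_anti/andP; split.
  by apply: ge_sup => [|_ [y _ <-]]; [exists (dist_at C f t x), x|exact: H].
by apply: ub_le_sup; [exists (dist_at C f t x) => _ [y _ <-]; exact: H|exists x].
Qed.

Lemma dist_at_gt0 t x : 0 <= t <= T -> fib (C t) x !=set0 ->
  ~ C t (TotalPt (f t x)) -> 0 < dist_at C f t x.
Proof.
move=> tT Cne nC; have [v [Cv dv]] := nearest_exists (f t x) (C_closed tT) Cne.
rewrite /dist_at -dv normr_gt0 subr_eq0; apply/eqP => fv.
by apply: nC; rewrite fv.
Qed.

(** On the window the weight lies in [1/2, 1], so the weighted maximum is positive exactly when some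
    distance is. It will be applied with 2L in place of L. *)
Lemma weighted_max S t1 (L : R) : 0 <= S -> S <= t1 -> t1 <= T ->
  0 < L -> t1 - S <= (2 * L)^-1 ->
  (forall x t, S <= t <= t1 -> fib (C t) x !=set0) ->
  (exists x, 0 < dist_at C f t1 x) ->
  let w t := 1 - L * (t - S) in
  exists x0 t0, [/\ S <= t0 <= t1, 0 < dist_at C f t0 x0 &
    forall x t, S <= t <= t1 -> dist_at C f t x * w t <= dist_at C f t0 x0 * w t0].
Proof.
move=> S0 St1 t1T L0 Lt1 Cne [x1 x1pos] w.
have wbd t : S <= t <= t1 -> 2^-1 <= w t <= 1.
  move=> /andP[St tt1]; rewrite /w; apply/andP; split; last first.
    by rewrite gerBl mulr_ge0 ?(ltW L0) // subr_ge0.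
  have : L * (t - S) <= L * (2 * L)^-1 by rewrite ler_pM2l //; lra.
  have -> : L * (2 * L)^-1 = 2^-1 by field; rewrite gt_eqF.
  lra.
pose K := [set: M] `*` `[S, t1].
pose u (z : M * R) := dist_at C f z.2 z.1 * w z.2.
have cK : compact K by apply: compact_setX M_compact _; exact: segment_compact.
have t1i : S <= t1 <= t1 by rewrite St1 lexx.
have Kt1 : K (x1, t1) by split => //=; rewrite in_itv.
(* Half of e pays for the distance, the other half for the weight, which is Lipschitz in time. *)
have usc z e : K z -> 0 < e -> \forall y \near z, K y -> u y < u z + e.
  case: z => x t [_ /=]; rewrite in_itv /= => tSt1 e0.
  have tT : 0 <= t <= T by lra.
  have [v [Cv dv]] := nearest_exists (f t x) (C_closed tT) (Cne x t tSt1).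
  have e2 : 0 < e / 2 by rewrite divr_gt0.
  have H1 := dist_usc d_metric C_cont f_smooth D_metric C_par tT Cv e2.
  set d0 := dist_at C f t x; have d00 : 0 <= d0 by exact: dist_set_ge0.
  have q0 : 0 < e / 2 / (L * d0 + 1) by rewrite divr_gt0 // ltr_wpDl // mulr_ge0 // ltW.
  have H2 : \forall y \near (x, t), `|t - y.2| < e / 2 / (L * d0 + 1).
    exists ([set: M], ball t (e / 2 / (L * d0 + 1))).
      by split => /=; [exact: filterT|exact: nbhsx_ballx].
    by move=> [y s] [/= _]; rewrite -ball_normE.
  apply: filterS2 H1 H2 => -[y s] /= H1 H2 [_ /=]; rewrite in_itv /= => sSt1.
  have sT : 0 <= s <= T by lra.
  have [c' Cc' dc'] := H1 sT.
  have dy : dist_at C f s y < d0 + e / 2.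
    by apply: le_lt_trans (dist_set_le _ Cc') _; rewrite /d0 /dist_at -dv.
  have /andP[ws0 ws1] := wbd s sSt1.
  rewrite /u /= -/d0.
  have h1 : dist_at C f s y * w s < (d0 + e / 2) * w s by rewrite ltr_pM2r //; lra.
  have h2 : e / 2 * w s <= e / 2 by rewrite ler_piMr // ltW.
  have h3 : d0 * w s - d0 * w t <= e / 2.
    have -> : d0 * w s - d0 * w t = L * d0 * (t - s) by rewrite /w; ring.
    apply: (@le_trans _ _ ((L * d0 + 1) * `|t - s|)); last first.
      by rewrite mulrC -ler_pdivlMr ?(ltW H2) // ltr_wpDl // mulr_ge0 // ltW.
    apply: (@le_trans _ _ (L * d0 * `|t - s|)).
      by rewrite ler_wpM2l ?ler_norm // mulr_ge0 // ltW.
    by rewrite ler_wpM2r // lerDl.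
  lra.
have [[x0 t0] [_ /=]] := usc_max cK (ex_intro _ _ Kt1) usc.
rewrite in_itv /= => t0i umax; exists x0, t0.
have mx x t : S <= t <= t1 -> dist_at C f t x * w t <= dist_at C f t0 x0 * w t0.
  by move=> ti; apply: (umax (x, t)); split => //=; rewrite in_itv.
split => //; have /andP[w0 _] := wbd t0 t0i; have /andP[w1 _] := wbd t1 t1i.
have w0p : 0 < w t0 by lra.
rewrite -(pmulr_lgt0 _ w0p); apply: lt_le_trans (mx x1 t1 t1i).
by rewrite mulr_gt0 //; lra.
Qed.

End MaximumTime.

(** * The first exit time and the contradiction *)

Theorem theorem2p1 (R : realType) (n r : nat) (M : topologicalType)
  (M_compact : compact [set: M]) (M_hausdorff : hausdorff_space M)
  (A : bd_atlas R n M) (V : metric_bundle A r) (T : R) (T_gt0 : 0 < T)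
  (g : chart A -> R -> 'rV[R]_n -> 'M[R]_n)
  (g_riemannian : is_riemannian T g)
  (N : chart A -> R -> 'rV[R]_n -> 'I_n -> 'M[R]_n)
  (N_levi_civita : is_levi_civita T g N)
  (D : chart A -> R -> 'rV[R]_n -> 'I_n -> 'M[R]_r)
  (D_metric : is_metric_connection V T D)
  (phi : forall x, fiber V x -> fiber V x)
  (phi_lipschitz : locally_lipschitz phi)
  (d : total_space V -> total_space V -> R) (d_metric : total_metric d)
  (C : R -> set (total_space V))
  (C_closed : forall t, 0 <= t <= T -> total_closed (C t))
  (C_cont : pointed_hausdorff_continuous d T C)
  (C_parallel : forall t, 0 <= t <= T ->
    parallel_invariant (fun a => D a t) (C t))
  (C_convex : forall t x, 0 <= t <= T -> convex_set (fib (C t) x))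
  (C_ode : ode_preserves T phi C)
  (f : R -> forall x, fiber V x)
  (f_smooth : smooth_family T f)
  (f_interior : forall t x, 0 < t -> t <= T ->
    0 < max_dist C f t -> dist_at C f t x = max_dist C f t ->
    forall v, nearest (f t x) (fib (C t) x) v ->
    exists (a : chart A) (k l : nat) (X : 'I_k -> 'rV[R]_n -> 'rV[R]_n)
           (Y : 'I_l -> 'rV[R]_n -> 'rV[R]_n),
      [/\ chart_dom a x,
          forall i, local_field a x (X i),
          forall j, local_field a x (Y j)
        & let p := chart_coord a x in
          let s := local_section a (f t) in
          tangent_cone (fib (C t) x) v
            (time_deriv T f t x
             - triv_inv V a x
                 (\sum_(i < k) cov2 a (N a t) (D a t) (X i) (X i) s p)
             - triv_inv V a x (\sum_(j < l) cov a (D a t) (Y j) s p)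
             - phi x (f t x))])
  (f_boundary : forall t x, 0 <= t <= T -> boundary A x ->
    dist_at C f t x = max_dist C f t -> 0 < max_dist C f t ->
    forall v, nearest (f t x) (fib (C t) x) v ->
    forall (a : chart A) (nu : 'rV[R]_n), chart_dom a x ->
      outer_unit_normal g a t (chart_coord a x) nu ->
      tangent_cone (fib (C t) x) v
        (triv_inv V a x
           (cov_vec a (D a t) nu (local_section a (f t)) (chart_coord a x)))) :
  (forall x, C 0 (TotalPt (f 0 x))) ->
  forall x t, 0 < t -> t <= T -> C t (TotalPt (f t x)).
Proof.
move=> f0 x t t_gt0 tT; apply: contrapT => nCt.
have C_par s : 0 <= s <= T -> parallel_invariant (fun a => D a s) (C s).
  by move=> sT; exact: C_parallel.
pose bad := [set s | 0 <= s <= T /\ exists y, ~ C s (TotalPt (f s y))].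
have bad0 : bad !=set0 by exists t; split; [lra|exists x].
have bad_lb : lbound bad 0 by move=> s [/andP[]].
pose S := inf bad.
have S0 : 0 <= S by exact: lb_le_inf.
have S_lb s : bad s -> S <= s by move=> bs; apply: ge_inf => //; exists 0.
have ST : S <= T by apply: (le_trans (S_lb t _)) => //; split; [lra|exists x].
have STi : 0 <= S <= T by rewrite S0.
(* The infimum of the bad times is itself good: by the initial condition if S = 0, and otherwise as
   a limit of earlier times, none of which is bad. *)
have CS y : C S (TotalPt (f S y)).
  have [->|Sn0] := eqVneq S 0; first exact: f0.
  have Sp : 0 < S by rewrite lt_neqAle eq_sym Sn0.
  apply: (@family_limit_mem _ _ _ _ _ _ _ _ d_metric _ C_cont _ f_smooth _ _ STi).
    exact: C_closed.
  move=> e e0.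
  pose m := Num.min S e; have m0 : 0 < m by rewrite lt_min Sp.
  have mS : m <= S by rewrite ge_min lexx.
  have me : m <= e by rewrite ge_min lexx orbT.
  clearbody m; have sT : 0 <= S - m / 2 <= T by lra.
  exists (S - m / 2); split => //.
    by rewrite addrAC subrr add0r normrN gtr0_norm ?divr_gt0 //; lra.
  apply: contrapT => nC; have := S_lb _ (conj sT (ex_intro _ y nC)); lra.
have [L L0 HL] := uniform_lipschitz M_compact f_smooth phi_lipschitz STi.
have Li0 : 0 < L^-1 by rewrite invr_gt0.
have [e e0 He] := uniform_near M_compact f_smooth d_metric C_cont D_metric C_par STi CS Li0.
(* The bound e keeps f uniformly near C; 1/(4L) is the window of [weighted_max] for the rate 2L, and
   lies below the time window 1/L of the Lipschitz estimate. *)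
pose m := Num.min e (4 * L)^-1.
have m0 : 0 < m by rewrite lt_min e0 invr_gt0 mulr_gt0.
have [t1 [t1T [y1 ny1]] t1m] : exists2 s, bad s & s < S + m.
  by apply: inf_lt => //; rewrite ltrDl.
have St1 : S <= t1 by apply: S_lb; split => //; exists y1.
have t1e : t1 - S < e.
  by rewrite ltrBlDl; apply: lt_le_trans t1m _; rewrite lerD2l ge_min lexx.
have t1L : t1 - S <= (2 * (2 * L))^-1.
  rewrite lerBlDl; apply: le_trans (ltW t1m) _; rewrite lerD2l ge_min mulrA -natrM.
  by rewrite lexx orbT.
have LL : (2 * (2 * L))^-1 < L^-1.
  by rewrite ltf_pV2 ?posrE //; lra.
clearbody m.
have near_C y s : S <= s <= t1 -> exists2 c, fib (C s) y c & `|f s y - c| < L^-1.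
  move=> si; apply: He; first lra.
  by rewrite ger0_norm; lra.
have Cne y s : S <= s <= t1 -> fib (C s) y !=set0.
  by move=> si; have [c Cc _] := near_C y s si; exists c.
have t1i : S <= t1 <= t1 by rewrite St1 lexx.
have L2 : 0 < 2 * L by rewrite mulr_gt0.
have [x0 [t0 [t0i d0 umax]]] := weighted_max M_compact f_smooth d_metric C_closed C_cont
  D_metric C_par S0 St1 (andP t1T).2 L2 t1L Cne
  (ex_intro _ y1 (dist_at_gt0 C_closed t1T (Cne y1 t1 t1i) ny1)).
(* At time S the distance vanishes, while the maximum is positive. *)
have St0 : S < t0.
  have /andP[St0 _] := t0i; rewrite lt_neqAle St0 andbT; apply/eqP => St0e.
  have := dist_set_le (f t0 x0) (CS x0 : fib (C S) x0 (f S x0)).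
  by rewrite St0e subrr normr0; move: d0; rewrite /dist_at; lra.
have t0p : 0 < t0 by lra.
have t0T : t0 <= T by lra.
have t0T' : 0 <= t0 <= T by lra.
have w0 : 0 < 1 - 2 * L * (t0 - S).
  have : 2 * L * (t0 - S) <= 2 * L * (2 * (2 * L))^-1 by rewrite ler_pM2l //; lra.
  have -> : 2 * L * (2 * (2 * L))^-1 = 2^-1 :> R by field; rewrite gt_eqF.
  lra.
have dmax y : dist_at C f t0 y <= dist_at C f t0 x0.
  by have := umax y t0 t0i; rewrite ler_pM2r.
have dE := max_distE dmax.
have [v vn] := nearest_exists (f t0 x0) (C_closed t0 t0T') (Cne x0 t0 t0i).
have [Cv dv] := vn; pose nv := f t0 x0 - v.
have nC0 : ~ fib (C t0) x0 (f t0 x0).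
  by move=> /(dist_set_le (f t0 x0)); rewrite subrr normr0; move: d0; rewrite /dist_at; lra.
(* The tangent cone condition is tested with x1 = f(x0, t0), which lies outside C and realises its
   distance at v. *)
have cone xi : tangent_cone (fib (C t0) x0) v xi -> ip xi nv <= 0.
  move=> /(_ (f t0 x0) nC0 dv); rewrite -opprB -/nv -scaleN1r ip_sym ipZl ip_sym.
  lra.
have dpos : 0 < max_dist C f t0 by rewrite dE.
have [a [k [l [X [Y [ax X_loc Y_loc]]]]]] := f_interior t0 x0 t0p t0T dpos (esym dE) v vn.
move=> /cone.
have f_loc : smooth_on (chart_img a) (local_section a (f t0)).
  have ST0 : seg 0 T (t0 : R^o) by [].
  exact: (smooth_on_slice ST0 (f_smooth a)).
have bd : boundary A x0 -> forall u, outer_unit_normal g a t0 (chart_coord a x0) u ->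
    fip V a (chart_coord a x0)
      (cov_vec a (D a t0) u (local_section a (f t0)) (chart_coord a x0)) (triv a nv) <= 0.
  move=> bx u unu; have := f_boundary t0 x0 t0T' bx (esym dE) dpos v vn a u ax unu.
  by move/cone; rewrite fip_center // trivK.
have ell := spatial_elliptic D_metric t0T' (C_par t0 t0T') (C_convex t0 x0 t0T')
  (fun y => Cne y t0 t0i) f_loc ax vn dmax d0 g_riemannian bd (N a t0) Y X_loc.
rewrite !ipBl -/nv => cone0.
apply: (@time_step _ _ _ _ _ V T T_gt0 phi f f_smooth C C_ode x0 t0 v L L^-1 (2 * L)) => //.
- by rewrite t0p.
- exact: C_convex.
- by rewrite dv.
- have [c Cc dc] := near_C x0 t0 t0i; rewrite dv.
  by apply: le_lt_trans (dist_set_le _ Cc) dc.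
- by move=> u u'; apply: HL => //; rewrite ger0_norm; lra.
- by rewrite ipBl -/nv; move: ell cone0; rewrite /= -/nv; lra.
- lra.
exists (t0 - S); first by rewrite subr_gt0.
move=> h h0 hS; have hi : S <= t0 - h <= t1 by lra.
split; first exact: Cne.
have := umax x0 (t0 - h) hi; rewrite dv -/(dist_at C f (t0 - h) x0) -/(dist_at C f t0 x0) => um.
have w1 : 0 < 1 - 2 * L * (t0 - h - S) by move: (mulr_gt0 L2 h0); lra.
rewrite -(ler_pM2r w1); apply: le_trans um _; rewrite -[X in _ <= X]mulrA ler_pM2l //.
(* With w the weight, (1 - 2Lh) w(t0 - h) - w(t0) equals this product, so the ratio of the weights
   is at most 1 - 2Lh. *)
have : 0 <= (2 * L * h) * (2 * L * (t0 - h - S)) by rewrite !mulr_ge0 ?(ltW L0) ?(ltW h0) //; lra.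
lra.
Qed.
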